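(* Suppose $Z^n\in D(\delta^n)$ for every $n\in\mathbb{N}$, and $(Z^n_{\lceil n\cdot\rceil})_{n\in\mathbb{N}}$ converges to $Z$ weakly in $L^2(\Omega\times[0,\infty))$. Then the following assertions are equivalent: (i) $\sup_{n\in\mathbb{N}}\mathbb{E}[|\delta^n(Z^n)|^2]<\infty$. (ii) $Z\in D(\delta)$ and $(\delta^n(Z^n))$ converges to $\delta(Z)$ weakly in $L^2(\Omega,\mathcal{F},P)$ as $n$ tends to infinity.
   Context: Setting: $(\Omega,\mathcal{F},P)$ is a probability space carrying a Brownian motion $B=(B_t)_{t\ge 0}$, where $\mathcal{F}$ is the $\sigma$-field generated by $B$, completed by null sets. $\xi$ is a square-integrable random variable with zero expectation and variance one. For each $n\in\mathbb{N}=\{1,2,\dots\}$, $(\xi^n_i)_{i\in\mathbb{N}}$ is a sequence of independent random variables on $(\Omega,\mathcal{F},P)$ with the same distribution as $\xi$, and $B^n_t=\frac{1}{\sqrt n}\sum_{i=1}^{\lfloor nt\rfloor}\xi^n_i$. Standing assumption: for every $t\ge 0$, $B^n_t\to B_t$ in probability as $n\to\infty$. $\mathcal{F}^n=\sigma(\xi^n_i, i\in\mathbb{N})$ and $\mathcal{F}^n_{M,-i}=\sigma(\xi^n_j, j\in\{1,\dots,M\}\setminus\{i\})$. $\mathcal{E}$ is the set of step functions $g=\sum_{j=1}^m a_j\mathbf{1}_{(b_j,c_j]}$, $m\in\mathbb{N}$, $a_j,b_j,c_j\in\mathbb{R}$ (regarded as functions on $[0,\infty)$). $I(f)$ is the Wiener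 integral of $f\in L^2([0,\infty))$ with respect to $B$, $\exp^{\diamond}(I(f))=\exp\left(I(f)-\frac12\int_0^\infty f(s)^2ds\right)$, and $(SX)(f)=\mathbb{E}[X\exp^{\diamond}(I(f))]$ for $X\in L^2(\Omega,\mathcal{F},P)$. $L^2(\Omega\times[0,\infty))=L^2(\Omega\times[0,\infty),\mathcal{F}\otimes\mathcal{B}([0,\infty)),P\otimes\lambda)$ with $\lambda$ Lebesgue measure. Skorokhod integral: $Z\in L^2(\Omega\times[0,\infty))$ belongs to $D(\delta)$ if there is $X\in L^2(\Omega,\mathcal{F},P)$ with $(SX)(g)=\int_0^\infty (SZ_t)(g)g(t)dt$ for every $g\in\mathcal{E}$; then $X$ is unique and $\delta(Z):=X$. $L^2_n(\Omega\times\mathbb{N})$ is the space of $Z^n:\mathbb{N}\to L^2(\Omega,\mathcal{F}^n,P)$ with $\frac1n\sum_{i\ge1}\mathbb{E}[(Z^n_i)^2]<\infty$; convention $Z^n_0=0$. Discrete Skorokhod integral: $Z^n\in L^2_n(\Omega\times\mathbb{N})$ belongs to $D(\delta^n)$ if $\delta^n(Z^n):=\lim_{M\to\infty}\sum_{i=1}^M\mathbb{E}[Z^n_i|\mathcal{F}^n_{M,-i}]\frac{\xi^n_i}{\sqrt n}$ exists strongly in $L^2(\Omega,\mathcal{F},P)$. $Z^n_{\lceil n\cdot\rceil}$ denotes the process $t\mapsto Z^n_{\lceil nt\rceil}$. *)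

(* Defs.v *)
(* MathComp / MathComp-Analysis *)
From HB Require Import structures.
#[warnings="-notation-incompatible-prefix,-notation-overridden,-ambiguous-paths"]
From mathcomp Require Export all_boot all_order all_algebra finmap.
#[warnings="-notation-incompatible-prefix,-notation-overridden,-ambiguous-paths"]
From mathcomp Require Export all_classical all_reals all_analysis.

Set Implicit Arguments.
Unset Strict Implicit.
Unset Printing Implicit Defensive.

Import Order.TTheory GRing.Theory Num.Theory.
Import numFieldNormedType.Exports.

Local Open Scope classical_set_scope.
Local Open Scope ring_scope.

Section sigma_fields.
Context {d : measure_display} {T : measurableType d} {R : realType}.
Variable P : probability T R.

Definition sigma_gen (I : Type) (D : set I) (X : I -> T -> R) : set (set T) :=
  <<s \bigcup_(i in D) preimage_set_system setT (X i) measurable >>.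

(* [P.-negligible] sets are the subsets of measurable sets of measure zero. *)
Definition null_completion (G : set (set T)) : set (set T) :=
  [set A `|` N | A in G & N in P.-negligible].

Definition measurable_wrt (G : set (set T)) (X : T -> R) :=
  forall U : set R, measurable U -> G (X @^-1` U).

(* [Y] is a version of the conditional expectation E[X | G]. *)
Definition cond_exp (G : set (set T)) (X Y : T -> R) :=
  [/\ measurable_wrt G Y,
      P.-integrable setT (EFin \o Y) &
      forall A, G A -> (\int[P]_(w in A) (Y w)%:E = \int[P]_(w in A) (X w)%:E)%E].

Definition mutual_indep (I : choiceType) (D : set I) (X : I -> T -> R) :=
  forall (J : {fset I}) (A : I -> set R),
    [set` J] `<=` D -> (forall i, measurable (A i)) ->
    P (\bigcap_(i in [set` J]) X i @^-1` A i)
      = (\prod_(i <- J) P (X i @^-1` A i))%E.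

Definition identically_distributed (X Y : {RV P >-> R}) :=
  forall A : set R, measurable A -> distribution P X A = distribution P Y A.

Definition cvg_in_probability (X_ : nat -> T -> R) (X : T -> R) :=
  forall e : R, 0 < e ->
    P [set w | e < `|X_ n w - X w| ] @[n --> \oo] --> 0%E.

End sigma_fields.

Section L2_convergence.
Context {d : measure_display} {S : measurableType d} {R : realType}.
Variable mu : {measure set S -> \bar R}.

Definition strong_cvg (X_ : nat -> S -> R) (X : S -> R) :=
  'N[mu]_2%:E [EFin \o (fun x => X_ n x - X x)%R]%E @[n --> \oo] --> 0%E.

Definition weak_cvg (X_ : nat -> S -> R) (X : S -> R) :=
  forall Y, Y \in Lfun mu 2%:E ->
    \int[mu]_x (X_ n x * Y x) @[n --> \oo] --> \int[mu]_x (X x * Y x).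

End L2_convergence.

Section continuous_time.
Context {d : measure_display} {T : measurableType d} {R : realType}.
Variables (P : probability T R) (B : R -> {RV P >-> R}).

Notation leb := (@lebesgue_measure R).

(* Only the values [B t] for [0 <= t] matter; the second parameter of
   [normal_prob] is the standard deviation. *)
Definition brownian_motion :=
  [/\ {ae P, forall w, B 0 w = 0},
      {ae P, forall w, {within `[0, +oo[, continuous (fun t => B t w)}},
      (forall s t : R, 0 <= s -> s < t -> forall A : set R, measurable A ->
        P ((fun w => B t w - B s w) @^-1` A)
          = normal_prob 0 (Num.sqrt (t - s)) A) &
      (forall t : nat -> R, 0 <= t 0%N ->
        {homo t : i j / (i <= j)%N >-> i <= j} ->
        mutual_indep P setT (fun i w => B (t i.+1) w - B (t i) w))].

(* Functions on [0, +oo[ and processes indexed by [0, +oo[ are handled as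
   functions on R and on T * R that vanish at negative times. *)
Definition half_line (f : R -> R) : R -> R := f \_ `[0, +oo[.

Definition half_line_process (Z : R -> T -> R) : T * R -> R :=
  (fun z => Z z.2 z.1) \_ ([set: T] `*` `[0, +oo[).

Definition time_product : {measure set (T * measurableTypeR R) -> \bar R} := (P \x leb)%E.

(* A list of triples (a, b, c) encodes the sum of the a * 1_(b, c]. *)
Definition step_fun (s : seq (R * R * R)) (t : R) : R :=
  \sum_(p <- s) p.1.1 * \1_(`]p.1.2, p.2]%classic) t.

Definition is_step_fun (g : R -> R) :=
  exists s : seq (R * R * R), g = step_fun s.

(* Integral of [step_fun s] over [0, +oo[: the intervals are cut at 0, and an
   empty interval (c < b) contributes 0. *)
Definition step_integral (s : seq (R * R * R)) (w : T) : R :=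
  \sum_(p <- s) p.1.1 *
    (if p.1.2 <= p.2 then B (Num.max 0 p.2) w - B (Num.max 0 p.1.2) w else 0).

(* [X] is a version of the Wiener integral I(f): the L2-limit of the integrals
   of step functions that approximate [f]. *)
Definition is_wiener_integral (f : R -> R) (X : T -> R) :=
  [/\ half_line f \in Lfun leb 2%:E, X \in Lfun P 2%:E &
      exists2 s_ : nat -> seq (R * R * R),
        strong_cvg leb (fun k => half_line (step_fun (s_ k))) (half_line f) &
        strong_cvg P (fun k => step_integral (s_ k)) X].

(* A chosen version, for f in L2([0, +oo[); the value 0 is used otherwise. *)
Definition wiener_integral (f : R -> R) : T -> R :=
  xget (fun=> 0) [set X | is_wiener_integral f X].

Definition wick_exp (f : R -> R) (w : T) : R :=
  expR (wiener_integral f w - 2^-1 * \int[leb]_(s in `[0, +oo[) f s ^+ 2).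

Definition S_transform (X : T -> R) (f : R -> R) : R :=
  fine ('E_P[(fun w => X w * wick_exp f w)%R])%E.

(* Z is in the domain of the Skorokhod integral and X is a version of its
   integral. *)
Definition skorokhod_integral (Z : R -> T -> R) (X : T -> R) :=
  [/\ half_line_process Z \in Lfun time_product 2%:E, X \in Lfun P 2%:E &
      forall g, is_step_fun g ->
        S_transform X g
          = \int[leb]_(t in `[0, +oo[) (S_transform (Z t) g * g t)].

End continuous_time.

(* The index 0 of the sequences below is never used: they are indexed by
   {1, 2, ...}. *)
Section discrete_time.
Context {d : measure_display} {T : measurableType d} {R : realType}.
Variable P : probability T R.

(* B^n, built from the noise xi^n. *)
Definition random_walk (n : nat) (xi : nat -> T -> R) (t : R) (w : T) : R :=
  (Num.sqrt n%:R)^-1 *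
    \sum_(1 <= i < `|Num.floor (n%:R * t)|%N.+1) xi i w.

Definition noise_field (xi : nat -> T -> R) : set (set T) :=
  sigma_gen [set i | (0 < i)%N] xi.

Definition noise_field_without (xi : nat -> T -> R) (M i : nat) :
    set (set T) :=
  sigma_gen [set j | (0 < j <= M)%N && (j != i)] xi.

Definition discrete_L2 (n : nat) (xi : nat -> T -> R) (Z : nat -> T -> R) :=
  (forall i, (0 < i)%N ->
     measurable_wrt (noise_field xi) (Z i) /\ Z i \in Lfun P 2%:E) /\
  ((n%:R^-1)%:E * (\sum_(1 <= i <oo) 'E_P[(fun w => Z i w ^+ 2)%R]) < +oo)%E.

(* Z is in the domain of the discrete Skorokhod integral and X is a version of
   its integral; C M i is a version of E[Z_i | F_{M,-i}], unique up to null
   sets. *)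
Definition discrete_skorokhod_integral (n : nat) (xi : nat -> T -> R)
    (Z : nat -> T -> R) (X : T -> R) :=
  [/\ discrete_L2 n xi Z, X \in Lfun P 2%:E &
      exists2 C : nat -> nat -> T -> R,
        (forall M i, (0 < i <= M)%N ->
          cond_exp P (noise_field_without xi M i) (Z i) (C M i)) &
        strong_cvg P (fun M w =>
          \sum_(1 <= i < M.+1) C M i w * (xi i w / Num.sqrt n%:R)) X].

(* The process t |-> Z_{ceil (n t)}, with the convention Z_0 = 0. *)
Definition embed_process (n : nat) (Z : nat -> T -> R) (t : R) (w : T) : R :=
  let k := `|Num.ceil (n%:R * t)|%N in if k == 0%N then 0 else Z k w.

End discrete_time.

(* Main.v *)
Require Import Defs.
From HB Require Import structures.
From mathcomp Require Import all_boot all_order all_algebra.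
From mathcomp Require Import all_classical all_reals all_analysis.
From mathcomp Require Import measurable_realfun ring lra.

(** A weakly convergent sequence in a Hilbert space is bounded
    ([uniform_boundedness]), so the second assertion implies the first.

    Conversely, for a bounded sequence it is enough to pair the discrete
    integrals with a total family and to find the limits of the pairings
    ([weak_cvg_total]). The family is that of the Wick exponentials
    W = exp(I(g) - |g|^2 / 2) of step functions g ([step_wick_total]). The
    limit that has to come out is the double integral of Z W g over events and
    times: by Fubini it is the right-hand side of the relation that defines the
    Skorokhod integral ([Rint_pairing_S_transform]), so it both shows that the
    sequence converges weakly and identifies its limit.

    The discrete counterpart of W is the product D over i of the factors
    1 + g(i/n) xi_i / sqrt n. Independence and E[xi (1 + a xi)] = a give, for
    each n, the exact formula: E[delta^n(Z^n) D] is the mean over the grid of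
    g(i/n) E[Z^n_i D_i], where D_i is D without its i-th factor
    ([discrete_duality]). Deleting a factor costs only O(1 / sqrt n) in norm
    ([wick_prod_omit_dist]). As D converges to W in L2, the formula turns into
    the double integral of Z^n W g up to o(1) ([duality_error]), and the weak
    convergence of Z^n concludes ([Rint_delta_wick_cvg]).

    Convergence of D to W in probability comes from the expansion
    log(1 + x) = x - x^2 / 2 + O(x^3): the linear terms sum up to increments of
    the random walk, which tend to I(g), and the squares to |g|^2 by a truncated
    weak law of large numbers ([wick_prod_cvg_in_probability]). In L2 it
    comes from the norms. The second moments of D are bounded for every g, so
    E[D] = 1 passes to the limit as E[W_g] = 1; since W_g^2 is exp(|g|^2) times
    W_(2g), also E[W_g^2] = exp(|g|^2), which bounds the second moments of D in
    the limit ([discrete_wick_cvg_L2]).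

    For totality, let Y be orthogonal to all exponentials exp(X) of linear
    combinations X of values of the Brownian motion. Powers of
    3 - exp(h X) - exp(-h X), for small h, approximate Gaussian functions of X
    ([gaussian_damping]), and functions (1 - exp(- n g (X - a)^2))^m approximate
    indicators of half-lines ([smooth_step_cvg]). So the orthogonality survives
    the multiplication of Y by an event X in A ([wick_orthogonal_indic]), hence
    by any cylinder, and Y is orthogonal to the whole sigma-field. *)

Import Order.TTheory GRing.Theory Num.Theory.
Import numFieldNormedType.Exports.

Local Open Scope classical_set_scope.
Local Open Scope ring_scope.

Set Implicit Arguments.
Unset Strict Implicit.
Unset Printing Implicit Defensive.

(** * Weak convergence in an abstract Hilbert space *)

Lemma cvgr_dist_squeeze (R : realType) (u v : nat -> R) (l : R) :
  (forall n, `|u n - l| <= v n) -> v n @[n --> \oo] --> (0 : R) ->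
  u n @[n --> \oo] --> l.
Proof.
move=> uv v0; apply: (@squeeze_cvgr _ _ _ _ (fun n => l - v n) (fun n => l + v n)).
- apply: nearW => n; have := uv n; rewrite ler_norml => /andP[? ?].
  by apply/andP; split; lra.
- by rewrite -[X in _ --> X]subr0; apply: cvgB => //; exact: cvg_cst.
- by rewrite -[X in _ --> X]addr0; apply: cvgD => //; exact: cvg_cst.
Qed.

(** The form is only positive semi-definite: square-integrable functions that
    agree almost everywhere have distance zero without being equal.
    Completeness is asked for sequences whose increments have norm at most
    2^-n; every Cauchy sequence has such a subsequence. *)
Record complete_inner_product (R : realType) (V : lmodType R)
    (ip : V -> V -> R) : Prop := {
  ip_sym : forall x y, ip x y = ip y x ;
  ip_lin : forall a x y z, ip (a *: x + y) z = a * ip x z + ip y z ;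
  ip_ge0 : forall x, 0 <= ip x x ;
  ip_complete : forall u : nat -> V,
    (forall n, ip (u n.+1 - u n) (u n.+1 - u n) <= 4^-1 ^+ n) ->
    exists x, ip (u n - x) (u n - x) @[n --> \oo] --> (0 : R) }.

Section hilbert.
Context (R : realType) (V : lmodType R) (ip : V -> V -> R).
Hypothesis H : complete_inner_product ip.

Lemma ipDl x y z : ip (x + y) z = ip x z + ip y z.
Proof. by rewrite -[x]scale1r (ip_lin H) mul1r scale1r. Qed.

Lemma ip0l z : ip 0 z = 0.
Proof.
have := ipDl 0 0 z; rewrite addr0 => /eqP.
by rewrite -subr_eq subrr eq_sym => /eqP.
Qed.

Lemma ipZl a x z : ip (a *: x) z = a * ip x z.
Proof. by rewrite -[a *: x]addr0 (ip_lin H) ip0l addr0. Qed.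

Lemma ipNl x z : ip (- x) z = - ip x z.
Proof. by rewrite -scaleN1r ipZl mulN1r. Qed.

Lemma ipDr x y z : ip z (x + y) = ip z x + ip z y.
Proof. by rewrite (ip_sym H) ipDl !(ip_sym H z). Qed.

Lemma ipZr a x z : ip z (a *: x) = a * ip z x.
Proof. by rewrite (ip_sym H) ipZl (ip_sym H z). Qed.

Lemma ipNr x z : ip z (- x) = - ip z x.
Proof. by rewrite (ip_sym H) ipNl (ip_sym H z). Qed.

Definition ipE := (ipDl, ipDr, ipZl, ipZr, ipNl, ipNr).

Let nm x := Num.sqrt (ip x x).

Lemma cauchy_schwarz_sqr x y : ip x y ^+ 2 <= ip x x * ip y y.
Proof.
have h t : 0 <= ip x x + 2 * t * ip x y + t ^+ 2 * ip y y.
  have := ip_ge0 H (x + t *: y); rewrite !ipE (ip_sym H y x).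
  by congr (0 <= _); ring.
have xx := ip_ge0 H x.
have := ip_ge0 H y; rewrite le_eqVlt => /predU1P[y0|y0].
  (* If y has norm zero but pairs with x, a large multiple of y makes the form
     negative. *)
  rewrite -y0 mulr0.
  have := h (- (ip x x + 1) / (2 * ip x y)).
  have [->|xy0] := eqVneq (ip x y) 0; first by rewrite expr0n.
  rewrite -y0 mulr0 addr0.
  rewrite (_ : 2 * _ * _ = - (ip x x + 1)); last by field.
  by move=> ?; exfalso; lra.
have := h (- ip x y / ip y y).
rewrite (_ : _ + _ = (ip x x * ip y y - ip x y ^+ 2) / ip y y); last first.
  by field; rewrite gt_eqF.
by rewrite pmulr_lge0 ?invr_gt0// subr_ge0.
Qed.

Lemma cauchy_schwarz_norm x y : `|ip x y| <= nm x * nm y.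
Proof.
rewrite -sqrtr_sqr -sqrtrM ?(ip_ge0 H)//.
by rewrite ler_sqrt ?cauchy_schwarz_sqr// mulr_ge0 ?(ip_ge0 H).
Qed.

Lemma nm_sqr x : nm x ^+ 2 = ip x x.
Proof. by rewrite sqr_sqrtr// (ip_ge0 H). Qed.

Lemma nm_ge0 x : 0 <= nm x. Proof. exact: sqrtr_ge0. Qed.

Lemma ler_nmD x y : nm (x + y) <= nm x + nm y.
Proof.
rewrite -(ler_pXn2r (ltn0Sn 1)) ?nnegrE ?addr_ge0 ?nm_ge0//.
rewrite nm_sqr sqrrD !nm_sqr !ipE (ip_sym H y x).
have := le_trans (ler_norm _) (cauchy_schwarz_norm x y) => h.
by rewrite mulr2n; lra.
Qed.

Lemma ler_nmZ a x : nm (a *: x) = `|a| * nm x.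
Proof.
rewrite /nm !ipE mulrA -expr2 sqrtrM ?sqr_ge0// sqrtr_sqr//.
Qed.

Lemma cvg_ipl (u : nat -> V) x :
  (ip (u n - x) (u n - x) @[n --> \oo] --> (0 : R)) ->
  forall y, ip (u n) y @[n --> \oo] --> ip x y.
Proof.
move=> ux y.
have h : nm (u n - x) * nm y @[n --> \oo] --> (0 : R).
  rewrite -[X in _ --> X](mul0r (nm y)) -sqrtr0; apply: cvgMr_tmp.
  exact: (cvg_comp _ _ ux (@sqrt_continuous R 0)).
apply: cvgr_dist_squeeze h => n.
by rewrite -ipNl -ipDl cauchy_schwarz_norm.
Qed.

(** Gliding hump. If the norms were unbounded, pick x (f k) of norm > 4^k and
    sum multiples of these vectors of norms 3^-k, with signs that prevent
    cancellation in the pairing with x (f k). The terms after the k-th have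
    total norm 3^-k / 2, so the sum v satisfies |<x (f k), v>| >= (4/3)^k / 2,
    which is unbounded. *)
Lemma uniform_boundedness (x : nat -> V) :
  (forall y, exists C : R, forall n, `|ip (x n) y| <= C) ->
  exists C : R, forall n, ip (x n) (x n) <= C.
Proof.
move=> xb; apply: contrapT => unb.
have big k : exists n, 4 ^+ k < nm (x n).
  apply: contrapT => no; apply: unb; exists ((4 ^+ k) ^+ 2) => n.
  rewrite -nm_sqr ler_pXn2r ?nnegrE ?nm_ge0 ?exprn_ge0//.
  by rewrite leNgt; apply/negP => xn; apply: no; exists n.
have [f fP] := choice big.
pose e k (v : V) : R := if 0 <= ip (x (f k)) v then 1 else -1.
have e1 k v : `|e k v| = 1 by rewrite /e; case: ifP; rewrite ?normrN1 ?normr1.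
pose step k v := v + (e k v * (3^-1 ^+ k / nm (x (f k)))) *: x (f k).
pose u := fix u k := if k is k'.+1 then step k' (u k') else 0.
have nf k : 0 < nm (x (f k)) by apply: lt_trans (fP k); rewrite exprn_gt0.
have uS k : nm (u k.+1 - u k) = 3^-1 ^+ k.
  rewrite /= /step addrAC subrr add0r ler_nmZ !normrM e1 mul1r.
  rewrite ger0_norm ?exprn_ge0// normfV ger0_norm ?nm_ge0//.
  by rewrite -mulrA mulVf ?mulr1// gt_eqF.
have xu k : 3^-1 ^+ k * nm (x (f k)) <= `|ip (x (f k)) (u k.+1)|.
  rewrite /= /step !ipE -nm_sqr.
  rewrite (_ : _ * _ * nm _ ^+ 2 =
      e k (u k) * (3^-1 ^+ k * nm (x (f k)))); last first.
    by field; rewrite ?gt_eqF.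
  have : 0 <= 3^-1 ^+ k * nm (x (f k)).
    by rewrite mulr_ge0 ?exprn_ge0 ?nm_ge0.
  set c := 3^-1 ^+ k * _ => c0; rewrite /e; case: ifPn => [h|].
    by rewrite mul1r ger0_norm ?addr_ge0// lerDr.
  by rewrite -ltNge mulN1r => h; rewrite ltr0_norm ?opprB; lra.
have [v uv] : exists v, ip (u n - v) (u n - v) @[n --> \oo] --> (0 : R).
  apply: (ip_complete H) => n; rewrite -nm_sqr uS -exprM mulnC exprM.
  by apply: lerXn2r; rewrite ?nnegrE; lra.
have tail k j : nm (u (k.+1 + j)%N - u k.+1) <= 3^-1 ^+ k / 2 * (1 - 3^-1 ^+ j).
  elim: j => [|j ih].
    by rewrite addn0 subrr expr0 subrr mulr0 -(scale0r 0) ler_nmZ normr0 mul0r.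
  rewrite (_ : u _ - _ = (u (k.+1 + j).+1%N - u (k.+1 + j)%N) +
      (u (k.+1 + j)%N - u k.+1)); last by rewrite addnS addrA subrK.
  apply: (le_trans (ler_nmD _ _)); rewrite uS.
  apply: (le_trans (lerD (lexx _) ih)).
  rewrite exprD exprS exprS.
  rewrite le_eqVlt; apply/orP; left; apply/eqP; by field.
have low k : 3^-1 ^+ k / 2 * nm (x (f k)) <= `|ip (x (f k)) v|.
  have cv : `|ip (x (f k)) (u (n + k.+1)%N)| @[n --> \oo] --> `|ip (x (f k)) v|.
    rewrite (cvg_shiftn k.+1 (fun n => `|ip (x (f k)) (u n)|)).
    apply: cvg_norm.
    rewrite (ip_sym H).
    under eq_fun do rewrite (ip_sym H).
    exact: cvg_ipl.
  apply: (cvgr_to_ge cv); apply: nearW => n; rewrite addnC.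
  have := cauchy_schwarz_norm (x (f k)) (u (k.+1 + n)%N - u k.+1).
  rewrite ipDr ipNr => h1.
  have h2 := xu k.
  have h3 : nm (x (f k)) * nm (u (k.+1 + n)%N - u k.+1) <=
    nm (x (f k)) * (3^-1 ^+ k / 2).
    rewrite ler_wpM2l ?nm_ge0//; apply: (le_trans (tail k n)).
    rewrite ler_piMr ?divr_ge0 ?exprn_ge0// lerBlDl lerDr ?exprn_ge0//.
  have h4 := ler_normB (ip (x (f k)) (u (k.+1 + n)%N))
    (ip (x (f k)) (u (k.+1 + n)%N) - ip (x (f k)) (u k.+1)).
  rewrite opprB addrC subrK in h4.
  move: h1 h2 h3 h4; set a := nm (x _); set b := 3^-1 ^+ k.
  by move=> h1 h2 h3 h4; lra.
have [C CP] := xb v.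
have C0 : 0 <= C by apply: le_trans (CP 0%N).
have {}low k : (4 / 3) ^+ k <= 2 * C.
  have h := le_trans (low k) (CP (f k)).
  have h' : 3^-1 ^+ k / 2 * 4 ^+ k <= C.
    by apply: le_trans h; rewrite ler_wpM2l ?divr_ge0 ?exprn_ge0// ltW.
  rewrite exprMn; move: h'; set a := 3^-1 ^+ k; set b := 4 ^+ k; lra.
have /cvgr0Pnorm_lt/(_ (2 * C + 1)^-1) : (fun k => (3 / 4) ^+ k : R) @ \oo --> (0 : R).
  by apply: cvg_expr; rewrite ger0_norm; lra.
rewrite invr_gt0 => /(_ _)[|N _ /(_ N (leqnn N))]; first lra.
have q0 : 0 < (3 / 4 : R) ^+ N by rewrite exprn_gt0//; lra.
rewrite gtr0_norm// -(ltr_pM2r (_ : 0 < 2 * C + 1)); last lra.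
rewrite mulVf; last by rewrite gt_eqF//; lra.
have : (4 / 3) ^+ N * (3 / 4) ^+ N = 1 :> R.
  by rewrite -exprMn (_ : 4 / 3 * (3 / 4) = 1) ?expr1n//; field.
have := ler_wpM2r (ltW q0) (low N).
by move: q0; set a := (3 / 4) ^+ N => q0 h1 h2 h3; lra.
Qed.

Record closed_subspace (L : V -> Prop) : Prop := {
  subspace0 : L 0 ;
  subspace_lin : forall a x y, L x -> L y -> L (a *: x + y) ;
  subspace_closed : forall (u : nat -> V) x, (forall n, L (u n)) ->
    (ip (u n - x) (u n - x) @[n --> \oo] --> (0 : R)) -> L x }.

(** The representing vector minimizes J x = <x, x> - 2 phi x on L. The
    parallelogram identity makes a minimizing sequence Cauchy, and the
    first-order condition at the minimum is the representation. *)
Lemma riesz_representation (L : V -> Prop) (phi : V -> R) (K : R) :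
  closed_subspace L ->
  (forall a x y, L x -> L y -> phi (a *: x + y) = a * phi x + phi y) ->
  (forall x, L x -> phi x ^+ 2 <= K * ip x x) ->
  exists2 x, L x & forall y, L y -> phi y = ip x y.
Proof.
move=> LL phi_lin phi_bnd.
have L0 := subspace0 LL.
have LZ a x : L x -> L (a *: x).
  by move=> Lx; rewrite -[_ *: _]addr0; exact: subspace_lin.
have LD x y : L x -> L y -> L (x + y).
  by move=> Lx Ly; rewrite -[x]scale1r; exact: subspace_lin.
have phi0 : phi 0 = 0.
  have := phi_lin 1 0 0 L0 L0; rewrite scale1r addr0 mul1r => /eqP.
  by rewrite -subr_eq subrr eq_sym => /eqP.
have phiZ a x : L x -> phi (a *: x) = a * phi x.
  by move=> Lx; rewrite -[_ *: _]addr0 phi_lin// phi0 addr0.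
have phiD x y : L x -> L y -> phi (x + y) = phi x + phi y.
  by move=> Lx Ly; rewrite -{1}[x]scale1r phi_lin// mul1r.
pose J x := ip x x - 2 * phi x.
have Jlow x : L x -> - (`|K| + 1) <= J x.
  move=> Lx; rewrite /J.
  have hb : phi x ^+ 2 <= `|K| * ip x x.
    apply: (le_trans (phi_bnd x Lx)).
    by rewrite ler_wpM2r ?(ip_ge0 H)// ler_norm.
  have K0 := normr_ge0 K; have x0 := ip_ge0 H x.
  move: hb K0 x0; set k := `|K|; set p := phi x; set q := ip x x.
  move=> hb K0 x0.
  suff : 0 <= (k + 1) * (q - 2 * p + (k + 1)).
    by rewrite pmulr_rge0; [move=> ?; lra|lra].
  have : 0 <= (p - (k + 1)) ^+ 2 by exact: sqr_ge0.
  by move=> ?; nra.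
pose S := [set J y | y in L].
have hS : has_inf S.
  split; first by exists (J 0); exists 0.
  by exists (- (`|K| + 1)) => _ [y Ly <-]; exact: Jlow.
have Sge y : L y -> inf S <= J y.
  by move=> Ly; apply: ge_inf; [exact: hS.2|exists y].
have /choice[u uP] (n : nat) : exists x, L x /\ J x < inf S + 4^-1 * 4^-1 ^+ n.
  have e0 : 0 < 4^-1 * 4^-1 ^+ n :> R by rewrite mulr_gt0 ?exprn_gt0.
  by have [_ [y Ly <-] Jy] := inf_adherent e0 hS; exists y.
have [x ux] : exists x, ip (u n - x) (u n - x) @[n --> \oo] --> (0 : R).
  apply: (ip_complete H) => n.
  have [Ln un] := uP n; have [Lm um] := uP n.+1.
  have := Sge _ (LZ 2^-1 _ (LD _ _ Ln Lm)).
  rewrite /J !phiZ ?phiD//; last exact: LD.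
  move: un um; rewrite /J !ipE (ip_sym H (u n.+1) (u n)) exprS.
  have : 0 <= 4^-1 ^+ n :> R by rewrite exprn_ge0.
  set w := 4^-1 ^+ n; move=> w0 un um h; lra.
have Lx : L x by apply: (subspace_closed LL (u := u)) => // n; exact: (uP n).1.
exists x => // y Ly; apply/eqP; rewrite -subr_eq0; apply/eqP.
set c := phi y - ip x y; set q := ip y y.
have q0 : 0 <= q := ip_ge0 H y.
suff h t : 0 <= 2 * t * (- c) + t ^+ 2 * q.
  have := h (c / (q + 1)).
  rewrite (_ : _ + _ = - (c ^+ 2 * (q + 2)) / (q + 1) ^+ 2); last first.
    by field; lra.
  rewrite pmulr_lge0 ?invr_gt0 ?exprn_gt0//; [|lra].
  rewrite oppr_ge0 pmulr_lle0; last lra.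
  by move=> c2; apply/eqP; rewrite -sqrf_eq0; apply/eqP/le_anti; rewrite c2 sqr_ge0.
have cv : 4^-1 * 4^-1 ^+ n + 2 * t * (ip (u n) y - phi y) + t ^+ 2 * q
    @[n --> \oo] --> 4^-1 * 0 + 2 * t * (ip x y - phi y) + t ^+ 2 * q.
  apply: cvgD; last exact: cvg_cst.
  apply: cvgD.
    by apply: cvgMl_tmp; apply: cvg_expr; rewrite ger0_norm; lra.
  apply: cvgMl_tmp; apply: cvgB; last exact: cvg_cst.
  exact: cvg_ipl.
rewrite (_ : _ + _ = 4^-1 * 0 + 2 * t * (ip x y - phi y) + t ^+ 2 * q); last first.
  by rewrite mulr0 add0r /c opprB.
apply: (cvgr_to_ge cv); apply: nearW => n.
have [Ln un] := uP n; have := Sge _ (LD _ _ Ln (LZ t _ Ly)).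
rewrite /J phiD// ?phiZ//; last exact: LZ.
move: un; rewrite /J !ipE (ip_sym H y (u n)) -/q => un h.
by nra.
Qed.

(** The vectors against which x n converges form a closed subspace L, by the
    uniform bound; Riesz represents the limit on L, and since L contains the
    total set S, any vector differs from its projection to L by a null vector. *)
Lemma weak_cvg_total (S : V -> Prop) (x : nat -> V) (C : R) :
  (forall y, (forall s, S s -> ip y s = 0) -> ip y y = 0) ->
  (forall n, ip (x n) (x n) <= C) ->
  (forall s, S s -> cvg (ip (x n) s @[n --> \oo])) ->
  exists X, forall y, ip (x n) y @[n --> \oo] --> ip X y.
Proof.
move=> totS xC xS.
have C0 : 0 <= C by apply: le_trans (xC 0%N); exact: (ip_ge0 H).
pose L y := cvg (ip (x n) y @[n --> \oo]).
have null0 y z : ip z z = 0 -> ip y z = 0.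
  move=> z0; have := cauchy_schwarz_sqr y z; rewrite z0 mulr0 => h.
  by apply/eqP; rewrite -sqrf_eq0; apply/eqP/le_anti; rewrite h sqr_ge0.
have LL : closed_subspace L.
  split.
  - rewrite /L (_ : (fun n => _) = cst 0); first exact: is_cvg_cst.
    by apply/funext => n /=; rewrite (ip_sym H) ip0l.
  - move=> a y z Ly Lz; rewrite /L.
    under eq_fun do rewrite ipDr ipZr.
    by apply: is_cvgD => //; apply: is_cvgMl_tmp.
  - move=> u y Lu uy; apply/cauchy_cvgP/cauchy_exP => _/posnumP[e].
    pose e' := e%:num / 3 / (C + 1).
    have e'0 : 0 < e' by rewrite !divr_gt0//; lra.
    have /cvgr0Pnorm_lt/(_ _ (exprn_gt0 2 e'0))[N _ /(_ N (leqnn N))] := uy.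
    rewrite ger0_norm ?(ip_ge0 H)// -nm_sqr.
    rewrite ltr_pXn2r ?nnegrE ?nm_ge0//; last exact: ltW.
    move=> uN; exists (lim (ip (x n) (u N) @[n --> \oo])).
    have /cvgrPdist_lt/(_ (e%:num / 3)) := Lu N.
    move=> /(_ _)[//|M _ MP]; exists M => // n Mn.
    have {}MP := MP n Mn.
    have := cauchy_schwarz_norm (x n) (u N - y).
    rewrite ipDr ipNr => h1.
    have xn : nm (x n) <= C + 1.
      rewrite -(ler_pXn2r (ltn0Sn 1)) ?nnegrE ?nm_ge0//; last lra.
      rewrite nm_sqr; have := xC n; nra.
    have h2 : nm (x n) * nm (u N - y) <= e%:num / 3.
      rewrite (_ : _ / 3 = (C + 1) * e'); last by rewrite /e'; field; lra.
      by apply: ler_pM; rewrite ?nm_ge0// ltW.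
    rewrite /ball /= .
    have := ler_distD (ip (x n) (u N)) (lim (ip (x n0) (u N) @[n0 --> \oo]))
      (ip (x n) y).
    move=> h3; apply: (le_lt_trans h3).
    have : 0 < e%:num by [].
    by move: MP h1 h2 => /=; move: (e%:num) => d; lra.
have SL s : S s -> L s by exact: xS.
have [P LP PE] : exists2 X, L X &
    forall y, L y -> lim (ip (x n) y @[n --> \oo]) = ip X y.
  apply: (@riesz_representation L (fun y => lim (ip (x n) y @[n --> \oo])) C) => //.
  - move=> a y z Ly Lz; under eq_fun do rewrite ipDr ipZr.
    by apply/cvg_lim => //; apply: cvgD => //; exact: cvgMl_tmp.
  - move=> y Ly.
    have cv : ip (x n) y ^+ 2 @[n --> \oo] --> lim (ip (x n) y @[n --> \oo]) ^+ 2.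
      by rewrite !expr2; apply: cvgM.
    apply: (cvgr_to_le cv); apply: nearW => n.
    apply: (le_trans (cauchy_schwarz_sqr _ _)).
    by rewrite ler_wpM2r ?(ip_ge0 H).
exists P => y.
(* Q is the orthogonal projection of y to L. *)
have [Q LQ QE] : exists2 Q, L Q & forall z, L z -> ip y z = ip Q z.
  apply: (@riesz_representation L (ip y) (ip y y)) => //.
  - by move=> a u v _ _; rewrite ipDr ipZr.
  - by move=> z _; exact: cauchy_schwarz_sqr.
have yQ : ip (y - Q) (y - Q) = 0.
  apply: totS => s Ss; rewrite ipDl ipNl QE ?subrr//; exact: SL.
have e z : ip z y = ip z Q.
  apply/eqP; rewrite -subr_eq0 -ipNr -ipDr; apply/eqP; exact: null0.
rewrite e; under eq_fun do rewrite e.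
by rewrite -PE.
Qed.

End hilbert.

(** * Real-valued integrals and square-integrable functions *)

Section real_integrals.
Context d (T : measurableType d) (R : realType) (mu : {measure set T -> \bar R}).
Implicit Types f g : T -> R.

Local Notation mfun f := (measurable_fun [set: T] (f : T -> R)).
Local Notation intg f := (mu.-integrable [set: T] (EFin \o (f : T -> R))).

Lemma integrable_meas f : intg f -> mfun f.
Proof. by move=> /measurable_int/measurable_EFinP. Qed.

Lemma integrable_le f g : mfun f -> (forall x, `|f x| <= g x) -> intg g -> intg f.
Proof.
move=> mf fg ig; apply: (le_integrable measurableT _ _ ig).
  exact/measurable_EFinP.
by move=> x _ /=; rewrite lee_fin (le_trans (fg x))// ler_norm.
Qed.

Lemma eq_intg f g : f =1 g -> intg f -> intg g.
Proof. by move=> fg; rewrite (_ : f = g)//; exact/funext. Qed.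

Lemma intgD f g : intg f -> intg g -> intg (fun x => f x + g x).
Proof. by move=> If Ig; apply: (integrableD measurableT If Ig). Qed.

Lemma intgB f g : intg f -> intg g -> intg (fun x => f x - g x).
Proof. by move=> If Ig; apply: (integrableB measurableT If Ig). Qed.

Lemma intgZ a f : intg f -> intg (fun x => a * f x).
Proof. by move=> If; apply: (integrableZl measurableT a If). Qed.

Lemma intg_norm f : intg f -> intg (fun x => `|f x|).
Proof. by move=> If; exact: integrable_norm. Qed.

Lemma intg_sum (I : Type) (s : seq I) (F : I -> T -> R) :
  (forall i, intg (F i)) -> intg (fun x => \sum_(i <- s) F i x).
Proof.
move=> IF; elim: s => [|i s ih].
  by apply: eq_intg (integrable0 mu setT) => x; rewrite big_nil.
by apply: eq_intg (intgD (IF i) ih) => x; rewrite big_cons.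
Qed.

Lemma RintD f g : intg f -> intg g ->
  \int[mu]_x (f x + g x) = \int[mu]_x f x + \int[mu]_x g x.
Proof. by move=> If Ig; rewrite RintegralD. Qed.

Lemma RintB f g : intg f -> intg g ->
  \int[mu]_x (f x - g x) = \int[mu]_x f x - \int[mu]_x g x.
Proof. by move=> If Ig; rewrite RintegralB. Qed.

Lemma RintZ a f : intg f -> \int[mu]_x (a * f x) = a * \int[mu]_x f x.
Proof. by move=> If; rewrite RintegralZl. Qed.

Lemma Rint_sum (I : Type) (s : seq I) (F : I -> T -> R) :
  (forall i, intg (F i)) ->
  \int[mu]_x (\sum_(i <- s) F i x) = \sum_(i <- s) \int[mu]_x F i x.
Proof.
move=> IF; elim: s => [|i s ih].
  rewrite big_nil /Rintegral; under eq_integral do rewrite big_nil.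
  by rewrite integral0.
rewrite big_cons -ih -RintD//; last exact: intg_sum.
by apply: eq_Rintegral => x _; rewrite big_cons.
Qed.

Lemma le_Rint f g : intg f -> intg g -> (forall x, f x <= g x) ->
  \int[mu]_x f x <= \int[mu]_x g x.
Proof. by move=> If Ig fg; apply: le_Rintegral. Qed.

Lemma Rint_ge0 f : (forall x, 0 <= f x) -> 0 <= \int[mu]_x f x.
Proof. by move=> f0; apply: Rintegral_ge0. Qed.

Lemma EFin_Rint f : intg f -> (\int[mu]_x f x)%:E = (\int[mu]_x (f x)%:E)%E.
Proof. by move=> If; rewrite fineK//; exact: integrable_fin_num. Qed.

Lemma ge0_intg f : mfun f -> (forall x, 0 <= f x) ->
  (\int[mu]_x (f x)%:E < +oo)%E -> intg f.
Proof.
move=> mf f0 foo; apply/integrableP; split; first exact/measurable_EFinP.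
by under eq_integral do rewrite /= ger0_norm ?f0//.
Qed.

Lemma ae_eq_Rint f g : mfun f -> mfun g -> {ae mu, forall x, f x = g x} ->
  \int[mu]_x f x = \int[mu]_x g x.
Proof.
move=> mf mg fg; congr fine; apply: ae_eq_integral => //.
- exact/measurable_EFinP.
- exact/measurable_EFinP.
- by apply: filterS fg => x fgx _; rewrite fgx.
Qed.

Lemma Rint_eq0 f : intg f -> (forall x, 0 <= f x) -> \int[mu]_x f x = 0 ->
  {ae mu, forall x, f x = 0}.
Proof.
move=> If f0 i0.
have mf := integrable_meas If.
have : (\int[mu]_x `|(f x)%:E|)%E = 0%E.
  under eq_integral do rewrite /= ger0_norm ?f0//.
  by rewrite -EFin_Rint// i0.
move=> /ae_eq_integral_abs => /(_ measurableT).
move=> iff; have h : {ae mu, forall x, [set: T] x -> (f x)%:E = cst 0%E x}.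
  by apply: iff; exact/measurable_EFinP.
by apply: filterS h => x /(_ I) [].
Qed.

End real_integrals.

Section square_integrable.
Context d (T : measurableType d) (R : realType) (mu : {measure set T -> \bar R}).
Implicit Types f g : T -> R.

Local Notation mfun f := (measurable_fun [set: T] (f : T -> R)).
Local Notation intg f := (mu.-integrable [set: T] (EFin \o (f : T -> R))).
Local Notation L2 f := ((f : T -> R) \in Lfun mu 2%:E).

Lemma L2_meas f : L2 f -> mfun f.
Proof. by move=> /sub_Lfun_mfun; rewrite inE. Qed.

Lemma L2P f : L2 f <-> mfun f /\ intg (fun x => f x ^+ 2).
Proof.
split=> [L|[mf If]]; first by split; [exact: L2_meas|exact: Lfun2_integrable_sqr].
rewrite inE; apply/andP; split; first by rewrite inE.
rewrite inE /= /finite_norm unlock poweR_lty//.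
move/integrableP : If => [_]; apply: le_lt_trans.
rewrite le_eqVlt; apply/orP; left; apply/eqP; apply: eq_integral => x _ /=.
by rewrite normrX powR_mulrn.
Qed.

Lemma L2_sqr f : L2 f -> intg (fun x => f x ^+ 2).
Proof. by case/L2P. Qed.

Lemma L2M f g : L2 f -> L2 g -> intg (fun x => f x * g x).
Proof. by move=> Lf Lg; apply/Lfun1_integrable/Lfun2_mul_Lfun1. Qed.

Lemma L2_le f g : mfun f -> (forall x, `|f x| <= `|g x|) -> L2 g -> L2 f.
Proof.
move=> mf fg Lg; apply/L2P; split => //.
apply: integrable_le (L2_sqr Lg); first exact: measurable_funX.
by move=> x; rewrite normrX -[leRHS]real_normK ?num_real// lerXn2r ?nnegrE.
Qed.

Lemma L2D f g : L2 f -> L2 g -> L2 (fun x => f x + g x).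
Proof.
move=> Lf Lg; have mfg : mfun (fun x => f x + g x).
  by apply: measurable_funD; exact: L2_meas.
apply/L2P; split => //.
apply: integrable_le
  (intgZ 2 (intgD (L2_sqr Lf) (L2_sqr Lg))).
  exact: measurable_funX.
move=> x; rewrite ger0_norm ?sqr_ge0//.
by have := sqr_ge0 (f x - g x); rewrite sqrrB sqrrD; lra.
Qed.

Lemma L2Z a f : L2 f -> L2 (fun x => a * f x).
Proof.
move=> Lf; apply/L2P; split; first by apply: measurable_funM => //; exact: L2_meas.
apply: eq_intg (intgZ (a ^+ 2) (L2_sqr Lf)) => x.
by rewrite exprMn.
Qed.

Lemma L2B f g : L2 f -> L2 g -> L2 (fun x => f x - g x).
Proof.
move=> Lf Lg; have := L2D Lf (L2Z (-1) Lg).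
by under eq_fun do rewrite mulN1r.
Qed.

Lemma L20 : L2 (fun=> 0).
Proof.
apply/L2P; split; first exact: measurable_cst.
by apply: eq_intg (integrable0 mu setT) => x; rewrite expr0n.
Qed.

Lemma L2_sum (I : Type) (s : seq I) (F : I -> T -> R) :
  (forall i, L2 (F i)) -> L2 (fun x => \sum_(i <- s) F i x).
Proof.
move=> LF; elim: s => [|i s ih].
  by under eq_fun do rewrite big_nil; exact: L20.
by under eq_fun do rewrite big_cons; exact: L2D.
Qed.

Lemma L2_bounded f g (C : R) : mfun f -> (forall x, `|f x| <= C) -> L2 g ->
  L2 (fun x => f x * g x).
Proof.
move=> mf fC Lg; apply: L2_le (L2Z C Lg).
  by apply: measurable_funM => //; exact: L2_meas.
move=> x; rewrite !normrM ler_wpM2r//.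
by rewrite (le_trans (fC x))// ler_norm.
Qed.

Lemma geometric_cauchy (u : nat -> R) (c q : R) : 0 <= q < 1 ->
  (forall n, `|u n.+1 - u n| <= c * q ^+ n) ->
  cvgn u /\ forall n, `|limn u - u n| <= c * q ^+ n / (1 - q).
Proof.
move=> /andP[q0 q1] uc.
have c0 : 0 <= c by have := uc 0%N; rewrite expr0 mulr1; exact: le_trans.
have p0 : 0 < 1 - q by lra.
have tail n k : `|u (n + k)%N - u n| <= c * q ^+ n * (1 - q ^+ k) / (1 - q).
  elim: k => [|k ih]; first by rewrite addn0 subrr normr0 expr0 subrr mulr0 mul0r.
  rewrite (_ : u _ - u n = (u (n + k).+1 - u (n + k)%N) + (u (n + k)%N - u n)).
    apply: (le_trans (ler_normD _ _)); apply: (le_trans (lerD (uc _) ih)).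
    rewrite le_eqVlt; apply/orP; left; apply/eqP; rewrite exprD exprS.
    by field; rewrite gt_eqF.
  by rewrite addnS addrA subrK.
have {}tail n k : `|u (n + k)%N - u n| <= c * q ^+ n / (1 - q).
  apply: (le_trans (tail n k)); rewrite ler_wpM2r ?invr_ge0 ?(ltW p0)//.
  rewrite ler_piMr ?mulr_ge0 ?exprn_ge0//.
  by rewrite lerBlDl lerDr exprn_ge0.
have t0 : c * q ^+ n / (1 - q) @[n --> \oo] --> (0 : R).
  rewrite -[X in _ --> X](mul0r (1 - q)^-1); apply: cvgMr_tmp.
  rewrite -[X in _ --> X](mulr0 c); apply: cvgMl_tmp.
  by apply: cvg_expr; rewrite ger0_norm.
have cu : cvgn u.
  apply/cauchy_cvgP/cauchy_exP => e e0.
  have /cvgr0Pnorm_lt/(_ _ e0)[N _ /(_ N (leqnn N)) tN] := t0.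
  exists (u N); exists N => // n /= Nn.
  rewrite /ball /= distrC -(subnKC Nn) (le_lt_trans (tail _ _))//.
  by rewrite (le_lt_trans (ler_norm _))//.
split=> // n.
have cv : `|u (k + n)%N - u n| @[k --> \oo] --> `|limn u - u n|.
  apply: cvg_norm; apply: cvgB; last exact: cvg_cst.
  by rewrite (cvg_shiftn n u).
by apply: (cvgr_to_le cv); apply: nearW => k; rewrite addnC.
Qed.

Definition L2ip f g : R := \int[mu]_x (f x * g x).

(** The series of the squared increments with weights (9/4)^n has an
    integrable sum h, because 9/4 < 4. Hence the increments are at most
    sqrt(h) (2/3)^n, the sequence converges wherever h is finite, and the
    squared distance to the limit is dominated by a multiple of (4/9)^n h. *)
Lemma L2_complete (u : nat -> T -> R) : (forall n, L2 (u n)) ->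
  (forall n, \int[mu]_x (u n.+1 x - u n x) ^+ 2 <= 4^-1 ^+ n) ->
  exists2 v, L2 v & \int[mu]_x (u n x - v x) ^+ 2 @[n --> \oo] --> (0 : R).
Proof.
move=> Lu du.
pose f n x : \bar R := ((9 / 4) ^+ n * (u n.+1 x - u n x) ^+ 2)%:E.
have f0 n x : (0 <= f n x)%E.
  by rewrite lee_fin mulr_ge0 ?sqr_ge0// exprn_ge0//; lra.
have Id n : intg (fun x => (u n.+1 x - u n x) ^+ 2) by exact/L2_sqr/L2B.
have mf n : measurable_fun setT (f n).
  by apply/measurable_EFinP; apply/integrable_meas/intgZ/Id.
pose h x : \bar R := (\sum_(n <oo) f n x)%E.
have h0 x : (0 <= h x)%E by exact: nneseries_ge0.
have mh : measurable_fun setT h.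
  exact: (ge0_emeasurable_sum (P := xpredT)).
have Ih : (\int[mu]_x h x <= 3%:E)%E.
  rewrite integral_nneseries//.
  apply: lime_le.
    by apply: is_cvg_nneseries => n _ _; apply: integral_ge0 => x _; exact: f0.
  apply: nearW => N.
  apply: (@le_trans _ _ (\sum_(0 <= n < N) ((9 / 16) ^+ n)%:E)%E).
    apply: lee_sum => n _.
    rewrite -(EFin_Rint (intgZ _ (Id n))) lee_fin.
    rewrite RintZ//; apply: (@le_trans _ _ ((9 / 4) ^+ n * 4^-1 ^+ n)).
      by rewrite ler_wpM2l// exprn_ge0//; lra.
    by rewrite -exprMn (_ : 9 / 4 * 4^-1 = 9 / 16)//; field.
  rewrite sumEFin lee_fin big_mkord.
  have -> : \sum_(i < N) (9 / 16) ^+ i = (1 - (9 / 16) ^+ N) / (1 - 9 / 16) :> R.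
    elim: N => [|N ih]; first by rewrite big_ord0 expr0 subrr mul0r.
    by rewrite big_ord_recr /= ih exprS; field.
  have : 0 <= (9 / 16) ^+ N :> R by rewrite exprn_ge0//; lra.
  by set a := _ ^+ N => a0; rewrite ler_pdivrMr; lra.
have step x : (h x < +oo)%E -> forall n,
    `|u n.+1 x - u n x| <= Num.sqrt (fine (h x)) * (2 / 3) ^+ n.
  move=> hx n.
  have hf : h x \is a fin_num by rewrite ge0_fin_numE.
  have hn : (9 / 4) ^+ n * (u n.+1 x - u n x) ^+ 2 <= fine (h x).
    rewrite -lee_fin fineK//; apply: le_trans (nneseries_lim_ge n.+1 _) => //.
    by rewrite big_nat_recr//= leeDr// sume_ge0.
  have q0 : 0 <= (2 / 3) ^+ n :> R by rewrite exprn_ge0//; lra.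
  rewrite -(ler_pXn2r (ltn0Sn 1)) ?nnegrE ?mulr_ge0 ?sqrtr_ge0//.
  rewrite exprMn sqr_sqrtr; last by rewrite fine_ge0.
  rewrite real_normK ?num_real// -exprM mulnC exprM.
  rewrite -(ler_pM2l (_ : 0 < (9 / 4) ^+ n)); last by rewrite exprn_gt0//; lra.
  apply: (le_trans hn); rewrite mulrCA -exprMn.
  by rewrite (_ : 9 / 4 * _ = 1) ?expr1n ?mulr1//; field.
pose v x := if (h x < +oo)%E then limn (u ^~ x) else 0.
have vu x n : (((u n x - v x) ^+ 2)%:E <= (9 * (4 / 9) ^+ n)%:E * h x)%E.
  rewrite /v; case: ifPn => [hx|]; last first.
    rewrite -leNgt leye_eq => /eqP ->.
    by rewrite gt0_muley ?leey// lte_fin mulr_gt0// exprn_gt0//; lra.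
  have hf : h x \is a fin_num by rewrite ge0_fin_numE.
  have q1 : 0 <= (2 / 3 : R) < 1 by apply/andP; split; lra.
  have [_ /(_ n) e] := geometric_cauchy q1 (step x hx).
  rewrite -(fineK hf) -EFinM lee_fin.
  rewrite -sqrrN opprB -real_normK ?num_real//.
  have -> : 9 * (4 / 9) ^+ n * fine (h x) =
      (Num.sqrt (fine (h x)) * (2 / 3) ^+ n / (1 - 2 / 3)) ^+ 2.
    have -> : (4 / 9) ^+ n = ((2 / 3) ^+ n) ^+ 2 :> R.
      by rewrite -exprM mulnC exprM; congr (_ ^+ n); field.
    rewrite -{1}(sqr_sqrtr (fine_ge0 (h0 x))).
    by move: (_ ^+ n) (Num.sqrt _) => a b; field.
  by rewrite lerXn2r ?nnegrE// (le_trans _ e).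
have mv : mfun v.
  pose g n x := if (h x < +oo)%E then u n x else 0.
  have mlt : measurable_fun setT (fun x => (h x < +oo)%E).
    by apply: measurable_fun_lte => //; exact: measurable_cst.
  apply: (measurable_fun_cvg (h := g)).
    by move=> n; apply: measurable_fun_ifT => //; exact: L2_meas.
  move=> x _; rewrite /g /v; case: ifPn => [hx|_]; last exact: cvg_cst.
  have q1 : 0 <= (2 / 3 : R) < 1 by apply/andP; split; lra.
  by have [] := geometric_cauchy q1 (step x hx).
have muv n : mfun (fun x => (u n x - v x) ^+ 2).
  by apply: measurable_funX; apply: measurable_funB => //; exact: L2_meas.
have Iuv n : (\int[mu]_x ((u n x - v x) ^+ 2)%:E <= (27 * (4 / 9) ^+ n)%:E)%E.
  apply: (@le_trans _ _ (\int[mu]_x ((9 * (4 / 9) ^+ n)%:E * h x))%E).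
    apply: ge0_le_integral => //.
    - by move=> x _; rewrite lee_fin sqr_ge0.
    - exact/measurable_EFinP.
    - exact: measurable_funeM.
  have c0 : 0 < 9 * (4 / 9) ^+ n :> R by rewrite mulr_gt0// exprn_gt0//; lra.
  rewrite ge0_integralZl_EFin ?(ltW c0)//.
  rewrite (_ : 27 * _ = 9 * (4 / 9) ^+ n * 3); last by ring.
  by rewrite [X in (_ <= X)%E]EFinM lee_pmul2l.
have Iuvn n : intg (fun x => (u n x - v x) ^+ 2).
  apply: ge0_intg => //; first by move=> x; exact: sqr_ge0.
  by apply: le_lt_trans (Iuv n) _; rewrite ltry.
exists v.
  have Luv : L2 (fun x => u 0%N x - v x).
    by apply/L2P; split => //; apply: measurable_funB => //; exact: L2_meas.
  have := L2B (Lu 0%N) Luv.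
  by under eq_fun do rewrite opprB addrC subrK.
apply: (@cvgr_dist_squeeze _ _ (fun n => 27 * (4 / 9) ^+ n)).
  move=> n; rewrite subr0 ger0_norm; last by apply: Rint_ge0 => x; exact: sqr_ge0.
  by rewrite -lee_fin EFin_Rint.
rewrite -[X in _ --> X](mulr0 27); apply: cvgMl_tmp.
by apply: cvg_expr; rewrite ger0_norm; lra.
Qed.

Let V : lmodType R := LfunType mu (lee1n 2).
Let ip (f g : V) : R := L2ip f g.

Lemma L2_complete_inner_product : complete_inner_product (V := V) ip.
Proof.
have LV (f : V) : L2 f by exact: LfunP.
split.
- by move=> f g; apply: eq_Rintegral => x _; rewrite mulrC.
- move=> a f g h; rewrite /ip /L2ip -RintZ; last exact: L2M.
  rewrite -RintD; last 2 first.
    by apply: intgZ; exact: L2M.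
    exact: L2M.
  by apply: eq_Rintegral => x _; rewrite mulrA -mulrDl.
- by move=> f; apply: Rint_ge0 => x; rewrite -expr2 sqr_ge0.
- move=> u du.
  have [|v Lv uv] := L2_complete (fun n => LV (u n)).
    by move=> n; apply: le_trans (du n).
  by exists (Lfun_Sub (lee1n 2) Lv).
Qed.

Theorem L2_bounded_of_weak (X : nat -> T -> R) : (forall n, L2 (X n)) ->
  (forall Y, L2 Y -> cvgn (fun n => \int[mu]_x (X n x * Y x))) ->
  exists C : R, forall n, \int[mu]_x X n x ^+ 2 <= C.
Proof.
move=> LX cX.
pose X' n : V := Lfun_Sub (lee1n 2) (LX n).
have [|C CP] := uniform_boundedness L2_complete_inner_product (x := X').
  move=> Y; have /cvg_seq_bounded[M [_ MP]] := cX _ (LfunP Y).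
  by exists (M + 1) => n; apply: MP => //; rewrite ltrDl.
by exists C => n; apply: (CP n).
Qed.

Theorem L2_weak_cvg_total (S : (T -> R) -> Prop) (X : nat -> T -> R) (C : R) :
  (forall s, S s -> L2 s) ->
  (forall Y, L2 Y -> (forall s, S s -> \int[mu]_x (Y x * s x) = 0) ->
     \int[mu]_x Y x ^+ 2 = 0) ->
  (forall n, L2 (X n)) -> (forall n, \int[mu]_x X n x ^+ 2 <= C) ->
  (forall s, S s -> cvgn (fun n => \int[mu]_x (X n x * s x))) ->
  exists2 Z, L2 Z & forall Y, L2 Y ->
    \int[mu]_x (X n x * Y x) @[n --> \oo] --> \int[mu]_x (Z x * Y x).
Proof.
move=> LS totS LX XC cX.
pose X' n : V := Lfun_Sub (lee1n 2) (LX n).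
have [|//||Z ZP] := weak_cvg_total L2_complete_inner_product
   (S := fun s => S s) (x := X') (C := C).
- by move=> Y YS; apply: totS; [exact: LfunP|move=> s Ss; exact: (YS (Lfun_Sub (lee1n 2) (LS s Ss)))].
- by move=> s Ss; apply: cX.
exists Z; first exact: LfunP.
by move=> Y LY; exact: (ZP (Lfun_Sub (lee1n 2) LY)).
Qed.

Lemma L2_cauchy_schwarz f g : L2 f -> L2 g ->
  (\int[mu]_x (f x * g x)) ^+ 2 <= \int[mu]_x f x ^+ 2 * \int[mu]_x g x ^+ 2.
Proof.
move=> Lf Lg; exact: (cauchy_schwarz_sqr L2_complete_inner_product
  (Lfun_Sub (lee1n 2) Lf) (Lfun_Sub (lee1n 2) Lg)).
Qed.

Lemma strong_cvg_Rint (X : nat -> T -> R) (Y : T -> R) :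
  (forall n, L2 (X n)) -> L2 Y -> strong_cvg mu X Y ->
  \int[mu]_x (X n x - Y x) ^+ 2 @[n --> \oo] --> (0 : R).
Proof.
move=> LX LY XY.
pose N n := 'N[mu]_2%:E [EFin \o (fun x => X n x - Y x)%R]%E.
have NE n : \int[mu]_x (X n x - Y x) ^+ 2 = fine (N n) ^+ 2.
  have LXY := L2B (LX n) LY.
  have fN : N n \is a fin_num.
    rewrite ge0_fin_numE ?Lnorm_ge0//.
    by move/sub_Lfun_finLfun : LXY; rewrite inE.
  apply: EFin_inj; rewrite EFin_Rint; last exact: L2_sqr.
  have : (N n `^ 2 = \int[mu]_x `|(X n x - Y x)%:E| `^ 2)%E.
    by rewrite /N -poweR_Lnorm.
  rewrite -(fineK fN) poweR_EFin powR_mulrn ?fine_ge0 ?Lnorm_ge0// => ->.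
  by apply: eq_integral => x _; rewrite /= powR_mulrn// real_normK ?num_real.
under eq_fun do rewrite NE.
under eq_fun do rewrite expr2.
by rewrite -(mulr0 0); apply: cvgM; exact: fine_cvg.
Qed.

End square_integrable.

(** * Dominated convergence, independence and conditional expectation *)

Section factorization.
Import HBNNSimple.
Context d (T : measurableType d) (R : realType) (mu : {measure set T -> \bar R}).
Implicit Types Y V : T -> R.

Local Notation mfun f := (measurable_fun [set: T] (f : T -> R)).
Local Notation intg f := (mu.-integrable [set: T] (EFin \o (f : T -> R))).

Lemma Rint_dominated_cvg_ae (F : nat -> T -> R) (f g : T -> R) :
  (forall n, mfun (F n)) -> mfun f -> intg g ->
  (forall n x, `|F n x| <= g x) -> {ae mu, forall x, F n x @[n --> \oo] --> f x} ->
  \int[mu]_x F n x @[n --> \oo] --> \int[mu]_x f x.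
Proof.
move=> mF mf Ig Fg Ff.
have [|||//||If _ cI] := @dominated_convergence _ _ _ mu setT measurableT
  (fun n x => (F n x)%:E) (EFin \o f) (EFin \o g).
- by move=> n; exact/measurable_EFinP.
- exact/measurable_EFinP.
- by apply: filterS Ff => x Ffx _; apply: (cvg_comp _ _ Ffx).
- by apply: aeW => x n _; rewrite /= lee_fin.
by apply: fine_cvg; rewrite EFin_Rint.
Qed.

Lemma Rint_dominated_cvg (F : nat -> T -> R) (f g : T -> R) :
  (forall n, mfun (F n)) -> intg g ->
  (forall n x, `|F n x| <= g x) -> (forall x, F n x @[n --> \oo] --> f x) ->
  intg f /\ \int[mu]_x F n x @[n --> \oo] --> \int[mu]_x f x.
Proof.
move=> mF Ig Fg Ff.
have mf : mfun f by apply: (measurable_fun_cvg (h := F)) => // x _; exact: Ff.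
split; last by apply: Rint_dominated_cvg_ae Ig Fg _ => //; exact: aeW.
apply: integrable_le Ig => // x.
have cv : `|F n x| @[n --> \oo] --> `|f x| by apply: cvg_norm; exact: Ff.
by apply: (cvgr_to_le cv); apply: nearW.
Qed.

Lemma ae_imply (A B : T -> Prop) : (forall x, A x -> B x) ->
  {ae mu, forall x, A x} -> {ae mu, forall x, B x}.
Proof. by move=> AB; apply: filterS. Qed.

Lemma comp_indic V (A : set R) x : \1_A (V x) = \1_(V @^-1` A) x :> R.
Proof. by rewrite !indicE. Qed.

Lemma mfun_comp V (f : R -> R) : mfun V -> measurable_fun setT f ->
  mfun (fun x => f (V x)).
Proof. by move=> mV mf; exact: measurableT_comp. Qed.

Lemma intg_bounded Y V (C : R) : intg Y -> mfun V -> (forall x, `|V x| <= C) ->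
  intg (fun x => Y x * V x).
Proof.
move=> IY mV VC; have mY := integrable_meas IY.
apply: integrable_le (intgZ C (intg_norm IY)).
  exact: measurable_funM.
by move=> x; rewrite normrM mulrC ler_wpM2r.
Qed.

Lemma indic_le1 (U : Type) (A : set U) x : `|\1_A x : R| <= 1.
Proof. by rewrite indicE; case: (_ \in _); rewrite ?normr1 ?normr0. Qed.

(** The measures with densities Y1 and Y2 have the same image under V, hence
    give the same integral to every nonnegative function of V; this is checked
    on the simple functions below f. *)
Lemma ge0_integral_comp_eq Y1 Y2 V : mfun Y1 -> mfun Y2 -> mfun V ->
  (forall x, 0 <= Y1 x) -> (forall x, 0 <= Y2 x) ->
  (forall A : set R, measurable A ->
    (\int[mu]_x (Y1 x * \1_A (V x))%:E = \int[mu]_x (Y2 x * \1_A (V x))%:E)%E) ->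
  forall f : R -> R, measurable_fun setT f -> (forall y, 0 <= f y) ->
    (\int[mu]_x (Y1 x * f (V x))%:E = \int[mu]_x (Y2 x * f (V x))%:E)%E.
Proof.
move=> mY1 mY2 mV Y10 Y20 Y12 f mf f0.
have mfE : measurable_fun setT (EFin \o f) by exact/measurable_EFinP.
pose gs (n : nat) := nnsfun_approx measurableT mfE n.
pose g n : R -> R := gs n.
have limY Y : mfun Y -> (forall x, 0 <= Y x) ->
    (\int[mu]_x (Y x * f (V x))%:E =
     limn (fun n => \int[mu]_x (Y x * g n (V x))%:E))%E.
  move=> mY Y0; rewrite -monotone_convergence//.
  - apply: eq_integral => x _; apply/esym/cvg_lim => //.
    have gf : g n (V x) @[n --> \oo] --> f (V x).
      have f0E y : [set: R] y -> (0 <= (EFin \o f) y)%E by rewrite lee_fin.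
      exact: (fine_cvg (cvg_nnsfun_approx measurableT mfE f0E (x := V x) I)).
    have h : Y x * g n (V x) @[n --> \oo] --> Y x * f (V x) by exact: cvgMl_tmp.
    by apply: (cvg_comp _ _ h).
  - by move=> n; apply/measurable_EFinP/measurable_funM => //; exact: mfun_comp.
  - by move=> n x _; rewrite lee_fin mulr_ge0.
  - move=> x _ m n mn; rewrite lee_fin ler_wpM2l//.
    by have /lefP := nd_nnsfun_approx measurableT mfE mn; exact.
rewrite !limY//; congr (limn _); apply/funext => n.
pose s := fset_set (range (g n)).
have sfun Y : mfun Y -> (forall x, 0 <= Y x) ->
    (\int[mu]_x (Y x * g n (V x))%:E =
     \sum_(i < #|`s|) (s`_i)%:E *
        \int[mu]_x (Y x * \1_(g n @^-1` [set s`_i]) (V x))%:E)%E.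
  move=> mY Y0.
  have s0 (i : 'I_#|`s|) : 0 <= s`_i.
    have : s`_i \in s by exact: mem_nth.
    by rewrite in_fset_set ?inE//= => -[y _ <-].
  have mg r : measurable (g n @^-1` [set r]).
    by apply: (measurable_sfunP (gs n)); exact: measurable_set1.
  have mi i : mfun (fun x => Y x * \1_(g n @^-1` [set s`_i]) (V x)).
    apply: measurable_funM => //; apply: (mfun_comp mV (f := \1_(g n @^-1` [set s`_i]))) => //.
  under eq_integral => x _.
    rewrite [g n (V x)](fimfunEord (gs n)) mulr_sumr -sumEFin.
    under eq_bigr do rewrite mulrCA EFinM.
    over.
  rewrite ge0_integral_sum//.
  - apply: eq_bigr => i _; rewrite ge0_integralZl_EFin//.
    + by move=> x _; rewrite lee_fin mulr_ge0.
    + exact/measurable_EFinP.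
  - by move=> i; apply: measurable_funeM; exact/measurable_EFinP.
  - by move=> i x _; rewrite mule_ge0 ?lee_fin ?mulr_ge0.
rewrite !sfun//; apply: eq_bigr => i _; rewrite Y12//.
Qed.

Let pos (y : R) := Num.max y 0.
Let pos_ge0 y : 0 <= pos y. Proof. by rewrite le_max lexx orbT. Qed.
Let posN y : y = pos y - pos (- y).
Proof. by rewrite /pos !maxEle; case: ifPn => h1; case: ifPn => h2; lra. Qed.
Let pos_norm y : pos y <= `|y|.
Proof. by rewrite ge_max ler_norm normr_ge0. Qed.
Let mpos : measurable_fun [set: R] pos.
Proof. by apply: measurable_maxr => //; exact: measurable_cst. Qed.
Let mposN : measurable_fun [set: R] (fun y => pos (- y)).
Proof. by apply: measurableT_comp => //; exact: measurable_oppr. Qed.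

(** Apply ge0_integral_comp_eq to the positive and negative parts of Y,
    against the positive and negative parts of f. *)
Lemma Rint_comp_eq0 Y V (f : R -> R) : intg Y -> mfun V ->
  (forall A : set R, measurable A -> \int[mu]_x (Y x * \1_A (V x)) = 0) ->
  measurable_fun setT f -> intg (fun x => Y x * f (V x)) ->
  \int[mu]_x (Y x * f (V x)) = 0.
Proof.
move=> IY mV Y0 mf IYf; have mY := integrable_meas IY.
have mYp : mfun (fun x => pos (Y x)) by exact: mfun_comp.
have mYn : mfun (fun x => pos (- Y x)) by exact: (mfun_comp mY mposN).
have IYp : intg (fun x => pos (Y x)).
  by apply: integrable_le (intg_norm IY) => // x; rewrite ger0_norm.
have IYn : intg (fun x => pos (- Y x)).
  apply: integrable_le (intg_norm IY) => // x.
  by rewrite ger0_norm// -(normrN (Y x)).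
have eqA (A : set R) : measurable A ->
    (\int[mu]_x (pos (Y x) * \1_A (V x))%:E =
     \int[mu]_x (pos (- Y x) * \1_A (V x))%:E)%E.
  move=> mA.
  have mAV : mfun (fun x => \1_A (V x)).
    by apply: (mfun_comp mV (f := \1_A)) => //; exact: measurable_indic.
  have I1 : intg (fun x => pos (Y x) * \1_A (V x)).
    by apply: (intg_bounded (C := 1)) => // x; exact: indic_le1.
  have I2 : intg (fun x => pos (- Y x) * \1_A (V x)).
    by apply: (intg_bounded (C := 1)) => // x; exact: indic_le1.
  rewrite -!EFin_Rint//; congr EFin; apply/eqP; rewrite -subr_eq0 -RintB//.
  apply/eqP; rewrite -[RHS](Y0 A mA); apply: eq_Rintegral => x _.
  by rewrite -mulrBl -posN.
have key (h : R -> R) : measurable_fun setT h -> (forall y, 0 <= h y) ->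
    (forall y, h y <= `|f y|) ->
    [/\ intg (fun x => pos (Y x) * h (V x)), intg (fun x => pos (- Y x) * h (V x)) &
    \int[mu]_x (pos (Y x) * h (V x)) = \int[mu]_x (pos (- Y x) * h (V x))].
  move=> mh h0 hf.
  have mhV : mfun (fun x => h (V x)) by exact: mfun_comp.
  have I1 : intg (fun x => pos (Y x) * h (V x)).
    apply: integrable_le (intg_norm IYf); first exact: measurable_funM.
    by move=> x; rewrite ger0_norm ?mulr_ge0// normrM ler_pM.
  have I2 : intg (fun x => pos (- Y x) * h (V x)).
    apply: integrable_le (intg_norm IYf); first exact: measurable_funM.
    by move=> x; rewrite ger0_norm ?mulr_ge0// normrM ler_pM// -(normrN (Y x)).
  split => //; congr fine; exact: ge0_integral_comp_eq.
have [||y|Ipp Inp Ep] := key (fun y => pos (f y)); [exact: (measurableT_comp mpos)|by []|exact: pos_norm|].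
have [||y|Ipn Inn En] := key (fun y => pos (- f y)).
- exact: (measurableT_comp mposN).
- by [].
- by rewrite -normrN; exact: pos_norm.
rewrite (_ : \int[mu]_x _ =
  (\int[mu]_x (pos (Y x) * pos (f (V x))) - \int[mu]_x (pos (Y x) * pos (- f (V x)))) -
  (\int[mu]_x (pos (- Y x) * pos (f (V x))) - \int[mu]_x (pos (- Y x) * pos (- f (V x))))).
  by rewrite Ep En subrr.
rewrite -!RintB//; [|exact: intgB..].
apply: eq_Rintegral => x _; rewrite {1}(posN (Y x)) {1}(posN (f (V x))); ring.
Qed.

Definition truncated (f : T -> R) (n : nat) x := f x * \1_[set y : R | `|y| <= n%:R] (f x).

Lemma meas_ball (a : R) : measurable [set y : R | `|y| <= a].
Proof.
rewrite (_ : [set _ | _] = Num.norm @^-1` `]-oo, a]%classic); last first.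
  by apply/seteqP; split => y /=; rewrite in_itv.
by rewrite -[X in measurable X]setTI; exact: normr_measurable.
Qed.

Lemma mfun_truncation (n : nat) :
  measurable_fun [set: R] (fun y => y * \1_[set y : R | `|y| <= n%:R] y).
Proof. by apply: measurable_funM => //; apply: measurable_indic; exact: meas_ball. Qed.

(** By monotone convergence; this gives access to the second moment of a
    function that is not yet known to be square-integrable. *)
Lemma L2_truncation (f : T -> R) (M : R) : mfun f ->
  (forall n, (\int[mu]_x ((truncated f n x) ^+ 2)%:E <= M%:E)%E) ->
  f \in Lfun mu 2%:E /\ \int[mu]_x f x ^+ 2 <= M.
Proof.
move=> mf fM.
have mt n : mfun (truncated f n) by exact: (mfun_comp mf (mfun_truncation n)).
have If : (\int[mu]_x (f x ^+ 2)%:E <= M%:E)%E.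
  rewrite (_ : (\int[mu]_x _)%E = limn (fun n => \int[mu]_x ((truncated f n x) ^+ 2)%:E)%E).
    apply: lime_le; last exact: nearW.
    apply: ereal_nondecreasing_is_cvgn => m n mn.
    apply: ge0_le_integral => //.
    - by move=> x _; rewrite lee_fin sqr_ge0.
    - by apply/measurable_EFinP; exact: measurable_funX.
    - by apply/measurable_EFinP; exact: measurable_funX.
    - move=> x _; rewrite lee_fin /truncated !exprMn ler_wpM2l ?sqr_ge0//.
      rewrite !indicE; case: (boolP (_ \in [set y : R | `|y| <= m%:R])) => [|_]; last first.
      by rewrite expr0n sqr_ge0.
      rewrite inE /= => h1; rewrite mem_set//=.
      by rewrite (le_trans h1)// ler_nat.
  rewrite -monotone_convergence//.
  - apply: eq_integral => x _; apply/esym/cvg_lim => //.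
    apply: cvg_near_cst; near=> n; congr (_%:E); rewrite /truncated.
    rewrite indicE mem_set ?mulr1//=.
    by near: n; exact: nbhs_infty_ger.
  - by move=> n; apply/measurable_EFinP; exact: measurable_funX.
  - by move=> n x _; rewrite lee_fin sqr_ge0.
  - move=> x _ m n mn; rewrite lee_fin /truncated !exprMn ler_wpM2l ?sqr_ge0//.
    rewrite !indicE; case: (boolP (_ \in [set y : R | `|y| <= m%:R])) => [|_]; last first.
      by rewrite expr0n sqr_ge0.
      rewrite inE /= => h1; rewrite mem_set//=.
      by rewrite (le_trans h1)// ler_nat.
have If2 : intg (fun x => f x ^+ 2).
  apply: ge0_intg; first exact: measurable_funX.
  - by move=> x; exact: sqr_ge0.
  - by rewrite (le_lt_trans If)// ltry.
by split; [apply/L2P|rewrite -lee_fin EFin_Rint].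
Unshelve. all: by end_near. Qed.

End factorization.

Section independence.
Context d (T : measurableType d) (R : realType) (P : probability T R).
Implicit Types X Y : T -> R.

Local Notation mfun f := (measurable_fun [set: T] (f : T -> R)).
Local Notation intg f := (P.-integrable [set: T] (EFin \o (f : T -> R))).
Local Notation L2 f := ((f : T -> R) \in Lfun P 2%:E).

Lemma intg_cst (c : R) : intg (fun=> c).
Proof. exact: finite_measure_integrable_cst. Qed.

Lemma Rint_cst (c : R) : \int[P]_x c = c.
Proof. rewrite Rintegral_cst// -[RHS]mulr1; congr (_ * _).
by rewrite -[LHS]/(fine (P setT)) probability_setT. Qed.

Lemma Rint_indic (A : set T) : measurable A -> \int[P]_x \1_A x = fine (P A).
Proof. by move=> mA; rewrite /Rintegral integral_indic// setIT. Qed.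

Lemma L2_intg Y : L2 Y -> intg Y.
Proof.
move=> LY; have L1 : L2 (fun=> 1) by exact: Lfun_cst.
by apply: eq_intg (L2M LY L1) => x; rewrite mulr1.
Qed.

Lemma indic_mfun (A : set R) X : mfun X -> measurable A -> mfun (fun x => \1_A (X x)).
Proof.
by move=> mX mA; apply: (mfun_comp mX (f := \1_A)); exact: measurable_indic.
Qed.

Lemma mfun_preimage (A : set R) X : mfun X -> measurable A -> measurable (X @^-1` A).
Proof. by move=> mX mA; rewrite -[X in measurable X]setTI; exact: mX. Qed.

Lemma indic_intg (A : set R) X : mfun X -> measurable A -> intg (fun x => \1_A (X x)).
Proof.
move=> mX mA; apply: integrable_le (intg_cst 1); first exact: indic_mfun.
by move=> x; exact: indic_le1.
Qed.

Lemma Rint_indic_comp (A : set R) X : mfun X -> measurable A ->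
  \int[P]_x \1_A (X x) = fine (P (X @^-1` A)).
Proof.
move=> mX mA; rewrite -Rint_indic; last exact: mfun_preimage.
by apply: eq_Rintegral => x _; rewrite comp_indic.
Qed.

Definition indep_rv Y X := forall U A : set R, measurable U -> measurable A ->
  (P (Y @^-1` U `&` X @^-1` A) = P (Y @^-1` U) * P (X @^-1` A))%E.

Lemma indep_rv_comp Y X (h f : R -> R) : indep_rv Y X ->
  measurable_fun setT h -> measurable_fun setT f ->
  indep_rv (fun x => h (Y x)) (fun x => f (X x)).
Proof.
move=> YX mh mf U A mU mA; apply: (YX (h @^-1` U) (f @^-1` A)).
- by rewrite -[X in measurable X]setTI; exact: mh.
- by rewrite -[X in measurable X]setTI; exact: mf.
Qed.

Lemma indep_Rint_indic Y X (U A : set R) : mfun Y -> mfun X -> indep_rv Y X ->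
  measurable U -> measurable A ->
  \int[P]_x (\1_U (Y x) * \1_A (X x)) =
  \int[P]_x \1_U (Y x) * \int[P]_x \1_A (X x).
Proof.
move=> mY mX YX mU mA; rewrite !Rint_indic_comp//.
rewrite -fineM ?fin_num_measure//; try exact: mfun_preimage.
rewrite -YX// -Rint_indic; last by apply: measurableI; exact: mfun_preimage.
apply: eq_Rintegral => x _; rewrite !comp_indic.
by rewrite -[RHS]/(\1_(_ `&` _) x) indicI.
Qed.

(** Uncorrelatedness with the indicators of X extends to all functions of X:
    apply Rint_comp_eq0 to the centered variable Y - E[Y]. *)
Lemma Rint_factor Y X (f : R -> R) : intg Y -> mfun X ->
  (forall A : set R, measurable A ->
    \int[P]_x (Y x * \1_A (X x)) = \int[P]_x Y x * \int[P]_x \1_A (X x)) ->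
  measurable_fun setT f -> intg (fun x => f (X x)) -> intg (fun x => Y x * f (X x)) ->
  \int[P]_x (Y x * f (X x)) = \int[P]_x Y x * \int[P]_x f (X x).
Proof.
move=> IY mX YX mf If IYf; set c := \int[P]_x Y x.
have IYc : intg (fun x => Y x - c) by apply: intgB => //; exact: intg_cst.
have h : \int[P]_x ((Y x - c) * f (X x)) = \int[P]_x (Y x * f (X x)) - c * \int[P]_x f (X x).
  rewrite -RintZ// -RintB//; last exact: intgZ.
  by apply: eq_Rintegral => x _; rewrite mulrBl.
apply/eqP; rewrite -subr_eq0 -h; apply/eqP; apply: Rint_comp_eq0 => //.
- move=> A mA.
  have IA := indic_intg mX mA.
  have IYA : intg (fun x => Y x * \1_A (X x)).
    by apply: (intg_bounded (C := 1)) => //; [exact: indic_mfun|move=> x; exact: indic_le1].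
  under eq_Rintegral do rewrite mulrBl.
  by rewrite RintB ?RintZ// ?YX ?subrr//; exact: intgZ.
- apply: eq_intg (intgB IYf (intgZ c If)) => x.
  by rewrite mulrBl.
Qed.

Lemma indep_Rint_indicr Y X (A : set R) : intg Y -> mfun X -> indep_rv Y X ->
  measurable A ->
  \int[P]_x (Y x * \1_A (X x)) = \int[P]_x Y x * \int[P]_x \1_A (X x).
Proof.
move=> IY mX YX mA; have mY := integrable_meas IY.
under eq_Rintegral do rewrite mulrC.
rewrite mulrC; apply: (@Rint_factor (fun x => \1_A (X x)) Y id) => //.
- exact: indic_intg.
- move=> U mU; under eq_Rintegral do rewrite mulrC.
  by rewrite indep_Rint_indic// mulrC.
- have := intg_bounded IY (indic_mfun mX mA) (fun x => indic_le1 _ A (X x)).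
  by apply: eq_intg => x; rewrite mulrC.
Qed.

Lemma indep_Rint_ge0 Y X : intg Y -> intg X -> (forall x, 0 <= Y x) -> (forall x, 0 <= X x) ->
  indep_rv Y X -> intg (fun x => Y x * X x).
Proof.
move=> IY IX Y0 X0 YX; have mY := integrable_meas IY; have mX := integrable_meas IX.
set c := \int[P]_x Y x.
have c0 : 0 <= c by exact: Rint_ge0.
pose abs (y : R) := `|y|.
have e : (\int[P]_x (Y x * abs (X x))%:E = \int[P]_x (c * abs (X x))%:E)%E.
  apply: (@ge0_integral_comp_eq _ _ _ _ Y (fun=> c)) => //.
    move=> A mA; rewrite -!EFin_Rint.
    - by rewrite indep_Rint_indicr// RintZ//; exact: indic_intg.
    - by apply: intgZ; exact: indic_intg.
    - by apply: (intg_bounded (C := 1)) => //; [exact: indic_mfun|move=> x; exact: indic_le1].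
  by move=> y; exact: normr_ge0.
apply: ge0_intg.
- exact: measurable_funM.
- by move=> x; rewrite mulr_ge0.
- rewrite (_ : (\int[P]_x _ = \int[P]_x (Y x * abs (X x))%:E)%E); last first.
    by apply: eq_integral => x _; rewrite /abs ger0_norm.
  have Ic : intg (fun x => c * abs (X x)) by apply: intgZ; exact: intg_norm.
  by rewrite e -EFin_Rint// ltry.
Qed.

Lemma indep_Rint Y X : intg Y -> intg X -> indep_rv Y X ->
  intg (fun x => Y x * X x) /\
  \int[P]_x (Y x * X x) = \int[P]_x Y x * \int[P]_x X x.
Proof.
move=> IY IX YX; have mY := integrable_meas IY; have mX := integrable_meas IX.
have I1 : intg (fun x => Y x * X x).
  have := indep_Rint_ge0 (intg_norm IY) (intg_norm IX) (fun=> normr_ge0 _)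
    (fun=> normr_ge0 _) (indep_rv_comp YX (@normr_measurable _ _) (@normr_measurable _ _)).
  apply: integrable_le; first exact: measurable_funM.
  by move=> x; rewrite normrM.
by split => //; apply: (@Rint_factor Y X id) => // A mA; exact: indep_Rint_indicr.
Qed.

Lemma indep_L2 Y X : L2 Y -> L2 X -> indep_rv Y X ->
  L2 (fun x => Y x * X x) /\
  \int[P]_x (Y x * X x) ^+ 2 = \int[P]_x Y x ^+ 2 * \int[P]_x X x ^+ 2.
Proof.
move=> LY LX YX.
have [I2 E2] := indep_Rint (L2_sqr LY) (L2_sqr LX)
  (indep_rv_comp YX (measurable_funX 2 (@measurable_id _ _ _)) (measurable_funX 2 (@measurable_id _ _ _))).
split; last by rewrite -E2; apply: eq_Rintegral => x _; rewrite exprMn.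
apply/L2P; split.
  by apply: measurable_funM; [exact: (L2_meas LY)|exact: (L2_meas LX)].
by apply: eq_intg I2 => x; rewrite exprMn.
Qed.

Lemma Rint_lambda_system Y : intg Y -> \int[P]_x Y x = 0 ->
  lambda_system setT [set G | measurable G /\ \int[P]_x (Y x * \1_G x) = 0].
Proof.
move=> IY Y0.
have IYG G : measurable G -> intg (fun x => Y x * \1_G x).
  by move=> mG; apply: (intg_bounded (C := 1)) => // x; exact: indic_le1.
split => //.
- split=> //; rewrite -[RHS]Y0; apply: eq_Rintegral => x _.
  by rewrite indicT mulr1.
- move=> A B BA [mA A0] [mB B0]; split; first exact: measurableD.
  rewrite (_ : \int[P]_x _ = \int[P]_x (Y x * \1_A x) - \int[P]_x (Y x * \1_B x)).
    by rewrite A0 B0 subrr.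
  rewrite -RintB ?IYG//; apply: eq_Rintegral => x _; rewrite -mulrBr; congr (_ * _).
  rewrite !indicE in_setD; have [xB|xB] := boolP (x \in B); rewrite /= ?andbF ?andbT ?subr0//.
  by have -> : x \in A; [apply/mem_set/BA/set_mem|rewrite subrr].
- move=> F ndF F0; split; first by apply: bigcupT_measurable => n; exact: (F0 n).1.
  have [||||_ cI] := @Rint_dominated_cvg _ _ _ P (fun n x => Y x * \1_(F n) x)
    (fun x => Y x * \1_(\bigcup_n F n) x) (fun x => `|Y x|).
  - by move=> n; exact: integrable_meas (IYG _ (F0 n).1).
  - exact: intg_norm.
  - by move=> n x; rewrite normrM ler_piMr// indic_le1.
  - move=> x; apply: cvgMl_tmp.
    have [[n _ Fnx]|nF] := pselect ((\bigcup_n F n) x).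
      apply: cvg_near_cst; exists n => // m /= nm.
      rewrite !indicE !mem_set//; first by exists n.
      by move/ndF : nm => /subsetPset; exact.
    apply: cvg_near_cst; apply: nearW => m.
    rewrite !indicE !memNset// => Fx; apply: nF; by exists m.
  have h : (fun n => \int[P]_x (Y x * \1_(F n) x)) = cst 0.
    by apply/funext => n; exact: (F0 n).2.
  by rewrite h in cI; rewrite -(cvg_lim _ cI)// lim_cst.
Qed.

(** Dynkin: the cylinders of X are stable under intersection, and the events
    on which Y has integral zero form a lambda-system. *)
Lemma Rint_sigma_gen_eq0 (I : choiceType) (D : set I) (X : I -> T -> R) Y :
  (forall i, D i -> mfun (X i)) -> intg Y ->
  (forall (J : {fset I}) (A : I -> set R), [set` J] `<=` D ->
    (forall i, measurable (A i)) ->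
    \int[P]_x (Y x * \1_(\bigcap_(i in [set` J]) X i @^-1` A i) x) = 0) ->
  forall G, sigma_gen D X G -> measurable G /\ \int[P]_x (Y x * \1_G x) = 0.
Proof.
move=> mX IY YJ.
pose PI : set (set T) := [set G | exists (J : {fset I}) (A : I -> set R),
  [/\ [set` J] `<=` D, forall i, measurable (A i) &
      G = \bigcap_(i in [set` J]) X i @^-1` A i]].
have PII : setI_closed PI.
  move=> _ _ [J1 [A1 [J1D mA1 ->]]] [J2 [A2 [J2D mA2 ->]]].
  exists (J1 `|` J2)%fset, (fun i => (if i \in J1 then A1 i else setT) `&`
     (if i \in J2 then A2 i else setT)); split.
  - by move=> i /=; rewrite inE => /orP[/J1D|/J2D].
  - by move=> i; apply: measurableI; case: ifP.
  - apply/seteqP; split=> x /=.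
      move=> [h1 h2] i /= _; split.
        by case: ifPn => // /h1.
      by case: ifPn => // /h2.
    move=> h; split=> i /= iJ; have := h i; rewrite /= inE iJ ?orbT => /(_ isT) [].
      by [].
    by [].
have Y0 : \int[P]_x Y x = 0.
  have := YJ fset0 (fun=> setT); rewrite set_fset0 bigcap_set0 => <- //.
    by apply: eq_Rintegral => x _; rewrite indicT mulr1.
have sub : sigma_gen D X `<=` <<s PI >>.
  apply: sub_sigma_algebra2 => G [i Di [A mA <-]].
  exists [fset i]%fset, (fun=> A); split => //.
  - by move=> j /=; rewrite inE => /eqP ->.
  - by rewrite set_fset1 bigcap_set1 setTI.
move=> G /sub; apply: (lambda_system_subset PII (Rint_lambda_system IY Y0)) => //.
move=> _ [J [A [JD mA ->]]]; split; last exact: YJ.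
apply: fin_bigcap_measurable => //= i iJ; apply: mfun_preimage => //.
by apply: mX; exact: JD.
Qed.

(** Mutual independence says that 1_A(X i) - P(X i in A) is orthogonal to the
    cylinders in the other coordinates, hence to all of their sigma-field. *)
Lemma mutual_indep_rv (I : choiceType) (D D' : set I) (X : I -> T -> R) i Y :
  mutual_indep P D X -> (forall j, D j -> mfun (X j)) ->
  D' `<=` D -> D i -> ~ D' i -> measurable_wrt (sigma_gen D' X) Y ->
  mfun Y /\ indep_rv Y (X i).
Proof.
move=> indX mX D'D Di D'i mY.
have key A : measurable A -> forall G, sigma_gen D' X G -> measurable G /\
    \int[P]_x ((\1_A (X i x) - fine (P (X i @^-1` A))) * \1_G x) = 0.
  move=> mA; set p := fine _.
  have IA := indic_intg (mX _ Di) mA.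
  apply: Rint_sigma_gen_eq0.
  - by move=> j /D'D; exact: mX.
  - by apply: intgB => //; exact: intg_cst.
  - move=> J B JD' mB.
    set G := \bigcap_(j in [set` J]) _.
    have mG : measurable G.
      apply: fin_bigcap_measurable => //= j jJ; apply: mfun_preimage => //.
      by apply/mX/D'D/JD'.
    have iJ : i \notin J by apply/negP => iJ; apply: D'i; exact: JD'.
    pose B' j := if j == i then A else B j.
    have mB' j : measurable (B' j) by rewrite /B'; case: ifP.
    have GE : G = \bigcap_(j in [set` J]) X j @^-1` B' j.
      apply: eq_bigcapr => j jJ; rewrite /B'; case: eqP => // ji.
      by move: iJ; rewrite -ji; move: jJ => /= ->.
    have PG := indX J B' (subset_trans JD' D'D) mB'.
    have sub : [set` (i |` J)%fset] `<=` D.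
      by move=> j /=; rewrite in_fset1U => /orP[/eqP ->//|/JD'/D'D].
    have PGi := indX (i |` J)%fset B' sub mB'.
    rewrite big_fsetU1//= set_fsetU1 bigcap_setU1 -PG -GE {1 2}/B' eqxx in PGi.
    under eq_Rintegral do rewrite mulrBl.
    have IG : intg \1_G by apply: integrable_le (intg_cst 1) => [|x]; [exact: measurable_indic|exact: indic_le1].
    rewrite RintB; last 2 first.
      have := intg_bounded IG (indic_mfun (mX _ Di) mA) (fun x => indic_le1 _ A (X i x)).
      by apply: eq_intg => x; rewrite mulrC.
      exact: intgZ.
    rewrite RintZ// Rint_indic// /p -fineM ?fin_num_measure//; last first.
      by apply: mfun_preimage => //; exact: mX.
    rewrite -PGi.
    rewrite -Rint_indic; last by apply: measurableI => //; apply: mfun_preimage => //; exact: mX.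
    apply/eqP; rewrite subr_eq0; apply/eqP; apply: eq_Rintegral => x _.
    by rewrite indicI comp_indic.
have mYG G : sigma_gen D' X G -> measurable G.
  by move=> /(key setT measurableT)[].
have mfY : mfun Y by move=> _ U mU; rewrite setTI; apply: mYG; exact: mY.
split => // U A mU mA.
have [mG] := key A mA _ (mY U mU).
have mXi := mX _ Di.
under eq_Rintegral do rewrite mulrBl.
have IG : intg \1_(Y @^-1` U).
  by apply: integrable_le (intg_cst 1) => [|x]; [exact: measurable_indic|exact: indic_le1].
have mXA := mfun_preimage mXi mA.
rewrite RintB; last 2 first.
  have := intg_bounded IG (indic_mfun mXi mA) (fun x => indic_le1 _ A (X i x)).
  by apply: eq_intg => x; rewrite mulrC.
  exact: intgZ.
rewrite RintZ// Rint_indic// -fineM ?fin_num_measure//.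
move/eqP; rewrite subr_eq0 => /eqP h.
rewrite muleC -[RHS]fineK ?fin_numM ?fin_num_measure// -h -[LHS]fineK; last first.
  by rewrite fin_num_measure//; exact: measurableI.
congr EFin; rewrite -Rint_indic; last exact: measurableI.
by apply: eq_Rintegral => x _; rewrite indicI comp_indic mulrC.
Qed.

(** A conditional expectation is only assumed integrable. Testing it against
    its own truncation t gives E[t^2] = E[Z t], so E[t^2] <= E[Z^2] by
    Cauchy-Schwarz, uniformly in the level of truncation. *)
Lemma cond_exp_L2 (G : set (set T)) (Z C : T -> R) :
  (forall A, G A -> measurable A) -> L2 Z -> cond_exp P G Z C ->
  L2 C /\ forall V, measurable_wrt G V -> L2 V ->
    \int[P]_x (C x * V x) = \int[P]_x (Z x * V x).
Proof.
move=> Gm LZ [mC IC CZ]; have IZ := L2_intg LZ.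
have mfw V : measurable_wrt G V -> mfun V.
  by move=> mV _ U mU; rewrite setTI; apply/Gm/mV.
have restr A Y : \int[P]_x (Y x * \1_A x) = fine (\int[P]_(x in A) (Y x)%:E).
  rewrite -[RHS]/(\int[P]_(x in A) Y x) [RHS]Rintegral_mkcond; apply: eq_Rintegral => x _.
  by rewrite patch_indic.
have ICZ := intgB IC IZ.
have key V : measurable_wrt G V -> intg (fun x => (C x - Z x) * V x) ->
    \int[P]_x ((C x - Z x) * V x) = 0.
  move=> mV IV; apply: (@Rint_comp_eq0 _ _ _ P (fun x => C x - Z x) V id) => //.
    exact: mfw.
  move=> A mA.
  under eq_Rintegral do rewrite mulrBl.
  have Ib Y : intg Y -> intg (fun x => Y x * \1_A (V x)).
    move=> IY; apply: (intg_bounded (C := 1)) => //; last by move=> x; exact: indic_le1.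
    by apply: indic_mfun => //; exact: mfw.
  rewrite RintB; [|exact: Ib|exact: Ib].
  under eq_Rintegral do rewrite comp_indic.
  under [X in _ - X]eq_Rintegral do rewrite comp_indic.
  by rewrite !restr CZ ?subrr//; exact: mV.
have mfC := mfw _ mC.
have trC n : L2 (truncated C n) /\ \int[P]_x (truncated C n x) ^+ 2 <= \int[P]_x Z x ^+ 2.
  have mt : mfun (truncated C n) by exact: (mfun_comp mfC (mfun_truncation n)).
  have bt x : `|truncated C n x| <= n%:R.
    rewrite /truncated indicE; case: (boolP (_ \in _)) => h; rewrite ?mulr0 ?normr0 ?mulr1//.
    by move: h; rewrite inE.
  have Lt : L2 (truncated C n).
    apply: L2_le (Lfun_cst P n%:R 2) => // x; rewrite /=.
    by rewrite (le_trans (bt x))// ler_norm.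
  split => //.
  have h : \int[P]_x (truncated C n x) ^+ 2 = \int[P]_x (Z x * truncated C n x).
    apply/eqP; rewrite -subr_eq0 -RintB; [|exact: L2_sqr|exact: L2M].
    have e x : truncated C n x ^+ 2 - Z x * truncated C n x = (C x - Z x) * truncated C n x.
      rewrite mulrBl; congr (_ - _); rewrite /truncated indicE.
      by case: (_ \in _); rewrite ?mulr1 ?mulr0 ?expr0n ?expr2.
    under eq_Rintegral do rewrite e.
    apply/eqP; apply: key; last exact: (intg_bounded (C := n%:R)).
    move=> U mU; apply: (mC ((fun y => y * \1_[set y : R | `|y| <= n%:R] y) @^-1` U)).
    by rewrite -[X in measurable X]setTI; exact: mfun_truncation.
  have := L2_cauchy_schwarz LZ Lt; rewrite -h.
  have : 0 <= \int[P]_x (truncated C n x) ^+ 2 by apply: Rint_ge0 => x; exact: sqr_ge0.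
  rewrite expr2 le_eqVlt => /predU1P[<- _|c0]; last by rewrite ler_pM2r.
  by apply: Rint_ge0 => x; exact: sqr_ge0.
have [LC _] : L2 C /\ \int[P]_x C x ^+ 2 <= \int[P]_x Z x ^+ 2.
  apply: L2_truncation => // n; rewrite -EFin_Rint ?lee_fin; first by case: (trC n).
  by apply: L2_sqr; case: (trC n).
split => // V mV LV; apply/eqP; rewrite -subr_eq0 -RintB; [|exact: L2M|exact: L2M].
under eq_Rintegral do rewrite -mulrBl.
apply/eqP; apply: key => //; exact: L2M (L2B LC LZ) LV.
Qed.

End independence.

(** * White noise and discrete Wick exponentials *)

Section generated_sigma_field.
Context d (T : measurableType d) (R : realType) (P : probability T R).
Context (I : Type) (D : set I) (X : I -> T -> R).

Let C := \bigcup_(i in D) preimage_set_system setT (X i) measurable.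
Let G := sigma_gen D X.

Lemma measurable_wrtE (Y : T -> R) : measurable_wrt G Y <->
  measurable_fun [set: g_sigma_algebraType C] (Y : g_sigma_algebraType C -> R).
Proof.
split=> mY; first by move=> _ U mU; rewrite setTI; exact: mY.
by move=> U mU; have := mY measurableT U mU; rewrite setTI.
Qed.

Lemma measurable_wrt_cst (c : R) : measurable_wrt G (fun=> c).
Proof. by apply/measurable_wrtE; exact: measurable_cst. Qed.

Lemma measurable_wrtD (Y Z : T -> R) : measurable_wrt G Y -> measurable_wrt G Z ->
  measurable_wrt G (fun x => Y x + Z x).
Proof.
by move=> /measurable_wrtE mY /measurable_wrtE mZ; apply/measurable_wrtE;
  exact: measurable_funD.
Qed.

Lemma measurable_wrtM (Y Z : T -> R) : measurable_wrt G Y -> measurable_wrt G Z ->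
  measurable_wrt G (fun x => Y x * Z x).
Proof.
by move=> /measurable_wrtE mY /measurable_wrtE mZ; apply/measurable_wrtE;
  exact: measurable_funM.
Qed.

Lemma measurable_wrt_comp (f : R -> R) i : D i -> measurable_fun setT f ->
  measurable_wrt G (fun x => f (X i x)).
Proof.
move=> Di mf U mU; apply: sub_sigma_algebra; exists i => //.
exists (f @^-1` U); last by rewrite setTI.
by rewrite -[X in measurable X]setTI; exact: mf.
Qed.

Lemma measurable_wrt_sum (J : eqType) (s : seq J) (F : J -> T -> R) :
  (forall j, j \in s -> measurable_wrt G (F j)) ->
  measurable_wrt G (fun x => \sum_(j <- s) F j x).
Proof.
elim: s => [|j s ih] mF; first by under eq_fun do rewrite big_nil; exact: measurable_wrt_cst.
under eq_fun do rewrite big_cons; apply: measurable_wrtD.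
  by apply: mF; rewrite mem_head.
by apply: ih => k ks; apply: mF; rewrite inE ks orbT.
Qed.

Lemma measurable_wrt_prod (J : eqType) (s : seq J) (F : J -> T -> R) :
  (forall j, j \in s -> measurable_wrt G (F j)) ->
  measurable_wrt G (fun x => \prod_(j <- s) F j x).
Proof.
elim: s => [|j s ih] mF; first by under eq_fun do rewrite big_nil; exact: measurable_wrt_cst.
under eq_fun do rewrite big_cons; apply: measurable_wrtM.
  by apply: mF; rewrite mem_head.
by apply: ih => k ks; apply: mF; rewrite inE ks orbT.
Qed.

Lemma sigma_gen_measurable : (forall i, D i -> measurable_fun setT (X i)) ->
  forall A, G A -> measurable A.
Proof.
move=> mX; apply: smallest_sub; first exact: sigma_algebra_measurable.
move=> _ [i Di [A mA <-]]; exact: mX.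
Qed.

End generated_sigma_field.

Section white_noise.
Context d (T : measurableType d) (R : realType) (P : probability T R).

Local Notation mfun f := (measurable_fun [set: T] (f : T -> R)).
Local Notation intg f := (P.-integrable [set: T] (EFin \o (f : T -> R))).
Local Notation L2 f := ((f : T -> R) \in Lfun P 2%:E).

Definition white_noise (X : nat -> T -> R) :=
  [/\ mutual_indep P [set i | (0 < i)%N] X,
      forall i, (0 < i)%N -> L2 (X i),
      forall i, (0 < i)%N -> \int[P]_x X i x = 0 &
      forall i, (0 < i)%N -> \int[P]_x X i x ^+ 2 = 1].

Context (X : nat -> T -> R).
Hypothesis noise : white_noise X.

Lemma noise_mfun i : (0 < i)%N -> mfun (X i).
Proof. by case: noise => _ LX _ _ /LX; exact: L2_meas. Qed.

Lemma noise_indep (D' : set nat) i Y : (forall j, D' j -> (0 < j)%N) -> (0 < i)%N ->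
  ~ D' i -> measurable_wrt (sigma_gen D' X) Y -> mfun Y /\ indep_rv P Y (X i).
Proof.
move=> D'0 i0 D'i mY; have [indX _ _ _] := noise.
apply: (mutual_indep_rv indX _ _ _ D'i mY) => //.
by move=> j; exact: noise_mfun.
Qed.

Lemma noise_sum (f : nat -> R -> R) (N : nat) :
  (forall i, measurable_fun setT (f i)) ->
  (forall i, (0 < i)%N -> L2 (fun x => f i (X i x))) ->
  (forall i, (0 < i)%N -> \int[P]_x f i (X i x) = 0) ->
  L2 (fun x => \sum_(1 <= i < N.+1) f i (X i x)) /\
  \int[P]_x (\sum_(1 <= i < N.+1) f i (X i x)) ^+ 2 =
  \sum_(1 <= i < N.+1) \int[P]_x f i (X i x) ^+ 2.
Proof.
move=> mf Lf f0; elim: N => [|N [LN EN]].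
  rewrite big_nil; under eq_fun do rewrite big_nil; split; first exact: L20.
  by under eq_Rintegral do rewrite big_nil expr0n /=; rewrite Rint_cst.
under eq_fun do rewrite big_nat_recr//=.
rewrite big_nat_recr//= -EN.
set S := fun x => \sum_(1 <= i < N.+1) f i (X i x).
have LfN := Lf N.+1 isT.
split; first exact: L2D.
have [mS iS] : mfun S /\ indep_rv P S (X N.+1).
  apply: (@noise_indep [set j | (0 < j <= N)%N]) => //=.
  - by move=> j /andP[].
  - by rewrite ltnn.
  - apply: measurable_wrt_sum => j; rewrite mem_index_iota => jN.
    exact: measurable_wrt_comp.
have [_ cross] := indep_Rint (L2_intg LN) (L2_intg LfN)
  (indep_rv_comp iS (@measurable_id _ _ _) (mf N.+1)).
have e x : (\sum_(1 <= i < N.+2) f i (X i x)) ^+ 2 =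
    (S x ^+ 2 + f N.+1 (X N.+1 x) ^+ 2) + 2 * (S x * f N.+1 (X N.+1 x)).
  by rewrite big_nat_recr//= -/(S x); ring.
under eq_Rintegral do rewrite e.
have I1 := L2_sqr LN; have I2 := L2_sqr LfN; have I3 := L2M LN LfN.
rewrite RintD; [|exact: intgD|exact: intgZ].
by rewrite RintD// RintZ// cross f0// !mulr0 addr0.
Qed.

(** The discrete counterpart of exp(I(g) - |g|^2 / 2): the coefficient a i
    stands for g(i/n) / sqrt n. *)
Definition wick_prod (a : nat -> R) (N : nat) (x : T) :=
  \prod_(1 <= i < N.+1) (1 + a i * X i x).

Lemma wick_prod_moments (a : nat -> R) (N : nat) :
  [/\ L2 (wick_prod a N), \int[P]_x wick_prod a N x = 1 &
      \int[P]_x wick_prod a N x ^+ 2 = \prod_(1 <= i < N.+1) (1 + a i ^+ 2)].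
Proof.
have [_ LX X0 X1] := noise.
elim: N => [|N [LN E1 E2]].
  rewrite big_nil /wick_prod; under eq_fun do rewrite big_nil; split.
  - exact: Lfun_cst.
  - by rewrite Rint_cst.
  - by under eq_Rintegral do rewrite big_nil expr1n; rewrite Rint_cst.
rewrite big_nat_recr//= -E2.
pose h (y : R) := 1 + a N.+1 * y.
have mh : measurable_fun setT h.
  by apply: measurable_funD => //; apply: measurable_funM.
have e x : wick_prod a N.+1 x = wick_prod a N x * h (X N.+1 x).
  by rewrite /wick_prod big_nat_recr.
have LX1 := LX N.+1 isT.
have Lh : L2 (fun x => h (X N.+1 x)).
  by apply: L2D; [exact: Lfun_cst|exact: L2Z].
have [mS iS] : mfun (wick_prod a N) /\ indep_rv P (wick_prod a N) (X N.+1).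
  apply: (@noise_indep [set j | (0 < j <= N)%N]) => //=.
  - by move=> j /andP[].
  - by rewrite ltnn.
  - apply: measurable_wrt_prod => j; rewrite mem_index_iota => jN.
    apply: (measurable_wrt_comp (f := fun y => 1 + a j * y)) => //.
    by apply: measurable_funD => //; apply: measurable_funM.
have iSh := indep_rv_comp iS (@measurable_id _ _ _) mh.
have [_ E1'] := indep_Rint (L2_intg LN) (L2_intg Lh) iSh.
have [LN' E2'] := indep_L2 LN Lh iSh.
split.
- by rewrite (_ : wick_prod a N.+1 = (fun x => wick_prod a N x * h (X N.+1 x))); last exact/funext.
- under eq_Rintegral do rewrite e.
  rewrite E1' E1 mul1r /h RintD; [|exact: intg_cst|exact/intgZ/L2_intg].
  by rewrite Rint_cst RintZ ?X0 ?mulr0 ?addr0//; exact: L2_intg.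
- under eq_Rintegral do rewrite e.
  rewrite E2'; congr (_ * _).
  have e2 x : h (X N.+1 x) ^+ 2 =
      1 + 2 * a N.+1 * X N.+1 x + a N.+1 ^+ 2 * X N.+1 x ^+ 2.
    by rewrite /h; ring.
  under eq_Rintegral do rewrite e2.
  have I1 := L2_intg LX1; have I2 := L2_sqr LX1.
  rewrite RintD; [|apply: intgD; [exact: intg_cst|exact: intgZ]|exact: intgZ].
  rewrite RintD; [|exact: intg_cst|exact: intgZ].
  by rewrite Rint_cst !RintZ// X0// X1// mulr0 addr0 mulr1.
Qed.

Lemma wick_prod_le (a : nat -> R) (N : nat) :
  \int[P]_x wick_prod a N x ^+ 2 <= expR (\sum_(1 <= i < N.+1) a i ^+ 2).
Proof.
have [_ _ ->] := wick_prod_moments a N.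
rewrite expR_sum; apply: ler_prod => i _.
by rewrite addr_ge0 ?sqr_ge0//= expR_ge1Dx.
Qed.

Definition omit (a : nat -> R) (i j : nat) : R := if j == i then 0 else a j.

Lemma omit_id a i : omit a i i = 0.
Proof. by rewrite /omit eqxx. Qed.

Lemma wick_prod_omit (a : nat -> R) (N i : nat) x : (0 < i <= N)%N ->
  wick_prod a N x = wick_prod (omit a i) N x * (1 + a i * X i x).
Proof.
move=> iN; rewrite /wick_prod !(bigD1_seq i) ?iota_uniq ?mem_index_iota//=.
rewrite omit_id mul0r addr0 mul1r mulrC; congr (_ * _).
by apply: eq_bigr => j /negbTE ji; rewrite /omit ji.
Qed.

Lemma omit_sum_le (a : nat -> R) i N :
  \sum_(1 <= j < N.+1) omit a i j ^+ 2 <= \sum_(1 <= j < N.+1) a j ^+ 2.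
Proof.
apply: ler_sum => j _; rewrite /omit; case: eqP => // _.
by rewrite expr0n sqr_ge0.
Qed.

Lemma wick_prod_omit_indep (a : nat -> R) (N i : nat) : (0 < i)%N ->
  indep_rv P (wick_prod (omit a i) N) (X i).
Proof.
move=> i0; suff [] : mfun (wick_prod (omit a i) N) /\
    indep_rv P (wick_prod (omit a i) N) (X i) by [].
apply: (@noise_indep [set j | (0 < j)%N && (j != i)]) => //=.
- by move=> j /andP[].
- by rewrite eqxx andbF.
- apply: measurable_wrt_prod => j; rewrite mem_index_iota => /andP[j0 _].
  have [->|ji] := eqVneq j i.
    rewrite (_ : (fun x : T => 1 + omit a i i * X i x) = fun=> 1).
      exact: measurable_wrt_cst.
    by apply/funext => x; rewrite omit_id mul0r addr0.
  apply: (measurable_wrt_comp (f := fun y => 1 + omit a i j * y)) => //=; first exact/andP.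
  by apply: measurable_funD => //; apply: measurable_funM.
Qed.

(** The two products differ by the summand a i * X i of the deleted factor,
    which is independent of the other factors. *)
Lemma wick_prod_omit_dist (a : nat -> R) (N i : nat) : (0 < i <= N)%N ->
  \int[P]_x (wick_prod (omit a i) N x - wick_prod a N x) ^+ 2 <=
  a i ^+ 2 * expR (\sum_(1 <= j < N.+1) a j ^+ 2).
Proof.
move=> iN; have i0 : (0 < i)%N by case/andP: iN.
have [_ LX X0 X1] := noise.
have [L E1 E2] := wick_prod_moments (omit a i) N.
have [_ E] := indep_L2 L (LX i i0) (wick_prod_omit_indep a N i0).
have e x : (wick_prod (omit a i) N x - wick_prod a N x) ^+ 2 =
    a i ^+ 2 * (wick_prod (omit a i) N x * X i x) ^+ 2.
  by rewrite (wick_prod_omit a x iN); ring.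
under eq_Rintegral do rewrite e.
rewrite RintZ; last first.
  by apply: L2_sqr; have [] := indep_L2 L (LX i i0) (wick_prod_omit_indep a N i0).
rewrite E X1// mulr1 ler_wpM2l ?sqr_ge0//.
by rewrite (le_trans (wick_prod_le _ _))// ler_expR omit_sum_le.
Qed.

(** Integration by parts for the noise: E[Z | F_(M,-i)] and the product
    without its i-th factor do not depend on X i, and E[X i (1 + a i * X i)] =
    a i. The terms i > N vanish, so the partial sums are constant from M = N
    on and the limit in M is exact. *)
Lemma discrete_duality (n : nat) (a : nat -> R) (N : nat) (Z : nat -> T -> R) (delta : T -> R) :
  (forall i, (N < i)%N -> a i = 0) ->
  discrete_skorokhod_integral P n X Z delta ->
  \int[P]_x (delta x * wick_prod a N x) =
  \sum_(1 <= i < N.+1) a i / Num.sqrt n%:R * \int[P]_x (Z i x * wick_prod (omit a i) N x).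
Proof.
move=> aN [[LZ _] Ldelta [C CZ cvgC]].
have [_ LX X0 X1] := noise.
have mgen D' : (forall j, D' j -> (0 < j)%N) -> forall A, sigma_gen D' X A -> measurable A.
  by move=> D'0; apply: sigma_gen_measurable => j /D'0; exact: noise_mfun.
pose D' M i := [set j | (0 < j <= M)%N && (j != i)].
have D'0 M i j : D' M i j -> (0 < j)%N by move=> /andP[/andP[]].
have LC M i : (0 < i <= M)%N -> [/\ measurable_wrt (sigma_gen (D' M i) X) (C M i), L2 (C M i) &
    forall V, measurable_wrt (sigma_gen (D' M i) X) V -> L2 V ->
    \int[P]_x (C M i x * V x) = \int[P]_x (Z i x * V x)].
  move=> iM; have i0 : (0 < i)%N by case/andP: iM.
  have [L h] := cond_exp_L2 (mgen _ (@D'0 M i)) (LZ i i0).2 (CZ M i iM).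
  by split => //; case: (CZ M i iM).
have iC M i V : (0 < i <= M)%N -> measurable_wrt (sigma_gen (D' M i) X) V -> indep_rv P V (X i).
  move=> iM mV; have i0 : (0 < i)%N by case/andP: iM.
  have nD : ~ D' M i i by rewrite /D' /= eqxx andbF.
  by have [] := noise_indep (@D'0 M i) i0 nD mV.
pose S M x := \sum_(1 <= i < M.+1) C M i x * (X i x / Num.sqrt n%:R).
have LS M : L2 (S M).
  rewrite (_ : S M = (fun x => \sum_(1 <= i < M.+1)
    (if (0 < i <= M)%N then C M i x * (X i x / Num.sqrt n%:R) else 0))); last first.
    by apply/funext => x; apply: eq_big_nat => i ->.
  apply: L2_sum => i; have [iM|_] := boolP (0 < i <= M)%N; last exact: L20.
  have [mC L _] := LC M i iM.
  have i0 : (0 < i)%N by case/andP: iM.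
  have [LL _] := indep_L2 L (LX i i0) (iC M i _ iM mC).
  have := L2Z (Num.sqrt n%:R)^-1 LL.
  by under eq_fun do rewrite mulrC -mulrA.
have [LD _ _] := wick_prod_moments a N.
have cv : \int[P]_x (S M x * wick_prod a N x) @[M --> \oo] -->
    \int[P]_x (delta x * wick_prod a N x).
  have := strong_cvg_Rint LS Ldelta cvgC.
  move=> h; have h2 : Num.sqrt (\int[P]_x (S M x - delta x) ^+ 2 *
    \int[P]_x wick_prod a N x ^+ 2) @[M --> \oo] --> (0 : R).
    rewrite -sqrtr0 -(mul0r (\int[P]_x wick_prod a N x ^+ 2)).
    by apply: (cvg_comp _ _ (cvgMr_tmp h)); exact: sqrt_continuous.
  apply: cvgr_dist_squeeze h2 => M.
  rewrite -RintB; [|exact: L2M|exact: L2M].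
  under eq_Rintegral do rewrite -mulrBl.
  rewrite -sqrtr_sqr ler_sqrt; last first.
    by rewrite mulr_ge0// Rint_ge0// => x; exact: sqr_ge0.
  by apply: L2_cauchy_schwarz => //; exact: L2B.
have eqS M : (N <= M)%N -> \int[P]_x (S M x * wick_prod a N x) =
    \sum_(1 <= i < N.+1) a i / Num.sqrt n%:R * \int[P]_x (Z i x * wick_prod (omit a i) N x).
  move=> NM.
  have WM b x : (forall i, (N < i)%N -> b i = 0) -> wick_prod b M x = wick_prod b N x.
    move=> bN; rewrite /wick_prod (big_cat_nat (n := N.+1))//= [X in _ * X]big1_seq ?mulr1//.
    by move=> i /andP[_]; rewrite mem_index_iota => /andP[/bN -> _]; rewrite mul0r addr0.
  have omN i : forall j, (N < j)%N -> omit a i j = 0.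
    by move=> j /aN; rewrite /omit; case: ifP.
  transitivity (\sum_(1 <= i < M.+1) a i / Num.sqrt n%:R * \int[P]_x (Z i x * wick_prod (omit a i) M x)).
    (* Split the integrand into a function of the other coordinates and h (X
       i). *)
    have term i : (0 < i <= M)%N -> intg (fun x => C M i x * (X i x / Num.sqrt n%:R) * wick_prod a N x) /\
      \int[P]_x (C M i x * (X i x / Num.sqrt n%:R) * wick_prod a N x) =
      a i / Num.sqrt n%:R * \int[P]_x (Z i x * wick_prod (omit a i) M x).
      move=> iM; have i0 : (0 < i)%N by case/andP: iM.
      have [mC L CV] := LC M i iM.
      have mW : measurable_wrt (sigma_gen (D' M i) X) (wick_prod (omit a i) M).
        apply: measurable_wrt_prod => j; rewrite mem_index_iota => jM.
        have [->|ji] := eqVneq j i.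
          rewrite (_ : (fun x : T => 1 + omit a i i * X i x) = fun=> 1).
            exact: measurable_wrt_cst.
          by apply/funext => x; rewrite omit_id mul0r addr0.
        apply: (measurable_wrt_comp (f := fun y => 1 + omit a i j * y)) => //=; first exact/andP.
        by apply: measurable_funD => //; apply: measurable_funM.
      have [LW _ _] := wick_prod_moments (omit a i) M.
      pose h (y : R) := y / Num.sqrt n%:R * (1 + a i * y).
      have mh : measurable_fun setT h.
        by apply: measurable_funM; [apply: measurable_funM|apply: measurable_funD => //; apply: measurable_funM].
      have hE x : h (X i x) = (Num.sqrt n%:R)^-1 * X i x + (Num.sqrt n%:R)^-1 * a i * X i x ^+ 2.
        by rewrite /h; ring.
      have I1 := L2_intg (LX i i0); have I2 := L2_sqr (LX i i0).
      have Ih : intg (fun x => h (X i x)).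
        by under eq_fun do rewrite hE; apply: intgD; exact: intgZ.
      have inde := indep_rv_comp (iC M i _ iM (measurable_wrtM mC mW)) (@measurable_id _ _ _) mh.
      have [II EE] := indep_Rint (L2M L LW) Ih inde.
      have e x : C M i x * (X i x / Num.sqrt n%:R) * wick_prod a N x =
          C M i x * wick_prod (omit a i) M x * h (X i x).
        by rewrite -WM// (wick_prod_omit a x iM) /h; ring.
      split; first by under eq_fun do rewrite e.
      under eq_Rintegral do rewrite e.
      rewrite EE CV// mulrC; congr (_ * _).
      under eq_Rintegral do rewrite hE.
      by rewrite RintD ?RintZ ?X0 ?X1 ?mulr0 ?add0r ?mulr1 1?mulrC//; exact: intgZ.
    rewrite /S; under eq_Rintegral do rewrite mulr_suml.
    rewrite (_ : \int[P]_x _ = \int[P]_x \sum_(1 <= i < M.+1)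
      (if (0 < i <= M)%N then C M i x * (X i x / Num.sqrt n%:R) * wick_prod a N x else 0)); last first.
      by apply: eq_Rintegral => x _; apply: eq_big_nat => i ->.
    rewrite Rint_sum; last first.
      by move=> i; have [/term[]//|_] := boolP (0 < i <= M)%N; exact: intg_cst.
    by apply: eq_big_nat => i iM; rewrite iM; case: (term i iM).
  rewrite (big_cat_nat (n := N.+1))//= [X in _ + X]big1_seq ?addr0//.
    apply: eq_big_nat => i iN; congr (_ * _); apply: eq_Rintegral => x _.
    by rewrite WM//; exact: omN.
  by move=> i /andP[_]; rewrite mem_index_iota => /andP[/aN -> _]; rewrite !mul0r.
rewrite -(cvg_lim _ cv)//; apply: cvg_lim => //; apply: cvg_near_cst.
by exists N => // M /= NM; exact: eqS.
Qed.

End white_noise.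

(** * Convergence in probability *)

Section convergence_in_probability.
Context d (T : measurableType d) (R : realType) (P : probability T R).

Local Notation mfun f := (measurable_fun [set: T] (f : T -> R)).
Local Notation intg f := (P.-integrable [set: T] (EFin \o (f : T -> R))).
Local Notation L2 f := ((f : T -> R) \in Lfun P 2%:E).

Lemma indic_sqr_le1 (U : Type) (A : set U) x : (\1_A x : R) ^+ 2 <= 1.
Proof. by rewrite indicE; case: (_ \in _); rewrite ?expr1n ?expr0n. Qed.

Lemma measurable_gt (c : R) (f : T -> R) : mfun f -> measurable [set x | c < f x].
Proof.
move=> mf; rewrite (_ : [set _ | _] = f @^-1` `]c, +oo[%classic).
  exact: mfun_preimage.
by apply/seteqP; split => x /=; rewrite in_itv/= andbT.
Qed.

Lemma measurable_dist_gt (c : R) (f g : T -> R) : mfun f -> mfun g ->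
  measurable [set x | c < `|f x - g x|].
Proof.
move=> mf mg; apply: (@measurable_gt c (fun x => `|f x - g x|)).
by apply: measurableT_comp => //; exact: measurable_funB.
Qed.

Lemma markov_Rint (c : R) (f : T -> R) : intg f -> (forall x, 0 <= f x) ->
  c * fine (P [set x | c < f x]) <= \int[P]_x f x.
Proof.
move=> If f0; have mA := measurable_gt c (integrable_meas If).
have IA : intg \1_[set x | c < f x].
  by apply: integrable_le (intg_cst P 1) => [|x]; [exact: measurable_indic|exact: indic_le1].
rewrite -Rint_indic// -RintZ//; apply: le_Rint => //; first exact: intgZ.
move=> x; rewrite indicE; case: (boolP (_ \in _)) => h; rewrite ?mulr0 ?mulr1//.
by move: h; rewrite inE /= => /ltW.
Qed.

Lemma prob_union_le (A B : set T) : measurable A -> measurable B ->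
  fine (P (A `|` B)) <= fine (P A) + fine (P B).
Proof.
move=> mA mB; rewrite -lee_fin EFinD !fineK ?fin_num_measure//; last exact: measurableU.
exact: measureU2.
Qed.

Lemma prob_le (A B : set T) : measurable A -> measurable B -> A `<=` B ->
  fine (P A) <= fine (P B).
Proof.
by move=> mA mB AB; rewrite fine_le ?fin_num_measure// le_measure ?inE.
Qed.

Lemma Rint_tail_cvg0 (Y : T -> R) : intg Y -> (forall x, 0 <= Y x) -> forall (g : T -> R), mfun g ->
  \int[P]_x (Y x * \1_[set x | n%:R < g x] x) @[n --> \oo] --> (0 : R).
Proof.
move=> IY Y0 g mg.
have [||||_ cI] := @Rint_dominated_cvg _ _ _ P
  (fun n x => Y x * \1_[set x | n%:R < g x] x) (fun=> 0) Y.
- move=> n; apply: measurable_funM; first exact: integrable_meas IY.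
  by apply: measurable_indic; exact: measurable_gt.
- by [].
- by move=> n x; rewrite normrM (ger0_norm (Y0 x)) ler_piMr// indic_le1.
- move=> x; apply: cvg_near_cst; near=> n; rewrite indicE memNset ?mulr0//=.
  by apply/negP; rewrite -leNgt; near: n; exact: nbhs_infty_ger.
by rewrite Rint_cst in cI.
Unshelve. all: by end_near. Qed.

Lemma cvg_in_probability_fine (X_ : nat -> T -> R) (X : T -> R) :
  cvg_in_probability P X_ X -> forall e g : R, 0 < e -> 0 < g ->
  \forall n \near \oo, fine (P [set w | e < `|X_ n w - X w|]) <= g.
Proof.
move=> cX e g e0 g0; have /fine_cvg /cvgr0_norm_le /(_ _ g0) := cX e e0.
by apply: filterS => n /=; apply: le_trans; exact: ler_norm.
Qed.

Lemma intg_indic (A : set T) : measurable A -> intg \1_A.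
Proof.
by move=> mA; apply: integrable_le (intg_cst P 1) => [|x]; [exact: measurable_indic|exact: indic_le1].
Qed.

(** Fatou's lemma for convergence in probability. The factor 2 comes from (a +
    b)^2 <= 2 a^2 + 2 b^2 and suffices, since only square-integrability and an
    upper bound up to constants are needed; truncating X makes the event where
    X_ N is far from X harmless. *)
Lemma L2_cvg_in_probability (X_ : nat -> T -> R) (X : T -> R) (C : nat -> R) (c : R) :
  (forall n, L2 (X_ n)) -> mfun X -> cvg_in_probability P X_ X ->
  (\forall n \near \oo, \int[P]_x X_ n x ^+ 2 <= C n) -> C n @[n --> \oo] --> c ->
  L2 X /\ \int[P]_x X x ^+ 2 <= 2 * c.
Proof.
move=> LX mX cX XC Cc; apply: L2_truncation => // K.
have mt : mfun (truncated X K) by exact: (mfun_comp mX (mfun_truncation K)).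
have bt x : `|truncated X K x| <= K%:R.
  rewrite /truncated indicE; case: (boolP (_ \in _)) => h; rewrite ?mulr0 ?normr0 ?mulr1//.
  by move: h; rewrite inE.
have Lt : L2 (truncated X K).
  by apply: L2_le (Lfun_cst P K%:R 2) => // x; rewrite /= (le_trans (bt x))// ler_norm.
rewrite -EFin_Rint; last exact: L2_sqr.
rewrite lee_fin; apply/ler_addgt0Pr => e e0.
have K0 : 0 < K%:R ^+ 2 + 1 :> R by rewrite ltr_wpDl ?sqr_ge0.
pose e' := Num.min 1 (e / 8).
have e'0 : 0 < e' by rewrite lt_min ltr01 divr_gt0.
have h1 := cvg_in_probability_fine cX e'0 (divr_gt0 e0 (mulr_gt0 (ltr0n R 4) K0)).
have h2 : \forall n \near \oo, C n <= c + e / 8.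
  by apply: cvgr_le Cc _ _; rewrite ltrDl divr_gt0.
have [N [NX NC NP]] : exists N, [/\ \int[P]_x X_ N x ^+ 2 <= C N, C N <= c + e / 8 &
    fine (P [set w | e' < `|X_ N w - X w|]) <= e / (4%:R * (K%:R ^+ 2 + 1))].
  have [N _ /(_ N (leqnn N))[]] := filterI XC (filterI h2 h1).
  by move=> ? [? ?]; exists N.
set A := [set w | _] in NP.
have mA : measurable A by apply: measurable_dist_gt => //; exact: L2_meas (LX N).
have IA := intg_indic mA.
have IX := L2_sqr (LX N).
apply: (@le_trans _ _ (\int[P]_x (2 * X_ N x ^+ 2 + 2 * e' ^+ 2 + K%:R ^+ 2 * \1_A x))).
  apply: le_Rint; first exact: L2_sqr.
    apply: intgD; last exact: intgZ.
    by apply: intgD; [exact: intgZ|exact: intg_cst].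
  move=> x; rewrite indicE; case: (boolP (_ \in A)) => [_|]; rewrite ?mulr1 ?mulr0 ?addr0.
    rewrite ler_wpDl//; first by rewrite addr_ge0// mulr_ge0// sqr_ge0.
    by rewrite -[X in X <= _]real_normK ?num_real// lerXn2r ?nnegrE.
  rewrite notin_setE /= => /negP; rewrite -leNgt => h.
  apply: (@le_trans _ _ (X x ^+ 2)).
    by rewrite /truncated exprMn ler_piMr ?sqr_ge0// indic_sqr_le1.
  have : (X_ N x - X x) ^+ 2 <= e' ^+ 2.
    by rewrite -[X in X <= _]real_normK ?num_real// lerXn2r ?nnegrE// ltW.
  have := sqr_ge0 (X x - 2 * X_ N x).
  move: (X x) (X_ N x) (e' ^+ 2) => a b c'; rewrite -subr_ge0 => h3 h4; nra.
rewrite RintD; [|by apply: intgD; [exact: intgZ|exact: intg_cst]|exact: intgZ].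
rewrite RintD; [|exact: intgZ|exact: intg_cst].
rewrite Rint_cst !RintZ// Rint_indic//.
have h3 : K%:R ^+ 2 * fine (P A) <= e / 4.
  apply: (@le_trans _ _ ((K%:R ^+ 2 + 1) * (e / (4 * (K%:R ^+ 2 + 1))))).
    by rewrite ler_pM ?sqr_ge0 ?fine_ge0// lerDl.
  rewrite le_eqVlt; apply/orP; left; apply/eqP; field.
  by rewrite gt_eqF.
have h4 : e' ^+ 2 <= e / 8.
  apply: (@le_trans _ _ (1 * e')).
    by rewrite expr2 ler_wpM2r ?(ltW e'0)// ge_min lexx.
  by rewrite mul1r ge_min lexx orbT.
by move: NX NC h3 h4; move: (e' ^+ 2) (K%:R ^+ 2 * _) => a b; lra.
Qed.

(** Let A be the event |X_ n - X| > dl. Off A the difference of the integrals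
    is at most dl E|Y|; on A, Cauchy-Schwarz bounds it by the second moments
    and by E[Y^2 1_A], which is small because P A -> 0. *)
Lemma Rint_cvg_in_probability (X_ : nat -> T -> R) (X Y : T -> R) (C : R) :
  (forall n, L2 (X_ n)) -> L2 X -> L2 Y -> cvg_in_probability P X_ X ->
  (\forall n \near \oo, \int[P]_x X_ n x ^+ 2 <= C) ->
  \int[P]_x (X_ n x * Y x) @[n --> \oo] --> \int[P]_x (X x * Y x).
Proof.
move=> LX_ LX LY cX XC; apply/cvgrPdist_le => e e0.
pose c := 2 * `|C| + 2 * \int[P]_x X x ^+ 2 + 1.
have c0 : 0 < c.
  by rewrite ltr_wpDl// addr_ge0// mulr_ge0// Rint_ge0// => x; exact: sqr_ge0.
have IY := L2_intg LY; have IY2 := L2_sqr LY.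
pose a := \int[P]_x `|Y x|.
have a0 : 0 <= a by exact: Rint_ge0.
pose dl := e / (2 * (a + 1)).
have dl0 : 0 < dl by rewrite divr_gt0// mulr_gt0// ltr_wpDl.
pose r := (e / 2) ^+ 2 / c.
have r0 : 0 < r by rewrite divr_gt0// exprn_gt0// divr_gt0.
have mY := L2_meas LY.
have mnY : mfun (fun x => `|Y x|) by exact: measurableT_comp.
have /cvgr0_norm_le /(_ (r / 2) (divr_gt0 r0 (ltr0n _ 2))) [K _ /(_ K (leqnn K)) hK] :=
  Rint_tail_cvg0 IY2 (fun x => sqr_ge0 (Y x)) mnY.
have {}hK := le_trans (ler_norm _) hK.
have K0 : 0 < K%:R ^+ 2 + 1 :> R by rewrite ltr_wpDl ?sqr_ge0.
have h1 := cvg_in_probability_fine cX dl0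
  (divr_gt0 (divr_gt0 r0 (ltr0n R 2)) K0).
apply: filterS2 XC h1 => n XC h1.
set A := [set w | _] in h1.
have mXn := L2_meas (LX_ n).
have mA : measurable A by apply: measurable_dist_gt => //; exact: L2_meas LX.
have LXX := L2B (LX_ n) LX.
rewrite distrC -RintB; [|exact: L2M|exact: L2M].
under eq_Rintegral do rewrite -mulrBl.
pose V x := Y x * \1_A x.
have LV : L2 V.
  have mI : mfun \1_A by exact: measurable_indic.
  have := L2_bounded mI (fun x => indic_le1 _ A x) LY.
  by under eq_fun do rewrite mulrC.
have sqV : \int[P]_x V x ^+ 2 <= r.
  apply: (@le_trans _ _ (\int[P]_x (K%:R ^+ 2 * \1_A x + Y x ^+ 2 * \1_[set x | K%:R < `|Y x|] x))).
    have It : intg (fun x => Y x ^+ 2 * \1_[set x | K%:R < `|Y x|] x).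
      apply: (intg_bounded (C := 1)) => //; last by move=> x; exact: indic_le1.
      by apply: measurable_indic; exact: measurable_gt.
    apply: le_Rint; first exact: L2_sqr.
      by apply: intgD => //; apply: intgZ; exact: intg_indic.
    move=> x; rewrite /V exprMn !indicE.
    have [xA|xA] := boolP (x \in A); last first.
      by rewrite expr0n mulr0 mulr0 add0r mulr_ge0 ?sqr_ge0.
    rewrite expr1n !mulr1; have [h|] := boolP (x \in [set x | K%:R < `|Y x|]).
      by rewrite mulr1 lerDr sqr_ge0.
    rewrite notin_setE /= => /negP; rewrite -leNgt => h.
    by rewrite mulr0 addr0 -[X in X <= _]real_normK ?num_real// lerXn2r ?nnegrE.
  rewrite RintD; last 2 first.
  - by apply: intgZ; exact: intg_indic.
  - apply: (intg_bounded (C := 1)) => //; last by move=> x; exact: indic_le1.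
    by apply: measurable_indic; exact: measurable_gt.
  rewrite RintZ ?Rint_indic//; last exact: intg_indic.
  rewrite [leRHS](splitr r) lerD//.
  apply: (@le_trans _ _ ((K%:R ^+ 2 + 1) * (r / 2 / (K%:R ^+ 2 + 1)))).
    by rewrite ler_pM ?sqr_ge0 ?fine_ge0// lerDl.
  by rewrite mulrCA divff ?mulr1// gt_eqF.
have sqX : \int[P]_x (X_ n x - X x) ^+ 2 <= c.
  apply: (@le_trans _ _ (\int[P]_x (2 * X_ n x ^+ 2 + 2 * X x ^+ 2))).
    have I1 := L2_sqr (LX_ n); have I2 := L2_sqr LX.
    apply: le_Rint; first exact: L2_sqr.
      by apply: intgD; exact: intgZ.
    move=> x; have := sqr_ge0 (X_ n x + X x).
    by rewrite sqrrB sqrrD; lra.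
  rewrite RintD ?RintZ; try exact: L2_sqr; try (by apply: intgZ; exact: L2_sqr).
  rewrite /c; have := ler_norm C; lra.
have split_int : \int[P]_x ((X_ n x - X x) * Y x) =
    \int[P]_x ((X_ n x - X x) * V x) + \int[P]_x ((X_ n x - X x) * (Y x * (1 - \1_A x))).
  rewrite -RintD; [|exact: L2M|].
    by apply: eq_Rintegral => x _; rewrite /V; ring.
  apply: eq_intg (intgB (L2M LXX LY) (L2M LXX LV)) => x; rewrite /V; ring.
rewrite split_int [e in _ <= e]splitr; apply: (le_trans (ler_normD _ _)); apply: lerD.
  rewrite -(ler_pXn2r (ltn0Sn 1)) ?nnegrE ?divr_ge0 ?(ltW e0)//.
  rewrite real_normK ?num_real// (le_trans (L2_cauchy_schwarz LXX LV))//.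
  apply: (@le_trans _ _ (c * r)).
    by rewrite ler_pM// Rint_ge0// => x; exact: sqr_ge0.
  by rewrite /r mulrCA divff ?mulr1// gt_eqF.
have I3 : intg (fun x => (X_ n x - X x) * (Y x * (1 - \1_A x))).
  by apply: eq_intg (intgB (L2M LXX LY) (L2M LXX LV)) => x; rewrite /V; ring.
apply: (le_trans (le_normr_Rintegral measurableT I3)).
apply: (@le_trans _ _ (\int[P]_x (dl * `|Y x|))).
  apply: le_Rint; [exact: intg_norm|by apply: intgZ; exact: intg_norm|].
  move=> x; rewrite !normrM indicE; have [xA|] := boolP (x \in A).
    by rewrite subrr normr0 !mulr0 mulr_ge0// ltW.
  rewrite notin_setE /= => /negP; rewrite -leNgt => h.
  by rewrite subr0 normr1 mulr1 ler_wpM2r.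
rewrite RintZ; last exact: intg_norm.
rewrite -/a /dl (_ : _ * a = e / 2 * (a / (a + 1))); last first.
  by field; rewrite gt_eqF// ltr_wpDl.
rewrite ler_piMr ?divr_ge0 ?(ltW e0)// ler_pdivrMr ?ltr_wpDl// mul1r; lra.
Qed.

End convergence_in_probability.

(** * Limits of discrete Wick exponentials *)

Section log_expansion.
Context (R : realType).

(* k c x compares 1 + x with exp(x - x^2 / 2 + c x^3). The derivative of k c
   has the sign of 1 - 3 c - 3 c x: k 0 increases, and k 1 decreases on [-1/2,
   1/2]; both are 1 at 0. *)
Let k (c x : R) := (1 + x) * expR (- x + 2^-1 * x ^+ 2 - c * x ^+ 3).

Let is_derive_k (c x : R) : is_derive x (1 : R) (k c)
  (x ^+ 2 * (1 - 3 * c - 3 * c * x) * expR (- x + 2^-1 * x ^+ 2 - c * x ^+ 3)).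
Proof.
rewrite /k; apply: is_derive_eq; rewrite /GRing.scale /=.
by set e := expR _; field.
Qed.

Let k_cont c : continuous (k c).
Proof.
move=> x; apply: differentiable_continuous; apply/derivable1_diffP.
by have [] := is_derive_k c x.
Qed.

Lemma expR_taylor2 (x : R) : `|x| <= 2^-1 ->
  expR (x - 2^-1 * x ^+ 2 - `|x| ^+ 3) <= 1 + x <= expR (x - 2^-1 * x ^+ 2 + `|x| ^+ 3).
Proof.
move=> xh; have /andP[x1 x2] : - 2^-1 <= x <= 2^-1 by rewrite -ler_norml.
have k00 c : k c 0 = 1
  by rewrite /k (_ : - 0 + 2^-1 * 0 ^+ 2 - c * 0 ^+ 3 = 0) ?expR0; ring.
have mvt c y z : y <= z -> exists2 w, w \in `[y, z]%R & k c z - k c y =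
    w ^+ 2 * (1 - 3 * c - 3 * c * w) * expR (- w + 2^-1 * w ^+ 2 - c * w ^+ 3) * (z - y).
  move=> yz; apply: (MVT_segment (f := k c)) => //.
  by apply: continuous_subspaceT; exact: k_cont.
have kE c y : (1 <= k c y) = (expR (y - 2^-1 * y ^+ 2 + c * y ^+ 3) <= 1 + y) /\
    (k c y <= 1) = (1 + y <= expR (y - 2^-1 * y ^+ 2 + c * y ^+ 3)).
  rewrite /k; have -> : - y + 2^-1 * y ^+ 2 - c * y ^+ 3 = - (y - 2^-1 * y ^+ 2 + c * y ^+ 3) by ring.
  by rewrite expRN ler_pdivlMr ?expR_gt0// ler_pdivrMr ?expR_gt0// mul1r.
have [x0|x0] := leP 0 x.
  rewrite ger0_norm//; apply/andP; split.
    have [w wI] := mvt 0 _ _ x0; rewrite k00 => e.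
    have : 1 <= k 0 x.
      rewrite -subr_ge0 e; apply: mulr_ge0; last by rewrite subr0.
      rewrite mulr0 mul0r !subr0 mulr1; apply: mulr_ge0; first exact: sqr_ge0.
      exact: expR_ge0.
    rewrite (kE 0 x).1 mul0r addr0; apply: le_trans; rewrite ler_expR.
    by rewrite gerBl exprn_ge0.
  have [w /[!in_itv]/= /andP[w0 wx]] := mvt 1 _ _ x0; rewrite k00 => e.
  have : k 1 x <= 1.
    rewrite -subr_le0 e; apply: mulr_le0_ge0; last by rewrite subr0.
    apply: mulr_le0_ge0; last exact: expR_ge0.
    by apply: mulr_ge0_le0; [exact: sqr_ge0|lra].
  by rewrite (kE 1 x).2 mul1r.
have xx : `|x| ^+ 3 = - x ^+ 3 by rewrite ltr0_norm// exprNn -signr_odd /= expr1 mulN1r.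
rewrite xx opprK; apply/andP; split.
  have [w /[!in_itv]/= /andP[xw w0]] := mvt 1 _ _ (ltW x0); rewrite k00 => e.
  have : 1 <= k 1 x.
    rewrite -subr_le0 e; apply: mulr_le0_ge0; last by rewrite sub0r oppr_ge0 ltW.
    apply: mulr_le0_ge0; last exact: expR_ge0.
    by apply: mulr_ge0_le0; [exact: sqr_ge0|lra].
  by rewrite (kE 1 x).1 mul1r.
have [w wI] := mvt 0 _ _ (ltW x0); rewrite k00 => e.
have : k 0 x <= 1.
  rewrite -subr_ge0 e; apply: mulr_ge0; last by rewrite sub0r oppr_ge0 ltW.
  rewrite mulr0 mul0r !subr0 mulr1; apply: mulr_ge0; first exact: sqr_ge0.
  exact: expR_ge0.
rewrite (kE 0 x).2 mul0r addr0 => /le_trans; apply; rewrite ler_expR.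
by rewrite -xx lerDl exprn_ge0.
Qed.

End log_expansion.

Section wick_convergence.
Context d (T : measurableType d) (R : realType) (P : probability T R).

Local Notation mfun f := (measurable_fun [set: T] (f : T -> R)).
Local Notation intg f := (P.-integrable [set: T] (EFin \o (f : T -> R))).
Local Notation L2 f := ((f : T -> R) \in Lfun P 2%:E).

Definition noise_integral (X : nat -> T -> R) (a : nat -> R) N x :=
  \sum_(1 <= i < N.+1) a i * X i x.

Definition noise_square (X : nat -> T -> R) (a : nat -> R) N x :=
  \sum_(1 <= i < N.+1) (a i * X i x) ^+ 2.

Lemma wick_prod_exp (X : nat -> T -> R) a N x tau : tau <= 2^-1 ->
  (forall i, (0 < i <= N)%N -> `|a i * X i x| <= tau) ->
  expR (noise_integral X a N x - 2^-1 * noise_square X a N x - tau * noise_square X a N x)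
    <= wick_prod X a N x <=
  expR (noise_integral X a N x - 2^-1 * noise_square X a N x + tau * noise_square X a N x).
Proof.
move=> th aX; rewrite /noise_integral /noise_square !mulr_sumr -!sumrB -big_split/=.
rewrite !expR_sum /wick_prod; apply/andP; split.
  rewrite big_nat [leRHS]big_nat; apply: ler_prod => i iN; rewrite expR_ge0/=.
  have h := aX i iN; have /andP[h1 _] := expR_taylor2 (le_trans h th).
  apply: le_trans h1; rewrite ler_expR lerD2l lerN2 exprSr real_normK ?num_real//.
  by rewrite mulrC ler_wpM2r// sqr_ge0.
rewrite big_nat [leRHS]big_nat; apply: ler_prod => i iN.
have h := aX i iN; have /andP[h0 h1] := expR_taylor2 (le_trans h th).
rewrite (le_trans (expR_ge0 _) h0)/=.
apply: (le_trans h1); rewrite ler_expR lerD2l exprSr real_normK ?num_real//.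
by rewrite mulrC ler_wpM2r// sqr_ge0.
Qed.

(** Weak law of large numbers by truncation at the level tau. The discarded
    part of the sum of squares has expectation at most s * t, so Markov's
    inequality bounds the probability that some |a i * X i| exceeds tau; the
    truncated part has variance at most tau^2 * s, and Chebyshev's inequality
    applies. *)
Lemma noise_square_event (X : nat -> T -> R) a N (tau eta t : R) : white_noise P X ->
  0 < tau -> 0 < eta ->
  (forall i, (0 < i <= N)%N -> \int[P]_x ((a i * X i x) ^+ 2 *
     \1_[set y : R | tau < `|a i * y|] (X i x)) <= a i ^+ 2 * t) ->
  let s := \sum_(1 <= i < N.+1) a i ^+ 2 in
  exists B : set T, [/\ measurable B,
    fine (P B) <= s * t / tau ^+ 2 + tau ^+ 2 * s / eta ^+ 2 &
    forall x, ~ B x -> (forall i, (0 < i <= N)%N -> `|a i * X i x| <= tau) /\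
      `|noise_square X a N x - s| <= eta + s * t].
Proof.
move=> noise tau0 eta0 at_ s; have [_ LX X0 X1] := noise.
pose big i := [set y : R | tau < `|a i * y|].
have mbig i : measurable (big i).
  apply: (@measurable_gt _ _ _ tau (fun y => `|a i * y|)).
  by apply: measurableT_comp => //; apply: measurable_funM.
have mfX i : (0 < i)%N -> mfun (X i) by move=> i0; exact: L2_meas (LX i i0).
pose u i (y : R) := (a i * y) ^+ 2 * \1_(big i) y.
pose v i (y : R) := (a i * y) ^+ 2 * \1_(~` big i) y.
have msq i : measurable_fun [set: R] (fun y => (a i * y) ^+ 2).
  by apply: measurable_funX; apply: measurable_funM.
have mu i : measurable_fun setT (u i).
  by apply: measurable_funM => //; exact: measurable_indic.
have mv i : measurable_fun setT (v i).
  by apply: measurable_funM => //; apply: measurable_indic; exact: measurableC.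
have uv i y : (a i * y) ^+ 2 = u i y + v i y.
  rewrite /u /v -mulrDr (_ : _ + _ = 1) ?mulr1// !indicE in_setC.
  by case: (y \in big i); rewrite ?addr0 ?add0r.
have u0 i y : 0 <= u i y by rewrite mulr_ge0 ?sqr_ge0// indicE.
have v0 i y : 0 <= v i y by rewrite mulr_ge0 ?sqr_ge0// indicE.
have vtau i y : v i y <= tau ^+ 2.
  rewrite /v indicE; case: (boolP (_ \in _)) => h; last by rewrite mulr0 sqr_ge0.
  move: h; rewrite inE /= => /negP; rewrite -leNgt mulr1 => h.
  by rewrite -[leLHS]real_normK ?num_real// lerXn2r ?nnegrE// ltW.
have Isq i : (0 < i)%N -> intg (fun x => (a i * X i x) ^+ 2).
  by move=> i0; apply/L2_sqr/L2Z/LX.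
have Iu i : (0 < i)%N -> intg (fun x => u i (X i x)).
  move=> i0; apply: integrable_le (Isq i i0); first exact: (mfun_comp (mfX i i0)).
  by move=> x; rewrite ger0_norm// (uv i (X i x)) lerDl.
have Iv i : (0 < i)%N -> intg (fun x => v i (X i x)).
  move=> i0; apply: integrable_le (Isq i i0); first exact: (mfun_comp (mfX i i0)).
  by move=> x; rewrite ger0_norm// (uv i (X i x)) lerDr.
have Esq i : (0 < i)%N -> \int[P]_x (a i * X i x) ^+ 2 = a i ^+ 2.
  move=> i0; under eq_Rintegral do rewrite exprMn.
  by rewrite RintZ ?X1 ?mulr1//; apply/L2_sqr/LX.
pose m i := \int[P]_x v i (X i x).
have Em i : (0 < i)%N -> m i = a i ^+ 2 - \int[P]_x u i (X i x).
  move=> i0; rewrite -Esq// -RintB//; [|exact: Isq|exact: Iu].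
  by apply: eq_Rintegral => x _; rewrite uv addrC addKr.
pose f i (y : R) := if (0 < i)%N then v i y - m i else 0.
have mf i : measurable_fun setT (f i).
  rewrite /f; case: (0 < i)%N; last exact: measurable_cst.
  by apply: measurable_funB.
have Lv i : (0 < i)%N -> L2 (fun x => v i (X i x)).
  move=> i0; apply: L2_le (Lfun_cst P (tau ^+ 2) 2); first exact: (mfun_comp (mfX i i0)).
  by move=> x; rewrite /= !ger0_norm ?sqr_ge0.
have Lf i : (0 < i)%N -> L2 (fun x => f i (X i x)).
  by move=> i0; rewrite /f i0; apply: L2B; [exact: Lv|exact: Lfun_cst].
have f0 i : (0 < i)%N -> \int[P]_x f i (X i x) = 0.
  move=> i0; rewrite /f i0 RintB; [|exact: Iv|exact: intg_cst].
  by rewrite Rint_cst subrr.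
have f2 i : (0 < i)%N -> \int[P]_x f i (X i x) ^+ 2 <= tau ^+ 2 * a i ^+ 2.
  move=> i0; rewrite /f i0.
  apply: (@le_trans _ _ (\int[P]_x v i (X i x) ^+ 2)).
    have e x : (v i (X i x) - m i) ^+ 2 = v i (X i x) ^+ 2 - 2 * m i * v i (X i x) + m i ^+ 2.
      by ring.
    under eq_Rintegral do rewrite e.
    have I1 := L2_sqr (Lv i i0); have I2 := Iv i i0.
    rewrite RintD; [|by apply: intgB => //; exact: intgZ|exact: intg_cst].
    rewrite RintB//; last exact: intgZ.
    rewrite RintZ// Rint_cst -/(m i); have := sqr_ge0 (m i); lra.
  rewrite -Esq// -RintZ; last exact: Isq.
  apply: le_Rint; [exact/L2_sqr/Lv|by apply: intgZ; exact: Isq|].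
  by move=> x; rewrite [leLHS]expr2 ler_pM// (uv i (X i x)) lerDr.
have [LS ES] := noise_sum noise N mf Lf f0.
set S := fun x => \sum_(1 <= i < N.+1) f i (X i x) in LS ES.
pose U x := \sum_(1 <= i < N.+1) (if (0 < i)%N then u i (X i x) else 0).
have IU : intg U.
  apply: intg_sum => i; have [i0|_] := boolP (0 < i)%N; last exact: intg_cst.
  exact: Iu.
have U0 x : 0 <= U x by apply: sumr_ge0 => i _; case: (0 < i)%N.
have EU : \int[P]_x U x <= s * t.
  rewrite Rint_sum; last first.
    by move=> i; have [i0|_] := boolP (0 < i)%N; [exact: Iu|exact: intg_cst].
  rewrite mulr_suml big_nat [leRHS]big_nat; apply: ler_sum => i iN.
  by have /andP[i0 _] := iN; rewrite i0; exact: at_.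
have ES2 : \int[P]_x S x ^+ 2 <= tau ^+ 2 * s.
  rewrite ES mulr_sumr big_nat [leRHS]big_nat; apply: ler_sum => i /andP[i0 _].
  exact: f2.
exists ([set x | tau ^+ 2 < U x] `|` [set x | eta ^+ 2 < S x ^+ 2]).
have mB1 : measurable [set x | tau ^+ 2 < U x].
  by apply: measurable_gt; exact: integrable_meas IU.
have mB2 : measurable [set x | eta ^+ 2 < S x ^+ 2].
  by apply: (@measurable_gt _ _ _ (eta ^+ 2) (fun x => S x ^+ 2)); exact: integrable_meas (L2_sqr LS).
split.
- exact: measurableU.
- apply: (@le_trans _ _ (fine (P [set x | tau ^+ 2 < U x]) + fine (P [set x | eta ^+ 2 < S x ^+ 2]))).
    exact: prob_union_le.
  apply: lerD.
    rewrite ler_pdivlMr ?exprn_gt0// mulrC.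
    exact: le_trans (markov_Rint (tau ^+ 2) IU U0) EU.
  rewrite ler_pdivlMr ?exprn_gt0// mulrC.
  exact: le_trans (markov_Rint (eta ^+ 2) (L2_sqr LS) (fun x => sqr_ge0 _)) ES2.
- move=> x /not_orP[/= /negP + /negP]; rewrite -!leNgt => Ux Sx.
  have small i : (0 < i <= N)%N -> `|a i * X i x| <= tau.
    move=> iN; have /andP[i0 _] := iN; rewrite leNgt; apply/negP => h.
    move: Ux; apply/negP; rewrite -ltNge.
    apply: (@lt_le_trans _ _ (u i (X i x))).
      rewrite /u indicE mem_set// mulr1 -[ltRHS]real_normK ?num_real//.
      by rewrite ltrXn2r ?nnegrE// ltW.
    rewrite /U (bigD1_seq i) ?iota_uniq ?mem_index_iota//= i0 lerDl.
    by apply: sumr_ge0 => j _; case: (0 < j)%N.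
  split => //.
  have vE i : (0 < i <= N)%N -> (a i * X i x) ^+ 2 = v i (X i x).
    move=> /small h; rewrite /v indicE mem_set ?mulr1//= .
    by apply/negP; rewrite -leNgt.
  have -> : noise_square X a N x - s = S x - \sum_(1 <= i < N.+1) (a i ^+ 2 - m i).
    rewrite /noise_square /s /S -!sumrB; apply: eq_big_nat => i iN.
    have /andP[i0 _] := iN; rewrite vE// /f i0; ring.
  apply: (le_trans (ler_normB _ _)); apply: lerD.
    rewrite -(ler_pXn2r (ltn0Sn 1)) ?nnegrE// ?(ltW eta0)//.
    by rewrite real_normK ?num_real.
  have am i : (0 < i <= N)%N -> 0 <= a i ^+ 2 - m i <= a i ^+ 2 * t.
    move=> iN; have /andP[i0 _] := iN; rewrite Em// opprB addrC subrK.
    by rewrite Rint_ge0//=; exact: at_.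
  rewrite ger0_norm; last by rewrite big_nat; apply: sumr_ge0 => i /am /andP[].
  by rewrite /s mulr_suml big_nat [leRHS]big_nat; apply: ler_sum => i /am /andP[].
Qed.

Lemma expR_small_perturbation (r rho : R) : `|r| <= rho -> rho <= 2^-1 ->
  `|expR r - 1| <= 2 * rho.
Proof.
rewrite ler_norml => /andP[r1 r2] rh.
have h1 : 1 + r <= expR r by exact: expR_ge1Dx.
have h2 : 1 - r <= expR (- r) by exact: expR_ge1Dx.
have rho0 : 0 <= rho by lra.
rewrite ler_norml; apply/andP; split; first lra.
have e : expR r * expR (- r) = 1 by rewrite -expRD subrr expR0.
have := expR_gt0 r; have : expR r * (1 - r) <= 1.
  by rewrite -[leRHS]e ler_wpM2l// expR_ge0.
move: (expR r) => E; nra.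
Qed.

(** The error analysis of the logarithm: if it is within rho = eta (s + 6) of
    J - s / 2, then D is within 2 rho, relatively, of exp(J - s / 2). *)
Lemma expR_error (D In Q J s tau eta e : R) :
  expR (In - 2^-1 * Q - tau * Q) <= D <= expR (In - 2^-1 * Q + tau * Q) ->
  0 <= Q -> 0 <= s -> 0 <= tau -> tau <= eta -> eta <= 1 ->
  `|Q - s| <= 3 * eta -> `|In - J| <= eta -> eta * (s + 6) <= 2^-1 ->
  expR (J - 2^-1 * s) * (2 * (eta * (s + 6))) <= e ->
  `|D - expR (J - 2^-1 * s)| <= e.
Proof.
move=> /andP[D1 D2] Q0 s0 tau0 taue eta1 Qs InJ; set rho := eta * (s + 6) => rho2.
set W := expR (J - 2^-1 * s) => We.
move: Qs InJ; rewrite !ler_norml => /andP[q1 q2] /andP[j1 j2].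
have W0 : 0 <= W by exact: expR_ge0.
have DW r : expR r = W * expR (r - (J - 2^-1 * s)) by rewrite /W -expRD addrC subrK.
have tQ0 : 0 <= tau * Q by exact: mulr_ge0.
have eta0 : 0 <= eta by exact: le_trans taue.
have tQ : tau * Q <= eta * (s + 3).
  apply: (@le_trans _ _ (eta * Q)); first by rewrite ler_wpM2r.
  by rewrite ler_wpM2l//; lra.
have rE : rho = eta * (s + 3) + 3 * eta by rewrite /rho; ring.
have pert r : `|r| <= rho -> W - e <= W * expR r <= W + e.
  move=> /expR_small_perturbation /(_ rho2); rewrite ler_norml => /andP[p1 p2].
  have := ler_wpM2l W0 p1; have := ler_wpM2l W0 p2; rewrite mulrBr mulr1 mulrN.
  by move=> ? ?; apply/andP; split; lra.
have es : 0 <= eta * (s + 3) by rewrite mulr_ge0// addr_ge0.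
rewrite DW in D1; rewrite DW in D2.
have /pert/andP[k1 _] : `|In - 2^-1 * Q - tau * Q - (J - 2^-1 * s)| <= rho.
  by rewrite ler_norml; apply/andP; split; rewrite rE; lra.
have /pert/andP[_ k2] : `|In - 2^-1 * Q + tau * Q - (J - 2^-1 * s)| <= rho.
  by rewrite ler_norml; apply/andP; split; rewrite rE; lra.
apply/andP; split; first by rewrite lerBrDl (le_trans k1).
by rewrite lerBlDl (le_trans D2).
Qed.

Lemma prob_tail (W : T -> R) : mfun W -> forall g : R, 0 < g ->
  exists K : nat, fine (P [set x | K%:R < W x]) <= g.
Proof.
move=> mW g g0.
have /cvgr0_norm_le /(_ _ g0)[K _ /(_ K (leqnn K))] :=
  Rint_tail_cvg0 (intg_cst P 1) (fun=> ler01) mW.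
move=> h; exists K; apply: le_trans h; apply: le_trans (ler_norm _).
under eq_Rintegral do rewrite mul1r.
by rewrite Rint_indic//; exact: measurable_gt.
Qed.

(** With x i = a i * X i, the product is exp(sum x i - (sum x i^2) / 2) up to
    a factor exp(tau * sum x i^2) when all |x i| <= tau. The first sum
    converges to I, and the second to s by the weak law of large numbers. The
    assumption on the tails is Lindeberg's condition. *)
Lemma wick_prod_cvg_in_probability (X : nat -> nat -> T -> R) (a : nat -> nat -> R)
    (N : nat -> nat) (I : T -> R) (s : R) :
  (forall n, white_noise P (X n)) ->
  (forall tau e : R, 0 < tau -> 0 < e -> \forall n \near \oo,
     forall i, (0 < i <= N n)%N -> \int[P]_x ((a n i * X n i x) ^+ 2 *
     \1_[set y : R | tau < `|a n i * y|] (X n i x)) <= a n i ^+ 2 * e) ->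
  \sum_(1 <= i < (N n).+1) a n i ^+ 2 @[n --> \oo] --> s ->
  mfun I -> cvg_in_probability P (fun n => noise_integral (X n) (a n) (N n)) I ->
  cvg_in_probability P (fun n => wick_prod (X n) (a n) (N n))
    (fun x => expR (I x - 2^-1 * s)).
Proof.
move=> noise tail cs mI cI e e0.
set W := fun x => expR (I x - 2^-1 * s).
have mW : mfun W.
  by apply: measurableT_comp => //; apply: measurable_funB => //; exact: measurable_cst.
have mD n : mfun (wick_prod (X n) (a n) (N n)).
  by have [L _ _] := wick_prod_moments (noise n) (a n) (N n); exact: L2_meas L.
have mA n : measurable [set w | e < `|wick_prod (X n) (a n) (N n) w - W w|].
  by apply: measurable_dist_gt.
have mNI n : mfun (noise_integral (X n) (a n) (N n)).
  have [_ LX _ _] := noise n.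
  rewrite (_ : noise_integral _ _ _ = (fun x => \sum_(1 <= i < (N n).+1)
     if (0 < i)%N then a n i * X n i x else 0)); last first.
    by apply/funext => x; apply: eq_big_nat => i /andP[->].
  apply: measurable_sum => i; have [i0|_] := boolP (0 < i)%N; last exact: measurable_cst.
  by apply: measurable_funM => //; exact: L2_meas (LX i i0).
have s0 : 0 <= s.
  by apply: (cvgr_to_ge cs); apply: nearW => n; apply: sumr_ge0 => i _; exact: sqr_ge0.
apply: cvg_EFin; first by apply: nearW => n; rewrite fin_num_measure.
apply/cvgr0Pnorm_le => g g0.
have g4 : 0 < g / 4 by rewrite divr_gt0.
have [K PK] := prob_tail mW g4.
have K0 : 0 <= K%:R :> R by [].
pose rho := Num.min 2^-1 (e / (2 * (K%:R + 1))).
have dK : 0 < 2 * (K%:R + 1) :> R by lra.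
have rho0 : 0 < rho by rewrite lt_min invr_gt0 ltr0n divr_gt0.
pose eta := rho / (s + 6).
have eta0 : 0 < eta by rewrite divr_gt0//; lra.
have rhoE : rho = eta * (s + 6) by rewrite /eta divfK// gt_eqF//; lra.
have rho2 : rho <= 2^-1 by rewrite ge_min lexx.
have eta1 : eta <= 1.
  by have := mulr_ge0 (ltW eta0) s0; move: rho2; rewrite rhoE; lra.
pose kap := Num.min 2^-1 (g / (4 * (s + 1))).
have ds : 0 < 4 * (s + 1) by lra.
have kap0 : 0 < kap by rewrite lt_min invr_gt0 ltr0n divr_gt0.
have kap2 : kap <= 2^-1 by rewrite ge_min lexx.
have kapg : kap * (s + 1) <= g / 4.
  rewrite -ler_pdivlMr; last lra.
  apply: (@le_trans _ _ (g / (4 * (s + 1)))); first by rewrite ge_min lexx orbT.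
  by rewrite le_eqVlt; apply/orP; left; apply/eqP; field; rewrite gt_eqF//; lra.
(* tau is small relative to eta because the variance bound is tau^2 * s /
   eta^2 *)
pose tau := eta * kap.
have tau0 : 0 < tau by rewrite mulr_gt0.
have tau2 : tau <= 2^-1.
  by rewrite /tau -[leRHS]mul1r; apply: ler_pM => //; exact: ltW.
have taue : tau <= eta by rewrite /tau ler_piMr ?(ltW eta0)//; lra.
pose ep := Num.min eta (tau ^+ 2 * (g / 4)) / (s + 1).
have ep0 : 0 < ep.
  rewrite divr_gt0//; last lra.
  by rewrite lt_min eta0 mulr_gt0 ?exprn_gt0.
have epe : (s + 1) * ep <= eta.
  by rewrite /ep mulrC divfK ?ge_min ?lexx// gt_eqF//; lra.
have epg : (s + 1) * ep <= tau ^+ 2 * (g / 4).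
  by rewrite /ep mulrC divfK ?ge_min ?lexx ?orbT// gt_eqF//; lra.
have h1 := tail _ _ tau0 ep0.
have h2 := cvg_in_probability_fine cI eta0 g4.
have /cvgrPdist_le/(_ _ eta0) h3 := cs.
apply: filterS3 h1 h2 h3 => n h1 h2 h3.
rewrite ger0_norm ?fine_ge0//.
have [B [mB PB BP]] := noise_square_event (noise n) tau0 eta0 h1.
set sn := \sum_(1 <= i < (N n).+1) a n i ^+ 2 in h3 PB BP.
have sn0 : 0 <= sn by apply: sumr_ge0 => i _; exact: sqr_ge0.
have [sn1 sn2] : s - eta <= sn /\ sn <= s + eta.
  by move: h3; rewrite ler_norml => /andP[]; lra.
set AI := [set w | _] in h2.
have mAI : measurable AI by apply: measurable_dist_gt.
have mAK : measurable [set x | K%:R < W x] by exact: measurable_gt.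
have sub : [set w | e < `|wick_prod (X n) (a n) (N n) w - W w|] `<=` (B `|` AI) `|` [set x | K%:R < W x].
  move=> x /= eD; apply: contrapT => /not_orP[/not_orP[nB /negP]].
  rewrite -leNgt => nI /negP; rewrite -leNgt => nW.
  move: eD; apply/negP; rewrite -leNgt.
  have [small sq] := BP x nB.
  have /andP[D1 D2] := wick_prod_exp tau2 small.
  set D := wick_prod _ _ _ _ in D1 D2 *.
  set In := noise_integral _ _ _ _ in nI D1 D2.
  set Q := noise_square _ _ _ _ in sq D1 D2.
  have Q0 : 0 <= Q by apply: sumr_ge0 => i _; exact: sqr_ge0.
  apply: (@expR_error _ In Q (I x) s tau eta) => //; [by apply/andP|exact: ltW| | |].
  - rewrite ler_norml; have sne : sn * ep <= eta.
      by apply: le_trans epe; rewrite ler_wpM2r ?(ltW ep0)//; lra.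
    by move: sq; rewrite ler_norml => /andP[? ?]; apply/andP; split; lra.
  - by rewrite -rhoE.
  - rewrite -rhoE; apply: (@le_trans _ _ ((K%:R + 1) * (2 * (e / (2 * (K%:R + 1)))))).
      apply: ler_pM; [exact: expR_ge0|by rewrite mulr_ge0// ltW| |].
        by rewrite (le_trans nW)// lerDl.
      by rewrite ler_wpM2l// ge_min lexx orbT.
    rewrite le_eqVlt; apply/orP; left; apply/eqP; field.
    by rewrite gt_eqF// ltr_wpDl.
have PA : fine (P [set w | e < `|wick_prod (X n) (a n) (N n) w - W w|]) <=
    fine (P B) + fine (P AI) + fine (P [set x | K%:R < W x]).
  have mBA : measurable (B `|` AI) by exact: measurableU.
  apply: (@le_trans _ _ (fine (P ((B `|` AI) `|` [set x | K%:R < W x])))).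
    by apply: prob_le => //; exact: measurableU.
  apply: (le_trans (prob_union_le P mBA mAK)).
  by rewrite lerD2r prob_union_le.
apply: (le_trans PA).
have b1 : sn * ep / tau ^+ 2 <= g / 4.
  rewrite ler_pdivrMr ?exprn_gt0// [leRHS]mulrC; apply: le_trans epg.
  by rewrite ler_wpM2r ?(ltW ep0)//; lra.
have b2 : tau ^+ 2 * sn / eta ^+ 2 <= g / 4.
  have -> : tau ^+ 2 * sn / eta ^+ 2 = kap ^+ 2 * sn.
    by rewrite /tau; field; rewrite gt_eqF.
  apply: le_trans kapg; apply: ler_pM => //; [exact: sqr_ge0| |lra].
  by rewrite expr2 ler_piMr ?(ltW kap0)//; lra.
lra.
Qed.

End wick_convergence.

(** * Noises with a common law *)

Section equal_laws.
Context d (T : measurableType d) (R : realType) (P : probability T R).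

Local Notation mfun f := (measurable_fun [set: T] (f : T -> R)).
Local Notation intg f := (P.-integrable [set: T] (EFin \o (f : T -> R))).
Local Notation L2 f := ((f : T -> R) \in Lfun P 2%:E).

Lemma ge0_integral_eq_law (X Y : {RV P >-> R}) (f : R -> R) :
  identically_distributed X Y -> measurable_fun setT f -> (forall y, 0 <= f y) ->
  (\int[P]_x (f (X x))%:E = \int[P]_x (f (Y x))%:E)%E.
Proof.
move=> XY mf f0.
have mEf : measurable_fun setT (EFin \o f) by exact/measurable_EFinP.
have Ef0 y : (0 <= (EFin \o f) y)%E by rewrite lee_fin.
have hX := ge0_integral_distribution X mEf Ef0.
have hY := ge0_integral_distribution Y mEf Ef0.
transitivity (\int[distribution P X]_y (EFin \o f) y)%E; first by rewrite hX.
rewrite (eq_measure_integral (distribution P Y)); first by rewrite hY.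
by move=> A mA _; exact: XY.
Qed.

Lemma ge0_Rint_eq_law (X Y : {RV P >-> R}) (f : R -> R) :
  identically_distributed X Y -> measurable_fun setT f -> (forall y, 0 <= f y) ->
  \int[P]_x f (X x) = \int[P]_x f (Y x).
Proof. by move=> XY mf f0; rewrite /Rintegral (ge0_integral_eq_law XY). Qed.

Lemma L2_eq_law (X Y : {RV P >-> R}) :
  identically_distributed X Y -> L2 Y -> L2 X.
Proof.
move=> XY /L2P[_ IY]; apply/L2P; split; first exact: measurable_funPT.
apply: ge0_intg => [|x|]; [|exact: sqr_ge0|].
  by apply: measurable_funX; exact: measurable_funPT.
rewrite (ge0_integral_eq_law XY (f := fun y => y ^+ 2)) => [||y]; [| |exact: sqr_ge0].
  by rewrite -EFin_Rint// ltry.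
by apply: measurable_funX; exact: measurable_id.
Qed.

Lemma Rint_eq_law (X Y : {RV P >-> R}) :
  identically_distributed X Y -> L2 Y -> \int[P]_x X x = \int[P]_x Y x.
Proof.
move=> XY LY; have LX := L2_eq_law XY LY.
have h (Z : {RV P >-> R}) : L2 Z -> \int[P]_x Z x = \int[P]_x (`|Z x| + Z x) - \int[P]_x `|Z x|.
  move=> LZ; have IZ := L2_intg LZ; have InZ := intg_norm IZ.
  by rewrite RintD// addrC addKr.
rewrite (h X)// (h Y)//; congr (_ - _).
  apply: (ge0_Rint_eq_law (f := fun y => `|y| + y) XY) => [|y].
    by apply: measurable_funD => //; exact: normr_measurable.
  by rewrite -lerBlDr sub0r -normrN ler_norm.
by apply: (ge0_Rint_eq_law (f := fun y => `|y|) XY) => //; exact: normr_measurable.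
Qed.

Lemma white_noise_of_law (xi : {RV P >-> R}) (X : nat -> {RV P >-> R}) :
  L2 xi -> ('E_P[xi])%E = 0%E -> ('V_P[xi])%E = 1%E ->
  mutual_indep P [set i | (0 < i)%N] (fun i => X i) ->
  (forall i, (0 < i)%N -> identically_distributed (X i) xi) ->
  white_noise P (fun i => X i : T -> R).
Proof.
move=> Lxi Exi Vxi indX lawX.
have m1 : \int[P]_x xi x = 0 by move: Exi; rewrite unlock /Rintegral => ->.
have m2 : \int[P]_x xi x ^+ 2 = 1.
  move: Vxi; rewrite varianceE// Exi expe2 mul0e sube0 unlock => h.
  by rewrite /Rintegral h.
split => // i i0.
- exact: L2_eq_law (lawX i i0) Lxi.
- by rewrite (Rint_eq_law (lawX i i0)).
- rewrite -m2; apply: (ge0_Rint_eq_law (f := fun y => y ^+ 2) (lawX i i0)) => [|y].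
    by apply: measurable_funX; exact: measurable_id.
  exact: sqr_ge0.
Qed.

(** As a n i ^ 2 <= K / (n + 1), the event |a n i * X n i| > tau forces (X n
    i)^2 > n tau^2 / K, and the tail of the second moment of the common law
    tends to 0. *)
Lemma lindeberg_of_law (xi : {RV P >-> R}) (X : nat -> nat -> {RV P >-> R})
    (a : nat -> nat -> R) (K : R) : L2 xi ->
  (forall n i, (0 < i)%N -> identically_distributed (X n i) xi) ->
  (forall n i, a n i ^+ 2 * n.+1%:R <= K) ->
  forall tau e : R, 0 < tau -> 0 < e -> \forall n \near \oo, forall i, (0 < i)%N ->
    \int[P]_x ((a n i * X n i x) ^+ 2 * \1_[set y : R | tau < `|a n i * y|] (X n i x))
      <= a n i ^+ 2 * e.
Proof.
move=> Lxi lawX aK tau e tau0 e0.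
have mxi : mfun xi by exact: measurable_funPT.
have mg : mfun (fun x => K / tau ^+ 2 * xi x ^+ 2).
  by apply: measurable_funM => //; apply: measurable_funX.
have /cvgr0_norm_le /(_ _ e0) := Rint_tail_cvg0 (L2_sqr Lxi) (fun x => sqr_ge0 _) mg.
apply: filterS => n h i i0.
pose A := [set y : R | tau < `|a n i * y|].
have mA : measurable A.
  apply: (@measurable_gt _ _ _ tau (fun y => `|a n i * y|)).
  by apply: measurableT_comp => //; apply: measurable_funM.
have mf : measurable_fun setT (fun y => (a n i * y) ^+ 2 * \1_A y).
  apply: measurable_funM; last exact: measurable_indic.
  by apply: measurable_funX; apply: measurable_funM.
rewrite (ge0_Rint_eq_law (f := fun y => (a n i * y) ^+ 2 * \1_A y) (lawX n i i0)) => [|//|y]; last first.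
  by rewrite mulr_ge0 ?sqr_ge0// indicE.
have mB : measurable [set x | n%:R < K / tau ^+ 2 * xi x ^+ 2] by exact: measurable_gt.
have I1 : intg (fun x => xi x ^+ 2 * \1_[set x | n%:R < K / tau ^+ 2 * xi x ^+ 2] x).
  apply: integrable_le (L2_sqr Lxi) => [|x].
    by apply: measurable_funM; [apply: measurable_funX|exact: measurable_indic].
  by rewrite normrM (ger0_norm (sqr_ge0 _)) ler_piMr ?sqr_ge0 ?indic_le1.
apply: (@le_trans _ _ (a n i ^+ 2 * \int[P]_x (xi x ^+ 2 * \1_[set x | n%:R < K / tau ^+ 2 * xi x ^+ 2] x))).
  rewrite -RintZ//; apply: le_Rint; [|exact: intgZ|].
    apply: integrable_le (intgZ (a n i ^+ 2) (L2_sqr Lxi)) => [|x]; first exact: (measurableT_comp mf).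
    by rewrite -exprMn normrM (ger0_norm (sqr_ge0 _)) ler_piMr ?sqr_ge0 ?indic_le1.
  move=> x; rewrite exprMn -mulrA ler_wpM2l ?sqr_ge0// ler_wpM2l ?sqr_ge0//.
  rewrite [leLHS]indicE; case: (boolP (_ \in _)) => [|_]; last by rewrite indicE.
  rewrite inE /A /= => h1; rewrite indicE mem_set//=.
  have h2 : tau ^+ 2 < a n i ^+ 2 * xi x ^+ 2.
    rewrite -exprMn -[ltRHS]real_normK ?num_real//.
    by rewrite ltrXn2r ?nnegrE// ltW.
  apply: (@lt_le_trans _ _ n.+1%:R); first by rewrite ltr_nat.
  rewrite mulrAC ler_pdivlMr ?exprn_gt0//.
  apply: (@le_trans _ _ (n.+1%:R * (a n i ^+ 2 * xi x ^+ 2))).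
    by rewrite ler_wpM2l// ltW.
  by rewrite mulrA ler_wpM2r ?sqr_ge0// mulrC.
by rewrite ler_wpM2l ?sqr_ge0// (le_trans (ler_norm _) h).
Qed.

End equal_laws.

Section convergence_in_probability.
Context d (T : measurableType d) (R : realType) (P : probability T R).

Local Notation mfun f := (measurable_fun [set: T] (f : T -> R)).

Lemma cvg_in_probability_cst (X : T -> R) : cvg_in_probability P (fun=> X) X.
Proof.
move=> e e0; rewrite (_ : [set w | _] = set0) ?measure0; first exact: cvg_cst.
by apply/seteqP; split => x //=; rewrite subrr normr0 ltNge ltW.
Qed.

Lemma cvg_in_probabilityZ (X_ : nat -> T -> R) (X : T -> R) (c : R) :
  cvg_in_probability P X_ X -> cvg_in_probability P (fun n x => c * X_ n x) (fun x => c * X x).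
Proof.
move=> cX; have [->|c0] := eqVneq c 0.
  rewrite (_ : (fun n x => 0 * X_ n x) = fun=> (fun x => 0 * X x)).
    exact: cvg_in_probability_cst.
  by apply/funext => n; apply/funext => x; rewrite !mul0r.
move=> e e0; have c1 : 0 < `|c| by rewrite normr_gt0.
have := cX (e / `|c|) (divr_gt0 e0 c1); apply: cvg_trans; apply: near_eq_cvg.
apply: nearW => n; congr (P _); apply/seteqP; split => x /=;
by rewrite -mulrBr normrM ltr_pdivrMr// mulrC.
Qed.

Lemma cvg_in_probabilityD (X_ Y_ : nat -> T -> R) (X Y : T -> R) :
  (forall n, mfun (X_ n)) -> (forall n, mfun (Y_ n)) -> mfun X -> mfun Y ->
  cvg_in_probability P X_ X -> cvg_in_probability P Y_ Y ->
  cvg_in_probability P (fun n x => X_ n x + Y_ n x) (fun x => X x + Y x).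
Proof.
move=> mX_ mY_ mX mY cX cY e e0; have e2 : 0 < e / 2 by rewrite divr_gt0.
pose A n := [set w | e / 2 < `|X_ n w - X w|].
pose B n := [set w | e / 2 < `|Y_ n w - Y w|].
apply: (@squeeze_cvge _ _ _ _ (fun=> 0%E) _ (fun n => (P (A n) + P (B n))%E)).
- apply: nearW => n; rewrite measure_ge0/=.
  apply: (@le_trans _ _ (P (A n `|` B n))).
    apply: le_measure; rewrite ?inE.
    + apply: (@measurable_dist_gt _ _ _ _ (fun w => X_ n w + Y_ n w) (fun w => X w + Y w));
      exact: measurable_funD.
    + by apply: measurableU; exact: measurable_dist_gt.
    + move=> x /= h; apply: contrapT => /not_orP[/negP + /negP]; rewrite -!leNgt => h1 h2.
      move: h; apply/negP; rewrite -leNgt opprD addrACA (splitr e).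
      by apply: (le_trans (ler_normD _ _)); exact: lerD.
  by apply: measureU2; exact: measurable_dist_gt.
- exact: cvg_cst.
- by rewrite -[0%E]adde0; apply: cvgeD => //; [exact: cX|exact: cY].
Qed.

Lemma cvg_in_probability_sum (I : Type) (r : seq I) (X_ : nat -> I -> T -> R) (X : I -> T -> R) :
  (forall n i, mfun (X_ n i)) -> (forall i, mfun (X i)) ->
  (forall i, cvg_in_probability P (X_ ^~ i) (X i)) ->
  cvg_in_probability P (fun n x => \sum_(i <- r) X_ n i x) (fun x => \sum_(i <- r) X i x).
Proof.
move=> mX_ mX cX; elim: r => [|i r IH].
  rewrite (_ : (fun n x => _) = fun=> (fun x => \sum_(i <- [::]) X i x)).
    exact: cvg_in_probability_cst.
  by apply/funext => n; apply/funext => x; rewrite !big_nil.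
rewrite (_ : (fun n x => _) = fun n x => X_ n i x + \sum_(i <- r) X_ n i x); last first.
  by apply/funext => n; apply/funext => x; rewrite big_cons.
rewrite (_ : (fun x => _) = fun x => X i x + \sum_(i <- r) X i x); last first.
  by apply/funext => x; rewrite big_cons.
by apply: cvg_in_probabilityD => // [n|]; exact: measurable_sum.
Qed.

End convergence_in_probability.

(** * Step functions and scaled random walks *)

Section step_functions.
Context (R : realType).
Implicit Types s : seq (R * R * R).

Lemma step_fun_cat s1 s2 t : step_fun (s1 ++ s2) t = step_fun s1 t + step_fun s2 t.
Proof. by rewrite /step_fun big_cat. Qed.

Definition scale_steps (c : R) s := [seq (c * p.1.1, p.1.2, p.2) | p <- s].

Lemma step_fun_scale c s t : step_fun (scale_steps c s) t = c * step_fun s t.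
Proof.
rewrite /step_fun big_map mulr_sumr; apply: eq_bigr => p _.
by rewrite mulrA.
Qed.

Definition horizon s : nat := \max_(p <- s) (Num.truncn p.2).+1.

Lemma le_horizon s p : p \in s -> p.2 <= (horizon s)%:R.
Proof.
move=> ps; apply: (@le_trans _ _ (Num.truncn p.2).+1%:R); first exact: ltW (truncnS_gt _).
by rewrite ler_nat /horizon (big_rem p ps)/= leq_max leqnn.
Qed.

Lemma step_fun_out s t : (horizon s)%:R < t -> step_fun s t = 0.
Proof.
move=> st; rewrite /step_fun big_seq big1// => p /le_horizon ps.
rewrite indicE memNset ?mulr0//= in_itv/= => /andP[_].
by apply/negP; rewrite -ltNge (le_lt_trans ps).
Qed.

Definition step_bound s : R := \sum_(p <- s) `|p.1.1|.

Lemma step_bound_ge0 s : 0 <= step_bound s.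
Proof. exact: sumr_ge0. Qed.

Lemma step_fun_le s t : `|step_fun s t| <= step_bound s.
Proof.
apply: (le_trans (ler_norm_sum _ _ _)); apply: ler_sum => p _.
by rewrite normrM ler_piMr// indic_le1.
Qed.

Lemma measurable_step_fun s : measurable_fun [set: R] (step_fun s).
Proof.
by apply: measurable_sum => p; apply: measurable_funM.
Qed.

Lemma sum_before_time (m L : nat) (phi : nat -> R) (c : R) : (0 < m)%N -> c <= L%:R ->
  \sum_(1 <= i < (L * m).+1) (i%:R / m%:R <= c)%R%:R * phi i =
  \sum_(1 <= i < `|Num.floor (m%:R * Num.max 0 c)%R|%N.+1) phi i.
Proof.
move=> m0 cL; set k := `|_|%N.
have m0' : 0 < m%:R :> R by rewrite ltr0n.
have mc0 : 0 <= m%:R * Num.max 0 c by rewrite mulr_ge0// le_max lexx.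
have kE : k%:Z = Num.floor (m%:R * Num.max 0 c).
  by rewrite /k gez0_abs// floor_ge0.
have kL : (k <= L * m)%N.
  rewrite -(ler_nat R) natrM mulrC.
  apply: (@le_trans _ _ (m%:R * Num.max 0 c)).
    by rewrite (_ : k%:R = (k%:Z)%:~R)// kE floor_le.
  by rewrite ler_wpM2l// ge_max ler0n.
rewrite (big_nat_widen _ _ _ _ _ (kL : (k.+1 <= (L * m).+1)%N)) [RHS]big_mkcond/=.
apply: eq_big_nat => i /andP[i0 _]; rewrite ltnS.
have -> : (i%:R / m%:R <= c) = (i <= k)%N.
  rewrite -lez_nat kE floor_ge_int.
  transitivity (i%:R / m%:R <= Num.max 0 c); last by rewrite ler_pdivrMr// mulrC.
  by rewrite le_max [X in _ = X || _]leNgt divr_gt0 ?ltr0n.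
by case: (i <= k)%N; rewrite ?mul1r ?mul0r.
Qed.

(** The weight of X i, where X i / sqrt m stands for the increment of the
    Brownian motion over the i-th cell, at whose right end point the step
    function is sampled. *)
Definition grid s (m i : nat) : R := step_fun s (i%:R / m%:R) / Num.sqrt m%:R.

(** The indicator of ]b, c] is the difference of those of ]-oo, c] and ]-oo,
    b]; summation up to a time c produces the random walk at c. *)
Lemma noise_integral_grid d (T : measurableType d) s (m : nat) (X : nat -> T -> R) x : (0 < m)%N ->
  noise_integral X (grid s m) (horizon s * m) x =
  \sum_(p <- s) p.1.1 * (if p.1.2 <= p.2 then
     random_walk m X (Num.max 0 p.2) x - random_walk m X (Num.max 0 p.1.2) x else 0).
Proof.
move=> m0; rewrite /noise_integral /grid /step_fun.
transitivity (\sum_(1 <= i < (horizon s * m).+1) \sum_(p <- s)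
   p.1.1 * (\1_(`]p.1.2, p.2]%classic) (i%:R / m%:R : R) * (X i x / Num.sqrt m%:R))).
  apply: eq_bigr => i _; rewrite mulr_suml mulr_suml; apply: eq_bigr => p _; ring.
rewrite exchange_big/= !big_seq; apply: eq_bigr => p ps; rewrite -mulr_sumr; congr (_ * _).
have iE (u : R) : \1_(`]p.1.2, p.2]%classic) u =
    (if p.1.2 <= p.2 then (u <= p.2)%R%:R - (u <= p.1.2)%R%:R else 0) :> R.
  rewrite indicE mem_setE in_itv/=; have [bc|bc] := leP p.1.2 p.2.
    rewrite ltNge; have [ub|ub] := leP u p.1.2; last by rewrite subr0.
    by rewrite (le_trans ub bc) subrr.
  by rewrite ltNge; case: (leP u p.1.2) => //= ub; rewrite leNgt (lt_trans bc ub).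
under eq_bigr do rewrite iE.
have [bc|bc] := leP p.1.2 p.2; last by rewrite big1// => i _; rewrite mul0r.
under eq_bigr do rewrite mulrBl; rewrite sumrB.
rewrite !sum_before_time//; [|exact: le_trans bc (le_horizon ps)|exact: le_horizon].
by rewrite /random_walk -!mulr_suml ![_ / Num.sqrt _]mulrC.
Qed.

End step_functions.

(** * Sampling step functions in time *)

Section time_sampling.
Context (R : realType).
Implicit Types s : seq (R * R * R).

Notation leb := (@lebesgue_measure R).
Local Notation intgL f := (leb.-integrable [set: R] (EFin \o (f : R -> R))).
Local Notation L2L f := ((f : R -> R) \in Lfun leb 2%:E).

Definition cell (n i : nat) : set R :=
  `](i.-1)%:R / n%:R, i%:R / n%:R]%classic.

Lemma measurable_cell n i : measurable (cell n i).
Proof. exact: measurable_itv. Qed.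

Lemma cell_pos n i t : cell n i t -> 0 < t.
Proof.
rewrite /cell/= in_itv/= => /andP[+ _]; apply: le_lt_trans.
by rewrite divr_ge0.
Qed.

Lemma cell_ceil n i t : (0 < n)%N -> (0 < i)%N -> 0 < t ->
  cell n i t <-> `|Num.ceil (n%:R * t)%R|%N = i.
Proof.
move=> n0 i0 t0; have n0' : 0 < n%:R :> R by rewrite ltr0n.
have c0 : 0 <= Num.ceil (n%:R * t).
  by rewrite ceil_ge0 (lt_trans (ltrN10 _))// mulr_gt0.
have -> : (cell n i t) = (Num.ceil (n%:R * t) == i%:Z) :> Prop.
  rewrite /cell/= in_itv/= ltr_pdivrMr// ler_pdivlMr// ceil_eq mulrC.
  by rewrite -pmulrn; case: i i0 => //= i _; rewrite -addn1 PoszD addrK.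
split => [/eqP ->//|e].
by rewrite -e gez0_abs.
Qed.

Lemma lebesgue_cell n i : (0 < n)%N -> (0 < i)%N -> leb (cell n i) = (n%:R^-1)%:E.
Proof.
move=> n0 i0; rewrite /cell lebesgue_measure_itv/= lte_fin.
rewrite ltr_pM2r ?invr_gt0 ?ltr0n// ltr_nat prednK// leqnn -EFinB -mulrBl.
by congr (_%:E); case: i i0 => // i _; rewrite -natr1 addrC addKr mul1r.
Qed.

Lemma Rint_cell n i : (0 < n)%N -> (0 < i)%N -> \int[leb]_t \1_(cell n i) t = n%:R^-1 :> R.
Proof.
move=> n0 i0; rewrite /Rintegral integral_indic//; last exact: measurable_cell.
by rewrite setIT; exact: (congr1 fine (lebesgue_cell n0 i0)).
Qed.

Lemma intg_finite_indic (A : set R) : measurable A -> (leb A < +oo)%E -> intgL \1_A.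
Proof.
move=> mA Aoo; apply: ge0_intg => [|x|].
- exact: measurable_indic.
- by rewrite indicE.
- by rewrite integral_indic// setIT.
Qed.

Lemma intg_cell n i : (0 < n)%N -> (0 < i)%N -> intgL \1_(cell n i).
Proof.
move=> n0 i0; apply: intg_finite_indic; first exact: measurable_cell.
by rewrite lebesgue_cell// ltry.
Qed.

Lemma sum_cell (phi : nat -> R) n N t : (0 < n)%N ->
  \sum_(1 <= i < N.+1) phi i * \1_(cell n i) t =
  if (0 < t) && (`|Num.ceil (n%:R * t)%R| <= N)%N then phi `|Num.ceil (n%:R * t)%R|%N else 0.
Proof.
move=> n0; have [t0|t0] := ltP 0 t; last first.
  rewrite big1// => i _; rewrite indicE memNset ?mulr0// => /cell_pos.
  by rewrite ltNge t0.
set k := `|_|%N; have k0 : (0 < k)%N.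
  rewrite /k absz_gt0 gt_eqF// ceil_gt0 mulr_gt0// ltr0n//.
have iE i : (0 < i)%N -> \1_(cell n i) t = (i == k)%:R :> R.
  move=> i0; rewrite indicE; suff -> : (t \in cell n i) = (i == k) by [].
  apply/idP/idP.
    by rewrite inE => /(cell_ceil n0 i0 t0) <-.
  by move=> /eqP e; apply/mem_set/(cell_ceil n0 i0 t0); rewrite e.
have h i : (0 < i < N.+1)%N -> phi i * \1_(cell n i) t = if i == k then phi k else 0.
  by move=> /andP[i0 _]; rewrite iE//; case: eqP => [->|]; rewrite ?mulr1 ?mulr0.
rewrite (eq_big_nat _ _ h) -big_mkcond/=; case: leqP => kN.
  by rewrite (big_nat1_eq _ (fun=> phi k)) k0 ltnS kN.
by rewrite (big_nat1_eq _ (fun=> phi k)) k0 ltnS leqNgt kN.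
Qed.

(** The function t |-> step_fun s (ceil (n t) / n) on the positive half-line,
    as sampledE shows; written as a finite sum over the cells, its integrals
    are immediate. *)
Definition sampled s n t := \sum_(1 <= i < (horizon s * n).+1)
  step_fun s (i%:R / n%:R) * \1_(cell n i) t.

Lemma sampledE s n t : (0 < n)%N -> sampled s n t =
  if 0 < t then step_fun s ((`|Num.ceil (n%:R * t)%R|%N)%:R / n%:R) else 0.
Proof.
move=> n0; rewrite /sampled sum_cell//; case: (ltP 0 t) => //= t0.
case: leqP => // h; rewrite step_fun_out// ltr_pdivlMr ?ltr0n//.
by rewrite -natrM ltr_nat.
Qed.

Lemma ceil_approx n (t : R) : (0 < n)%N -> 0 < t ->
  t <= (`|Num.ceil (n%:R * t)%R|%N)%:R / n%:R < t + n%:R^-1.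
Proof.
move=> n0 t0; have n0' : 0 < n%:R :> R by rewrite ltr0n.
have c0 : 0 <= Num.ceil (n%:R * t).
  by rewrite ceil_ge0 (lt_trans (ltrN10 _))// mulr_gt0.
rewrite (_ : _%:R = (Num.ceil (n%:R * t))%:~R); last by rewrite -[in RHS](gez0_abs c0).
have := ceil_itv (n%:R * t); rewrite intrB => /andP[h1 h2].
rewrite ler_pdivlMr// mulrC h2/= ltr_pdivrMr// mulrDl mulVf ?gt_eqF//.
by rewrite -ltrBlDr [t * _]mulrC.
Qed.

Lemma measurable_sampled s n : measurable_fun [set: R] (sampled s n).
Proof.
apply: measurable_sum => i; apply: measurable_funM => //.
by apply: measurable_indic; exact: measurable_cell.
Qed.

Lemma half_line_stepE s t : half_line (step_fun s) t = if 0 <= t then step_fun s t else 0.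
Proof. by rewrite /half_line patchE mem_setE in_itv/= andbT. Qed.

Lemma measurable_half_line_step s : measurable_fun [set: R] (half_line (step_fun s)).
Proof.
apply/(measurable_restrictT _ _).1 => //.
by apply: measurable_funTS; exact: measurable_step_fun.
Qed.

Definition step_majorant s (t : R) : R := step_bound s * \1_(`[0, (horizon s)%:R]%classic) t.

Lemma step_majorant_ge0 s t : 0 <= step_majorant s t.
Proof. by rewrite mulr_ge0 ?step_bound_ge0// indicE. Qed.

Lemma half_line_step_le s t : `|half_line (step_fun s) t| <= step_majorant s t.
Proof.
rewrite half_line_stepE; have [t0|t0] := leP 0 t; last first.
  by rewrite normr0 step_majorant_ge0.
have [tL|tL] := leP t (horizon s)%:R.
  by rewrite /step_majorant indicE mem_set ?mulr1 ?step_fun_le//= in_itv/= t0.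
by rewrite step_fun_out// normr0 step_majorant_ge0.
Qed.

Lemma sampled_le s n t : (0 < n)%N -> `|sampled s n t| <= step_majorant s t.
Proof.
move=> n0; rewrite sampledE//; have [t0|t0] := ltP 0 t; last first.
  by rewrite normr0 step_majorant_ge0.
have [tL|tL] := leP t (horizon s)%:R.
  by rewrite /step_majorant indicE mem_set ?mulr1 ?step_fun_le//= in_itv/= (ltW t0).
rewrite step_fun_out ?normr0 ?step_majorant_ge0//.
by have /andP[h _] := ceil_approx n0 t0; exact: lt_le_trans h.
Qed.

Lemma intg_step_majorant_sqr s : intgL (fun t => step_majorant s t ^+ 2).
Proof.
pose A := `[(0:R), (horizon s)%:R]%classic.
have : intgL (fun t => step_bound s ^+ 2 * \1_A t).
  apply/intgZ/intg_finite_indic; first exact: measurable_itv.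
  rewrite lebesgue_measure_itv/=; case: ifP => _; last exact: ltry.
  by rewrite -EFinB ltry.
apply: eq_intg => t; rewrite /step_majorant exprMn; congr (_ * _).
by rewrite indicE; case: (_ \in _); rewrite ?expr1n ?expr0n.
Qed.

Lemma measurable_step_majorant s : measurable_fun [set: R] (step_majorant s).
Proof.
apply: measurable_funM => //; apply: measurable_indic; exact: measurable_itv.
Qed.

Lemma L2_step_majorant s : L2L (step_majorant s).
Proof.
apply/L2P; split; [exact: measurable_step_majorant|exact: intg_step_majorant_sqr].
Qed.

Lemma L2_half_line_step s : L2L (half_line (step_fun s)).
Proof.
apply: L2_le (L2_step_majorant s); first exact: measurable_half_line_step.
by move=> t; rewrite (ger0_norm (step_majorant_ge0 _ _)) half_line_step_le.
Qed.

Lemma L2_sampled s n : (0 < n)%N -> L2L (sampled s n).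
Proof.
move=> n0; apply: L2_le (L2_step_majorant s); first exact: measurable_sampled.
by move=> t; rewrite (ger0_norm (step_majorant_ge0 _ _)) sampled_le.
Qed.

Lemma near_side (b t : R) (u : nat -> R) : t != b -> (forall n, t <= u n) ->
  u n @[n --> \oo] --> t -> \forall n \near \oo, (b < u n) = (b < t).
Proof.
move=> tb tu ut; case: (ltgtP b t) tb => // bt _.
  by apply: nearW => n; rewrite (lt_le_trans bt).
near=> n; apply/negbTE; rewrite -leNgt ltW//; near: n.
exact: cvgr_lt ut _ bt.
Unshelve. all: by end_near.
Qed.

Lemma step_fun_cvg s t (u : nat -> R) : (forall p, p \in s -> t != p.1.2 /\ t != p.2) ->
  (forall n, t <= u n) -> u n @[n --> \oo] --> t ->
  step_fun s (u n) @[n --> \oo] --> step_fun s t.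
Proof.
move=> ts tu ut; rewrite /step_fun; elim: s ts => [|p s IH] ts.
  by under eq_fun do rewrite big_nil; rewrite big_nil; exact: cvg_cst.
under eq_fun do rewrite big_cons; rewrite big_cons; apply: cvgD; last first.
  by apply: IH => q qs; apply: ts; rewrite inE qs orbT.
have [tb tc] := ts p (mem_head _ _).
apply: cvg_near_cst; have h1 := near_side tb tu ut; have h2 := near_side tc tu ut.
apply: filterS2 h1 h2 => n h1 h2.
by rewrite !indicE !mem_setE !in_itv/= h1 leNgt h2 -leNgt.
Qed.

(** The times ceil (n t) / n approach t from the right. Convergence can only
    fail at the jumps, which are finite in number, and at 0, where sampled
    vanishes. *)
Lemma sampled_cvg_ae s :
  {ae leb, forall t, sampled s n.+1 t @[n --> \oo] --> half_line (step_fun s) t}.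
Proof.
pose F := [set` 0 :: [seq p.1.2 | p <- s] ++ [seq p.2 | p <- s]] : set R.
have cF : countable F by apply: finite_set_countable; exact: finite_seq.
exists F; split => //.
- by apply: countable_measurable.
- exact: countable_lebesgue_measure0.
- move=> t; apply: contra_notP; rewrite /F/= => tF.
  rewrite half_line_stepE; have [t0|t0] := ltP t 0.
    rewrite (_ : (fun n => _) = cst 0); first exact: cvg_cst.
    by apply/funext => n; rewrite sampledE// ltNge (ltW t0).
  have t0' : 0 < t.
    by rewrite lt_neqAle t0 andbT; apply/eqP => e; apply: tF; rewrite inE -e eqxx.
  rewrite (_ : (fun n => _) = fun n => step_fun s ((`|Num.ceil (n.+1%:R * t)%R|%N)%:R / n.+1%:R)); last first.
    by apply/funext => n; rewrite sampledE// t0'.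
  apply: step_fun_cvg.
  + move=> p ps; split; apply/eqP => e; apply: tF; rewrite inE mem_cat; apply/orP; right; apply/orP.
      by left; apply/mapP; exists p.
    by right; apply/mapP; exists p.
  + by move=> n; have /andP[] := ceil_approx (ltn0Sn n) t0'.
  + apply: (@squeeze_cvgr _ _ _ _ (fun=> t) (fun n => t + n.+1%:R^-1)).
    * by apply: nearW => n; have /andP[-> /ltW ->] := ceil_approx (ltn0Sn n) t0'.
    * exact: cvg_cst.
    * by rewrite -[X in _ --> X]addr0; apply: cvgD; [exact: cvg_cst|exact: cvg_harmonic].
Qed.

Lemma sampled_cvg_L2 s :
  \int[leb]_t (sampled s n.+1 t - half_line (step_fun s) t) ^+ 2 @[n --> \oo] --> (0 : R).
Proof.
have := @Rint_dominated_cvg_ae _ _ _ leb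
  (fun n t => (sampled s n.+1 t - half_line (step_fun s) t) ^+ 2) (fun=> 0)
  (fun t => 4 * step_majorant s t ^+ 2).
rewrite /Rintegral integral0 fine0; apply => //.
- move=> n; apply: measurable_funX; apply: measurable_funB; first exact: measurable_sampled.
  exact: measurable_half_line_step.
- by apply: intgZ; exact: intg_step_majorant_sqr.
- move=> n t; rewrite ger0_norm ?sqr_ge0//.
  have -> : 4 * step_majorant s t ^+ 2 = (2 * step_majorant s t) ^+ 2 by ring.
  rewrite -[leLHS]real_normK ?num_real//.
  rewrite ler_pXn2r ?nnegrE ?mulr_ge0 ?step_majorant_ge0//.
  rewrite mulr_natl mulr2n; apply: (le_trans (ler_normB _ _)).
  by apply: lerD; [exact: sampled_le|exact: half_line_step_le].
- exact: step_bound_ge0.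
- apply: ae_imply (sampled_cvg_ae s) => t h.
  have -> : (0 : R) = (half_line (step_fun s) t - half_line (step_fun s) t) ^+ 2.
    by rewrite subrr expr0n.
  rewrite !expr2; apply: cvgM; apply: cvgB => //; exact: cvg_cst.
Qed.

(** The Riemann sum of the squares is the exact integral of the squared
    sampled function. *)
Lemma sum_grid_sqr s n : (0 < n)%N ->
  \sum_(1 <= i < (horizon s * n).+1) grid s n i ^+ 2 = \int[leb]_t sampled s n t ^+ 2.
Proof.
move=> n0; have n0' : 0 < n%:R :> R by rewrite ltr0n.
have e t : sampled s n t ^+ 2 = \sum_(1 <= i < (horizon s * n).+1)
   (if (0 < i)%N then step_fun s (i%:R / n%:R) ^+ 2 * \1_(cell n i) t else 0).
  rewrite /sampled sum_cell// [RHS](_ : _ = \sum_(1 <= i < (horizon s * n).+1)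
   step_fun s (i%:R / n%:R) ^+ 2 * \1_(cell n i) t).
    by rewrite (sum_cell (fun i => step_fun s (i%:R / n%:R) ^+ 2))//; case: ifP => // _; rewrite expr0n.
  by apply: eq_big_nat => i /andP[->].
under eq_Rintegral do rewrite e.
rewrite Rint_sum; last first.
  move=> i; have [i0|_] := boolP (0 < i)%N; first exact/intgZ/intg_cell.
  by have := @intgZ _ _ _ leb 0 _ (intg_cell n0 (ltn0Sn 0)); apply: eq_intg => x; rewrite mul0r.
apply: eq_big_nat => i /andP[i0 _]; rewrite i0 RintZ; last exact: intg_cell.
by rewrite Rint_cell// /grid expr_div_n sqr_sqrtr ?ler0n.
Qed.

Definition sq_norm s := \int[leb]_(t in `[0, +oo[) step_fun s t ^+ 2.

Lemma sq_normE s : sq_norm s = \int[leb]_t half_line (step_fun s) t ^+ 2.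
Proof.
rewrite /sq_norm Rintegral_mkcond; apply: eq_Rintegral => t _.
rewrite /half_line !patchE; case: ifP => // _.
by rewrite expr0n.
Qed.

Lemma sq_norm_ge0 s : 0 <= sq_norm s.
Proof. by rewrite sq_normE; apply: Rint_ge0 => t; exact: sqr_ge0. Qed.

Lemma sum_grid_sqr_cvg s :
  \sum_(1 <= i < (horizon s * n.+1).+1) grid s n.+1 i ^+ 2 @[n --> \oo] --> sq_norm s.
Proof.
under eq_fun do rewrite sum_grid_sqr//.
rewrite sq_normE.
apply: (@Rint_dominated_cvg_ae _ _ _ leb (fun n t => sampled s n.+1 t ^+ 2) _
  (fun t => step_majorant s t ^+ 2)).
- by move=> n; apply: measurable_funX; exact: measurable_sampled.
- by apply: measurable_funX; exact: measurable_half_line_step.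
- exact: intg_step_majorant_sqr.
- move=> n t; rewrite ger0_norm ?sqr_ge0// -[leLHS]real_normK ?num_real//.
  by rewrite ler_pXn2r ?nnegrE ?step_majorant_ge0// sampled_le.
- apply: ae_imply (sampled_cvg_ae s) => t h.
  by rewrite !expr2; exact: cvgM.
Qed.

Lemma sq_norm_scale c s : sq_norm (scale_steps c s) = c ^+ 2 * sq_norm s.
Proof.
rewrite !sq_normE -RintZ; last exact: L2_sqr (L2_half_line_step s).
apply: eq_Rintegral => t _; rewrite !half_line_stepE step_fun_scale.
by case: (0 <= t); rewrite ?exprMn// expr0n mulr0.
Qed.

Lemma grid_bound s n i : (0 < n)%N -> grid s n i ^+ 2 * n%:R <= step_bound s ^+ 2.
Proof.
move=> n0; rewrite /grid expr_div_n sqr_sqrtr ?ler0n// divfK ?pnatr_eq0 -?lt0n//.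
rewrite -[leLHS]real_normK ?num_real//.
by rewrite ler_pXn2r ?nnegrE ?step_bound_ge0// step_fun_le.
Qed.

Lemma grid_out s n i : (0 < n)%N -> (horizon s * n < i)%N -> grid s n i = 0.
Proof.
move=> n0 h; rewrite /grid step_fun_out ?mul0r// ltr_pdivlMr ?ltr0n//.
by rewrite -natrM ltr_nat.
Qed.

End time_sampling.

(** * Wick exponentials of Wiener integrals *)

Section brownian_limit.
Context d (T : measurableType d) (R : realType) (P : probability T R).
Variables (B : R -> {RV P >-> R}) (xi : {RV P >-> R}) (X : nat -> nat -> {RV P >-> R}).
Implicit Types s : seq (R * R * R).

Notation leb := (@lebesgue_measure R).
Local Notation mfun f := (measurable_fun [set: T] (f : T -> R)).
Local Notation intg f := (P.-integrable [set: T] (EFin \o (f : T -> R))).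
Local Notation L2 f := ((f : T -> R) \in Lfun P 2%:E).

Lemma step_integral_cat s1 s2 w :
  step_integral B (s1 ++ s2) w = step_integral B s1 w + step_integral B s2 w.
Proof. by rewrite /step_integral big_cat. Qed.

Lemma step_integral_scale c s w : step_integral B (scale_steps c s) w = c * step_integral B s w.
Proof.
rewrite /step_integral big_map mulr_sumr; apply: eq_bigr => p _.
by rewrite mulrA.
Qed.

Lemma measurable_step_integral s : mfun (step_integral B s).
Proof.
apply: measurable_sum => p; apply: measurable_funM => //.
by case: (p.1.2 <= p.2) => //; apply: measurable_funB; exact: measurable_funPT.
Qed.

(** An explicit representative of wick_exp B (step_fun s), which is defined
    through a chosen version of the Wiener integral; wick_exp_step shows that
    they agree almost surely. *)
Definition step_wick s w := expR (step_integral B s w - 2^-1 * sq_norm s).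

Lemma measurable_step_wick s : mfun (step_wick s).
Proof.
by apply: measurableT_comp => //; apply: measurable_funB => //; exact: measurable_step_integral.
Qed.

Lemma step_wick_sqr s w : step_wick s w ^+ 2 = expR (sq_norm s) * step_wick (scale_steps 2 s) w.
Proof.
rewrite /step_wick step_integral_scale sq_norm_scale -expRM_natl -expRD.
by congr expR; rewrite mulr2n; field.
Qed.

Hypothesis Lxi : L2 xi.
Hypothesis noise : forall n, white_noise P (fun i => X n i : T -> R).
Hypothesis lawX : forall n i, (0 < i)%N -> identically_distributed (X n i) xi.
Hypothesis walk_cvg : forall t : R, 0 <= t ->
  cvg_in_probability P (fun n => random_walk n.+1 (fun i => X n i) t) (B t).

Let N s n := (horizon s * n.+1)%N.
Let Y n i : T -> R := X n i.

Lemma measurable_random_walk n t : mfun (random_walk n.+1 (Y n) t).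
Proof.
apply: measurable_funM => //; apply: measurable_sum => i; exact: measurable_funPT.
Qed.

Lemma noise_integral_cvg s : cvg_in_probability P
  (fun n => noise_integral (Y n) (grid s n.+1) (N s n)) (step_integral B s).
Proof.
rewrite (_ : (fun n => _) = fun n x => \sum_(p <- s) p.1.1 * (if p.1.2 <= p.2 then
     random_walk n.+1 (Y n) (Num.max 0 p.2) x - random_walk n.+1 (Y n) (Num.max 0 p.1.2) x else 0)); last first.
  by apply/funext => n; apply/funext => x; rewrite noise_integral_grid.
have mr := measurable_random_walk.
have mB t : mfun (B t) by exact: measurable_funPT.
apply: cvg_in_probability_sum.
- move=> n p; apply: measurable_funM => //.
  by case: (p.1.2 <= p.2) => //; apply: measurable_funB.
- move=> p; apply: measurable_funM => //.
  by case: (p.1.2 <= p.2) => //; apply: measurable_funB.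
- move=> p; apply: cvg_in_probabilityZ; case: (p.1.2 <= p.2); last exact: cvg_in_probability_cst.
  have max0 c : 0 <= Num.max 0 c :> R by rewrite le_max lexx.
  apply: cvg_in_probabilityD => //.
  + by move=> n; exact: measurableT_comp.
  + exact: measurableT_comp.
  + exact: walk_cvg.
  + rewrite (_ : (fun n x => - _) = fun n x => -1 * random_walk n.+1 (Y n) (Num.max 0 p.1.2) x); last first.
      by apply/funext => n; apply/funext => x; rewrite mulN1r.
    rewrite (_ : (fun x => - _) = fun x => -1 * B (Num.max 0 p.1.2) x); last first.
      by apply/funext => x; rewrite mulN1r.
    by apply: cvg_in_probabilityZ; exact: walk_cvg.
Qed.

Definition discrete_wick s n := wick_prod (Y n) (grid s n.+1) (N s n).

Lemma discrete_wick_cvg s : cvg_in_probability P (discrete_wick s) (step_wick s).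
Proof.
apply: wick_prod_cvg_in_probability.
- exact: noise.
- move=> tau e tau0 e0.
  have := lindeberg_of_law Lxi lawX (fun n i => grid_bound s i (ltn0Sn n)) tau0 e0.
  by apply: filterS => n h i /andP[i0 _]; exact: h.
- exact: sum_grid_sqr_cvg.
- exact: measurable_step_integral.
- exact: noise_integral_cvg.
Qed.

Lemma L2_discrete_wick s n : L2 (discrete_wick s n).
Proof. by have [] := wick_prod_moments (noise n) (grid s n.+1) (N s n). Qed.

Lemma cvg_expR_sum_grid s :
  expR (\sum_(1 <= i < (N s n).+1) grid s n.+1 i ^+ 2) @[n --> \oo] --> expR (sq_norm s).
Proof. by apply: continuous_cvg; [exact: continuous_expR|exact: sum_grid_sqr_cvg]. Qed.

Lemma discrete_wick_sqr_le s n : \int[P]_x discrete_wick s n x ^+ 2 <=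
  expR (\sum_(1 <= i < (N s n).+1) grid s n.+1 i ^+ 2).
Proof. exact: (wick_prod_le (noise n)). Qed.

Lemma L2_step_wick s : L2 (step_wick s).
Proof.
have [] := @L2_cvg_in_probability _ _ _ P (discrete_wick s) (step_wick s) _ _
  (L2_discrete_wick s) (measurable_step_wick s) (@discrete_wick_cvg s)
  (nearW _ (discrete_wick_sqr_le s)) (@cvg_expR_sum_grid s) => //.
Qed.

Lemma Rint_discrete_wick_cvg s (V : T -> R) : L2 V ->
  \int[P]_x (discrete_wick s n x * V x) @[n --> \oo] --> \int[P]_x (step_wick s x * V x).
Proof.
move=> LV; apply: (@Rint_cvg_in_probability _ _ _ P _ _ _ (expR (sq_norm s) + 1)) => //.
- exact: L2_discrete_wick.
- exact: L2_step_wick.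
- exact: discrete_wick_cvg.
- have := cvgr_le _ (@cvg_expR_sum_grid s) (expR (sq_norm s) + 1).
  rewrite ltrDl => /(_ _ ltr01); apply: filterS => n; apply: le_trans.
  exact: discrete_wick_sqr_le.
Qed.

(** All discrete Wick exponentials have expectation 1, and their second
    moments are bounded. *)
Lemma Rint_step_wick s : \int[P]_x step_wick s x = 1.
Proof.
have L1 : L2 (fun=> 1) by exact: Lfun_cst.
have h := @Rint_discrete_wick_cvg s _ L1.
have e n : \int[P]_x (discrete_wick s n x * 1) = 1.
  under eq_Rintegral do rewrite mulr1.
  by have [] := wick_prod_moments (noise n) (grid s n.+1) (N s n).
have -> : \int[P]_x step_wick s x = \int[P]_x (step_wick s x * 1).
  by apply: eq_Rintegral => x _; rewrite mulr1.
move: h; rewrite (_ : (fun n => \int[P]_x (discrete_wick s n x * 1)) = fun=> 1); last exact/funext.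
by move=> h; apply: (cvg_unique _ h (cvg_cst _)); exact: norm_hausdorff.
Qed.

(** The square of a Wick exponential is a multiple of another one, so the
    second moment follows from the first; no Gaussian integral is computed. *)
Lemma Rint_step_wick_sqr s : \int[P]_x step_wick s x ^+ 2 = expR (sq_norm s).
Proof.
under eq_Rintegral do rewrite step_wick_sqr.
by rewrite RintZ ?Rint_step_wick ?mulr1//; exact/L2_intg/L2_step_wick.
Qed.

(** Weak convergence together with convergence of the norms. *)
Lemma discrete_wick_cvg_L2 s :
  \int[P]_x (discrete_wick s n x - step_wick s x) ^+ 2 @[n --> \oo] --> (0 : R).
Proof.
have LD := L2_discrete_wick s; have LW := L2_step_wick s.
have eE n : \int[P]_x (discrete_wick s n x - step_wick s x) ^+ 2 =
    \int[P]_x discrete_wick s n x ^+ 2 - 2 * \int[P]_x (discrete_wick s n x * step_wick s x) +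
    expR (sq_norm s).
  have e x : (discrete_wick s n x - step_wick s x) ^+ 2 = discrete_wick s n x ^+ 2 -
    2 * (discrete_wick s n x * step_wick s x) + step_wick s x ^+ 2 by ring.
  under eq_Rintegral do rewrite e.
  have I1 := L2M (LD n) LW; have I2 := L2_sqr (LD n).
  rewrite RintD; [|by apply: intgB => //; exact: intgZ|exact: L2_sqr].
  by rewrite RintB ?RintZ ?Rint_step_wick_sqr//; exact: intgZ.
apply: (@squeeze_cvgr _ _ _ _ (fun=> 0) (fun n =>
   expR (\sum_(1 <= i < (N s n).+1) grid s n.+1 i ^+ 2) -
   2 * \int[P]_x (discrete_wick s n x * step_wick s x) + expR (sq_norm s))).
- apply: nearW => n; apply/andP; split; first by apply: Rint_ge0 => x; exact: sqr_ge0.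
  by rewrite eE !lerD2r; exact: discrete_wick_sqr_le.
- exact: cvg_cst.
- rewrite [X in _ --> X](_ : 0 = expR (sq_norm s) - 2 * \int[P]_x (step_wick s x * step_wick s x) + expR (sq_norm s)).
    apply: cvgD; last exact: cvg_cst.
    apply: cvgB; first exact: cvg_expR_sum_grid.
    by apply: cvgMl_tmp; exact: Rint_discrete_wick_cvg.
  under eq_Rintegral do rewrite -expr2.
  rewrite Rint_step_wick_sqr; ring.
Qed.

(** A form of the Ito isometry, inherited from the orthogonality of the noise
    through Fatou's lemma, which costs the factor 2. *)
Lemma L2_step_integral_le s : L2 (step_integral B s) /\
  \int[P]_x step_integral B s x ^+ 2 <= 2 * sq_norm s.
Proof.
have h n : L2 (noise_integral (Y n) (grid s n.+1) (N s n)) /\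
    \int[P]_x noise_integral (Y n) (grid s n.+1) (N s n) x ^+ 2 =
    \sum_(1 <= i < (N s n).+1) grid s n.+1 i ^+ 2.
  have [_ LX X0 X1] := noise n.
  have [|||L e] := @noise_sum _ _ _ P _ (noise n) (fun i y => grid s n.+1 i * y) (N s n).
  - by move=> i; apply: measurable_funM.
  - by move=> i i0; apply: L2Z; exact: LX.
  - by move=> i i0; rewrite RintZ ?X0 ?mulr0//; exact/L2_intg/LX.
  split => //; rewrite e; apply: eq_big_nat => i /andP[i0 _].
  under eq_Rintegral do rewrite exprMn.
  by rewrite RintZ ?X1 ?mulr1//; exact/L2_sqr/LX.
apply: (@L2_cvg_in_probability _ _ _ P (fun n => noise_integral (Y n) (grid s n.+1) (N s n))
  _ (fun n => \sum_(1 <= i < (N s n).+1) grid s n.+1 i ^+ 2)).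
- by move=> n; exact: (h n).1.
- exact: measurable_step_integral.
- exact: noise_integral_cvg.
- by apply: nearW => n; rewrite (h n).2.
- exact: sum_grid_sqr_cvg.
Qed.

Lemma step_integral_dist s s' :
  \int[P]_x (step_integral B s x - step_integral B s' x) ^+ 2 <=
  2 * \int[leb]_t (half_line (step_fun s) t - half_line (step_fun s') t) ^+ 2.
Proof.
have := (L2_step_integral_le (s ++ scale_steps (-1) s')).2; rewrite sq_normE.
under eq_Rintegral do rewrite step_integral_cat step_integral_scale mulN1r.
under [X in _ <= _ * X -> _]eq_Rintegral => t _.
  rewrite (_ : half_line _ t = half_line (step_fun s) t - half_line (step_fun s') t); last first.
    rewrite !half_line_stepE step_fun_cat step_fun_scale mulN1r.
    by case: (0 <= t); rewrite ?subr0.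
  over.
by [].
Qed.

Lemma strong_cvg_cst d' (S : measurableType d') (mu : {measure set S -> \bar R}) (f : S -> R) :
  strong_cvg mu (fun=> f) f.
Proof.
rewrite /strong_cvg (_ : EFin \o _ = cst 0%E) ?Lnorm0//; first exact: cvg_cst.
by apply/funext => x /=; rewrite subrr.
Qed.

(** Any sequence of step functions that defines a version of the integral has,
    by step_integral_dist, integrals that tend to step_integral B s. *)
Lemma wiener_integral_step s : L2 (wiener_integral B (step_fun s)) /\
  {ae P, forall w, wiener_integral B (step_fun s) w = step_integral B s w}.
Proof.
have LI s' := (L2_step_integral_le s').1.
have ex : exists V, [set V | is_wiener_integral B (step_fun s) V] V.
  exists (step_integral B s); split; [exact: L2_half_line_step|exact: LI|].
  by exists (fun=> s); exact: strong_cvg_cst.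
have [_ LV [s_ c1 c2]] := xgetPex (fun=> 0) ex.
rewrite -/(wiener_integral B (step_fun s)) in LV c2.
set V := wiener_integral B (step_fun s) in LV c2 *; split => //.
have e1 := strong_cvg_Rint (fun k => L2_half_line_step (s_ k)) (L2_half_line_step s) c1.
have e2 := strong_cvg_Rint (fun k => LI (s_ k)) LV c2.
have LVI := L2B LV (LI s).
have : \int[P]_x (V x - step_integral B s x) ^+ 2 = 0.
  apply/eqP; rewrite eq_le Rint_ge0 ?andbT => [|x]; last exact: sqr_ge0.
  have h : 2 * \int[P]_x (step_integral B (s_ k) x - V x) ^+ 2 +
      2 * (2 * \int[leb]_t (half_line (step_fun (s_ k)) t - half_line (step_fun s) t) ^+ 2)
      @[k --> \oo] --> (0 : R).
    rewrite -[X in _ --> X](_ : 2 * 0 + 2 * (2 * 0) = 0 :> R); last by rewrite !mulr0 addr0.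
    by apply: cvgD; apply: cvgMl_tmp => //; exact: cvgMl_tmp.
  apply: (cvgr_to_ge h); apply: nearW => k.
  apply: (@le_trans _ _ (2 * \int[P]_x (step_integral B (s_ k) x - V x) ^+ 2 +
    2 * \int[P]_x (step_integral B (s_ k) x - step_integral B s x) ^+ 2)); last first.
    by rewrite lerD2l ler_wpM2l// step_integral_dist.
  have I1 := L2_sqr (L2B (LI (s_ k)) LV); have I2 := L2_sqr (L2B (LI (s_ k)) (LI s)).
  rewrite -!RintZ// -RintD; [|exact: intgZ|exact: intgZ].
  apply: le_Rint; [exact: L2_sqr|by apply: intgD; exact: intgZ|].
  move=> x; set a := step_integral B (s_ k) x.
  have -> : V x - step_integral B s x = (a - step_integral B s x) - (a - V x) by ring.
  move: (a - _) (a - _) => p q; have := sqr_ge0 (p + q); rewrite !expr2; lra.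
move=> /(Rint_eq0 (L2_sqr LVI) (fun x => sqr_ge0 _)).
by apply: ae_imply => x /eqP; rewrite sqrf_eq0 subr_eq0 => /eqP.
Qed.

Lemma wick_exp_step s : mfun (wick_exp B (step_fun s)) /\
  {ae P, forall w, wick_exp B (step_fun s) w = step_wick s w}.
Proof.
have [L ae] := wiener_integral_step s; split.
  by apply: measurableT_comp => //; apply: measurable_funB => //; exact: L2_meas L.
by apply: ae_imply ae => w e; rewrite /wick_exp e.
Qed.

Lemma S_transform_step (V : T -> R) s : mfun V ->
  S_transform B V (step_fun s) = \int[P]_x (V x * step_wick s x).
Proof.
move=> mV; have [mW ae] := wick_exp_step s.
rewrite /S_transform unlock; apply: ae_eq_Rint.
- exact: measurable_funM.
- by apply: measurable_funM => //; exact: measurable_step_wick.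
- by apply: ae_imply ae => w ->.
Qed.

End brownian_limit.

(** * Functions determined by exponential moments *)

Section exponential_inequalities.
Context (R : realType).
Implicit Types y : R.

(** This is 2 (cosh y - 1), of order y^2 near 0. *)
Definition exp_gap y : R := expR y + expR (- y) - 2.

Lemma exp_gap_sym y : exp_gap (- y) = exp_gap y.
Proof. by rewrite /exp_gap opprK [expR (- y) + _]addrC. Qed.

Lemma exp_gap_le y : exp_gap y <= 2 * expR (2 * y ^+ 2) - 2.
Proof.
rewrite lerD2r; have [y2|y2] := leP (y ^+ 2) 2^-1; last first.
  have h (z : R) : z ^+ 2 = y ^+ 2 -> expR z <= expR (2 * y ^+ 2).
    move=> zy; rewrite ler_expR -zy; move: y2; rewrite -zy => y2.
    have := sqr_ge0 (z - 2^-1); rewrite sqrrB; lra.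
  by rewrite mulr2n mulrDl mul1r lerD// h// sqrrN.
have h1 := expR_ge1Dx y; have h2 := expR_ge1Dx (- y).
have e1 : expR y * expR (- y) = 1 by rewrite -expRD subrr expR0.
have y1 : `|y| < 1.
  rewrite -(ltr_pXn2r (ltn0Sn 1)) ?nnegrE// real_normK ?num_real// expr1n.
  by apply: (le_lt_trans y2); rewrite invf_lt1// ltr1n.
move: y1; rewrite ltr_norml => /andP[y1 y1'].
have k1 : expR y <= (1 - y)^-1.
  rewrite -[leLHS]invrK -expRN lef_pV2 ?posrE ?expR_gt0//; lra.
have k2 : expR (- y) <= (1 + y)^-1.
  rewrite expRN lef_pV2 ?posrE ?expR_gt0//; lra.
have k3 : (1 - y)^-1 + (1 + y)^-1 <= 2 * (1 + 2 * y ^+ 2).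
  have -> : (1 - y)^-1 + (1 + y)^-1 = 2 / (1 - y ^+ 2).
    have n1 : 1 - y != 0 by rewrite gt_eqF//; lra.
    have n2 : 1 + y != 0 by rewrite gt_eqF//; lra.
    have n3 : 1 - y ^+ 2 != 0 by rewrite gt_eqF//; lra.
    by field; rewrite ?n1 ?n2 ?n3.
  rewrite ler_pdivrMr; last lra.
  have := sqr_ge0 y; move: y2; move: (y ^+ 2) => z z1 z0.
  have : 0 <= z * (2^-1 - z) by rewrite mulr_ge0// subr_ge0.
  by rewrite mulrBr; lra.
have := expR_ge1Dx (2 * y ^+ 2); lra.
Qed.

Lemma exp_gap_bounds y : y ^+ 2 * expR (- `|y|) <= exp_gap y <= y ^+ 2 * expR `|y|.
Proof.
wlog y0 : y / 0 <= y => [hw|].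
  have [/hw//|y0] := leP 0 y.
  by rewrite -exp_gap_sym -normrN -sqrrN; apply: hw; rewrite oppr_ge0 ltW.
rewrite ger0_norm//; pose a := expR (2^-1 * y); pose b := expR (- (2^-1 * y)).
have ab : a * b = 1 by rewrite -expRD subrr expR0.
have aa : a ^+ 2 = expR y by rewrite -expRM_natl; congr expR; field.
have bb : b ^+ 2 = expR (- y) by rewrite -expRM_natl; congr expR; field.
have -> : exp_gap y = (a - b) ^+ 2 by rewrite sqrrB ab aa bb /exp_gap; ring.
have b0 : 0 <= b by exact: expR_ge0.
have a0 : 0 <= a by exact: expR_ge0.
have e1 : a - b = b * (expR y - 1) by rewrite -aa mulrBr mulr1 expr2 mulrA [b * a]mulrC ab mul1r.
have e2 : a - b = a * (1 - expR (- y)) by rewrite -bb mulrBr mulr1 expr2 mulrA ab mul1r.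
have h1 := expR_ge1Dx y; have h2 := expR_ge1Dx (- y).
apply/andP; split.
  rewrite -bb -exprMn mulrC e1 ler_pXn2r ?nnegrE ?mulr_ge0//; last lra.
  by rewrite ler_wpM2l//; lra.
rewrite -aa -exprMn mulrC e2 ler_pXn2r ?nnegrE ?mulr_ge0//.
  by rewrite ler_wpM2l//; lra.
by rewrite subr_ge0 -[leRHS]expR0 ler_expR oppr_le0.
Qed.

Lemma exp_gap_ge0 y : 0 <= exp_gap y.
Proof.
by have /andP[h _] := exp_gap_bounds y; apply: le_trans h; rewrite mulr_ge0 ?sqr_ge0 ?expR_ge0.
Qed.

Lemma damping_le y : `|1 - exp_gap y| <= expR (4 * y ^+ 2).
Proof.
have := exp_gap_le y; have := exp_gap_ge0 y.
have -> : 4 * y ^+ 2 = 2 * (2 * y ^+ 2) by ring.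
rewrite (expRM_natl 2 (2 * y ^+ 2)).
have : 1 <= expR (2 * y ^+ 2) by rewrite -expR0 ler_expR mulr_ge0 ?sqr_ge0.
move: (expR _) (exp_gap y) => E g E1 g0 gE; rewrite ler_norml.
have := sqr_ge0 (E - 1); rewrite sqrrB expr1n mulr1 => h.
have E2 : 1 <= E ^+ 2 by rewrite expr2 -[leLHS]mul1r ler_pM.
apply/andP; split; lra.
Qed.

Lemma pow_compl_cvg (q : nat -> R) (c : R) : (forall n, 0 <= q n) ->
  q n @[n --> \oo] --> (0 : R) -> n.+1%:R * q n @[n --> \oo] --> c ->
  (1 - q n) ^+ n.+1 @[n --> \oo] --> expR (- c).
Proof.
move=> q0 qc nq.
have qh : \forall n \near \oo, q n <= 2^-1 by apply: (cvgr_le (0 : R)).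
apply: (@squeeze_cvgr _ _ _ _ (fun n => expR (- (n.+1%:R * q n * (1 + 2^-1 * q n + q n * q n))))
   (fun n => expR (- (n.+1%:R * q n)))).
- apply: filterS qh => n h.
  have q1 : 0 <= 1 - q n by lra.
  have /andP[t1 _] : expR (- q n - 2^-1 * (- q n) ^+ 2 - `|- q n| ^+ 3) <= 1 + - q n <=
      expR (- q n - 2^-1 * (- q n) ^+ 2 + `|- q n| ^+ 3).
    by apply: expR_taylor2; rewrite normrN ger0_norm.
  apply/andP; split.
    have -> : - (n.+1%:R * q n * (1 + 2^-1 * q n + q n * q n)) =
       n.+1%:R * (- q n - 2^-1 * (- q n) ^+ 2 - `|- q n| ^+ 3).
      by rewrite normrN ger0_norm//; ring.
    by rewrite expRM_natl ler_pXn2r ?nnegrE ?expR_ge0.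
  rewrite -mulrN expRM_natl ler_pXn2r ?nnegrE ?expR_ge0//.
  exact: expR_ge1Dx.
- apply: continuous_cvg; first exact: continuous_expR.
  apply: cvgN; rewrite -[X in _ --> X]mulr1; apply: cvgM => //.
  rewrite [X in _ --> X](_ : 1 = 1 + 2^-1 * 0 + 0 * 0); last by rewrite !mulr0 !addr0.
  apply: cvgD; last exact: cvgM.
  by apply: cvgD; [exact: cvg_cst|apply: cvgMl_tmp].
- by apply: continuous_cvg; [exact: continuous_expR|exact: cvgN].
Qed.

(** The factors are 1 - g x^2 / n up to smaller terms. A linear combination of
    exponentials in x thus approximates a Gaussian. *)
Lemma damping_cvg (g x : R) : 0 <= g ->
  (1 - exp_gap (Num.sqrt (g / n.+1%:R) * x)) ^+ n.+1 @[n --> \oo] --> expR (- (g * x ^+ 2)).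
Proof.
move=> g0; pose h n := Num.sqrt (g / n.+1%:R).
have h2 n : h n ^+ 2 = g / n.+1%:R by rewrite sqr_sqrtr// divr_ge0.
have hc : h n @[n --> \oo] --> (0 : R).
  rewrite -[X in _ --> X]sqrtr0; apply: continuous_cvg; first exact: sqrt_continuous.
  by rewrite -[X in _ --> X](mulr0 g); apply: cvgMl_tmp; exact: cvg_harmonic.
have hx : `|h n * x| @[n --> \oo] --> (0 : R).
  rewrite -[X in _ --> X](@normr0 _ R); apply: cvg_norm.
  by rewrite -[X in _ --> X](mul0r x); apply: cvgM => //; exact: cvg_cst.
have b n := exp_gap_bounds (h n * x).
have e n : (h n * x) ^+ 2 = g / n.+1%:R * x ^+ 2 by rewrite exprMn h2.
have ec (c : R) : expR (c * `|h n * x|) @[n --> \oo] --> (1 : R).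
  rewrite -[X in _ --> X]expR0; apply: continuous_cvg; first exact: continuous_expR.
  by rewrite -[X in _ --> X](mulr0 c); exact: cvgMl_tmp.
have nq : n.+1%:R * exp_gap (h n * x) @[n --> \oo] --> g * x ^+ 2.
  apply: (@squeeze_cvgr _ _ _ _ (fun n => g * x ^+ 2 * expR (-1 * `|h n * x|))
    (fun n => g * x ^+ 2 * expR (1 * `|h n * x|))).
  - apply: nearW => n; have /andP[b1 b2] := b n.
    have k z : g * x ^+ 2 * z = n.+1%:R * ((h n * x) ^+ 2 * z).
      by rewrite e; field.
    rewrite !k mulN1r mul1r; apply/andP; split; by rewrite ler_wpM2l.
  - by rewrite -[X in _ --> X]mulr1; apply: cvgMl_tmp; exact: ec.
  - by rewrite -[X in _ --> X]mulr1; apply: cvgMl_tmp; exact: ec.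
apply: pow_compl_cvg (nq) => [n|]; first exact: exp_gap_ge0.
rewrite -[X in _ --> X](mulr0 (0 : R)) (_ : (fun n => _) =
  fun n => n.+1%:R^-1 * (n.+1%:R * exp_gap (h n * x))); last first.
  by apply/funext => n; rewrite mulrA mulVf ?mul1r.
rewrite [X in _ --> X](_ : _ = 0 * (g * x ^+ 2)); last by rewrite !mul0r.
by apply: cvgM; [exact: cvg_harmonic|exact: nq].
Qed.

End exponential_inequalities.

Section exponential_moments.
Context d (T : measurableType d) (R : realType) (P : probability T R).

Local Notation mfun f := (measurable_fun [set: T] (f : T -> R)).
Local Notation intg f := (P.-integrable [set: T] (EFin \o (f : T -> R))).

(** Multiplying by 1 - exp_gap (h X) = 3 - exp(h X) - exp(- h X) combines
    exponentials of X, hence preserves orthogonality. With h^2 = g / n the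
    n-th power of this factor tends to exp(- g X^2) and is dominated by exp(4
    g X^2), which is where the Gaussian integrability of V enters. Induct on
    the number k of such factors. *)
Lemma gaussian_damping (V X : T -> R) (delta : R) : 0 < delta -> mfun V -> mfun X ->
  (forall lam, intg (fun x => V x * expR (lam * X x) * expR (delta * X x ^+ 2))) ->
  (forall lam, \int[P]_x (V x * expR (lam * X x)) = 0) ->
  forall k lam, intg (fun x => V x * expR (lam * X x - k%:R * (delta / 4) * X x ^+ 2)) /\
    \int[P]_x (V x * expR (lam * X x - k%:R * (delta / 4) * X x ^+ 2)) = 0.
Proof.
move=> d0 mV mX IV V0; set g := delta / 4.
have g0 : 0 <= g by rewrite divr_ge0// ltW.
pose G lam k f x := V x * expR (lam * X x - k%:R * g * X x ^+ 2) * f (X x).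
have mG lam k (f : R -> R) : measurable_fun setT f -> mfun (G lam k f).
  move=> mf; apply: measurable_funM; last exact: measurableT_comp.
  apply: measurable_funM => //; apply: measurableT_comp => //.
  apply: measurable_funB; first exact: measurable_funM.
  by apply: measurable_funM => //; exact: measurable_funX.
have IG lam k (f : R -> R) : measurable_fun setT f -> (forall y, `|f y| <= expR (delta * y ^+ 2)) ->
    intg (G lam k f).
  move=> mf fle; apply: integrable_le (intg_norm (IV lam)) => [|x]; first exact: mG.
  rewrite /G !normrM !(ger0_norm (expR_ge0 _)); apply: ler_pM => //.
    by rewrite ler_wpM2l// ler_expR gerBl mulr_ge0 ?sqr_ge0// mulr_ge0.
have mp h m : measurable_fun setT (fun y : R => (1 - exp_gap (h * y)) ^+ m).
  apply: measurable_funX; apply: measurable_funB => //; apply: measurable_funB => //.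
  by apply: measurable_funD; apply: measurableT_comp => //; try (apply: measurableT_comp => //); exact: measurable_funM.
move=> k; elim: k => [|k IH] lam.
  have E x : V x * expR (lam * X x - 0 * g * X x ^+ 2) = G lam 0%N (fun=> 1) x.
    by rewrite /G mulr1.
  under [X in _ /\ X = _]eq_Rintegral do rewrite mul0r mul0r subr0.
  split => //; under eq_fun do rewrite E; apply: IG => // y.
  by rewrite normr1 -expR0 ler_expR mulr_ge0 ?sqr_ge0// ltW.
have key n m : (m <= n.+1)%N -> forall lam,
    \int[P]_x G lam k (fun y => (1 - exp_gap (Num.sqrt (g / n.+1%:R) * y)) ^+ m) x = 0.
  set h := Num.sqrt _.
  have h2 : h ^+ 2 = g / n.+1%:R by rewrite sqr_sqrtr// divr_ge0.
  have pe j y : (j <= n.+1)%N -> `|(1 - exp_gap (h * y)) ^+ j| <= expR (delta * y ^+ 2).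
    move=> jn; rewrite normrX; apply: (@le_trans _ _ (expR (4 * (h * y) ^+ 2) ^+ j)).
      by rewrite lerXn2r ?nnegrE ?expR_ge0// damping_le.
    rewrite -expRM_natl ler_expR exprMn h2.
    have -> : j%:R * (4 * (g / n.+1%:R * y ^+ 2)) = delta * y ^+ 2 * (j%:R / n.+1%:R).
      by rewrite /g; field.
    rewrite ler_piMr//; first exact: (mulr_ge0 (ltW d0) (sqr_ge0 _)).
    by rewrite ler_pdivrMr// mul1r ler_nat.
  elim: m => [_|m IHm mn] {}lam.
    by have [_ <-] := IH lam; apply: eq_Rintegral => x _; rewrite /G expr0 mulr1.
  have E x : G lam k (fun y => (1 - exp_gap (h * y)) ^+ m.+1) x =
    3 * G lam k (fun y => (1 - exp_gap (h * y)) ^+ m) x -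
    (G (lam + h) k (fun y => (1 - exp_gap (h * y)) ^+ m) x +
    G (lam - h) k (fun y => (1 - exp_gap (h * y)) ^+ m) x).
    rewrite /G [_ ^+ m.+1]exprS; have -> : (lam + h) * X x - k%:R * g * X x ^+ 2 =
        h * X x + (lam * X x - k%:R * g * X x ^+ 2) by ring.
    have -> : (lam - h) * X x - k%:R * g * X x ^+ 2 =
        - (h * X x) + (lam * X x - k%:R * g * X x ^+ 2) by ring.
    by rewrite (expRD (h * X x)) (expRD (- (h * X x))) /exp_gap; ring.
  have mn' : (m <= n.+1)%N by exact: ltnW.
  have I lam' : intg (G lam' k (fun y => (1 - exp_gap (h * y)) ^+ m)).
    by apply: IG => // y; exact: pe.
  under eq_Rintegral do rewrite E.
  rewrite RintB; [|exact: intgZ|exact: intgD].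
  by rewrite RintZ// RintD// !IHm// mulr0 addr0 subrr.
pose F n := G lam k (fun y => (1 - exp_gap (Num.sqrt (g / n.+1%:R) * y)) ^+ n.+1).
have [|||x|I c] := @Rint_dominated_cvg _ _ _ P F
  (fun x => V x * expR (lam * X x - k.+1%:R * g * X x ^+ 2))
  (fun x => `|V x * expR (lam * X x) * expR (delta * X x ^+ 2)|).
- by move=> n; exact: mG.
- exact: intg_norm.
- move=> n x; rewrite /F /G !normrM !(ger0_norm (expR_ge0 _)).
  have h2 : Num.sqrt (g / n.+1%:R) ^+ 2 = g / n.+1%:R by rewrite sqr_sqrtr// divr_ge0.
  apply: ler_pM => //.
    by rewrite ler_wpM2l// ler_expR gerBl mulr_ge0 ?sqr_ge0// mulr_ge0.
  rewrite normrX; apply: (@le_trans _ _ (expR (4 * (Num.sqrt (g / n.+1%:R) * X x) ^+ 2) ^+ n.+1)).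
    by rewrite ler_pXn2r ?nnegrE ?expR_ge0// damping_le.
  rewrite -expRM_natl ler_expR exprMn h2 le_eqVlt; apply/orP; left; apply/eqP.
  by rewrite /g; field.
- have -> : V x * expR (lam * X x - k.+1%:R * g * X x ^+ 2) =
    V x * expR (lam * X x - k%:R * g * X x ^+ 2) * expR (- (g * X x ^+ 2)).
    by rewrite -[RHS]mulrA -expRD -natr1; congr (_ * expR _); ring.
  by apply: cvgMl_tmp; exact: damping_cvg.
- split => //; apply: (cvg_unique _ c); first exact: norm_hausdorff.
  rewrite (_ : (fun n => _) = fun=> 0); first exact: cvg_cst.
  by apply/funext => n; exact: key.
Qed.

End exponential_moments.

(** * From Gaussian functions to Borel functions *)

Section half_lines.
Context (R : realType).
Implicit Types y : R.

Lemma bernoulli_inequality (x : R) m : 0 <= x <= 1 -> 1 - m%:R * x <= (1 - x) ^+ m.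
Proof.
move=> /andP[x0 x1]; elim: m => [|m IH]; first by rewrite mul0r subr0 expr0.
rewrite exprS; have : (1 - x) * (1 - m%:R * x) <= (1 - x) * (1 - x) ^+ m.
  by rewrite ler_wpM2l// subr_ge0.
apply: le_trans; rewrite -natr1 -subr_ge0.
rewrite (_ : _ - _ = m%:R * x ^+ 2); last by ring.
by rewrite mulr_ge0 ?sqr_ge0.
Qed.

Lemma expRN_le_inv (t : R) : 0 < t -> expR (- t) <= t^-1.
Proof.
move=> t0; rewrite expRN lef_pV2 ?posrE ?expR_gt0//.
by apply: le_trans (expR_ge1Dx t); rewrite lerDr.
Qed.

(** The ball of radius n+1 about step_center b n has right end point b -
    1/(n+1). *)
Definition step_center (b : R) n : R := b - n.+1%:R^-1 - n.+1%:R.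

(** Chosen to balance exp(- g (n+1) r^2) at the radius r = n+1. *)
Definition step_power (g : R) n : nat := (Num.truncn (expR (g * n.+1%:R ^+ 3))).+1.

(** Let v n be the Gaussian raised to the power n+1, and z n the logarithm of
    step_power g n * v n up to a factor 2. If y >= b, then z n tends to -oo,
    and Bernoulli's inequality gives the limit 1. If y < b, then z n tends to
    +oo, and (1 - v)^m <= exp(- m v) gives the limit 0. *)
Lemma smooth_step_cvg (g b y : R) : 0 < g ->
  (1 - expR (- (g * (y - step_center b n) ^+ 2)) ^+ n.+1) ^+ step_power g n
    @[n --> \oo] --> (\1_(`[b, +oo[%classic) y : R).
Proof.
move=> g0; pose f n := (1 - expR (- (g * (y - step_center b n) ^+ 2)) ^+ n.+1) ^+ step_power g n.
pose v n := expR (- (g * (y - step_center b n) ^+ 2)) ^+ n.+1.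
have vE n : v n = expR (- (n.+1%:R * g * (y - step_center b n) ^+ 2)).
  by rewrite /v -expRM_natl; congr expR; ring.
have v01 n : 0 <= v n <= 1.
  by rewrite vE expR_ge0/= -expR0 ler_expR oppr_le0 mulr_ge0 ?sqr_ge0// mulr_ge0// ltW.
have f01 n : 0 <= f n <= 1.
  have /andP[v0 v1] := v01 n.
  by rewrite /f exprn_ge0 ?subr_ge0//= exprn_ile1 ?subr_ge0// lerBlDr lerDl.
pose z n := g * n.+1%:R * (n.+1%:R ^+ 2 - (y - step_center b n) ^+ 2).
have Mv n : expR (g * n.+1%:R ^+ 3) * v n = expR (z n).
  by rewrite vE -expRD /z; congr expR; ring.
have m1 n : expR (g * n.+1%:R ^+ 3) <= (step_power g n)%:R.
  by rewrite ltW// truncnS_gt.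
have m2 n : (step_power g n)%:R <= 2 * expR (g * n.+1%:R ^+ 3).
  rewrite /step_power -natr1 mulrDl mul1r lerD//.
    by rewrite truncn_le expR_ge0.
  by rewrite -expR0 ler_expR mulr_ge0 ?exprn_ge0// ltW.
have N0 n : 0 < n.+1%:R :> R by [].
have [yb|yb] := leP b y.
  rewrite indicE mem_set/=; last by rewrite in_itv/= yb.
  apply: (@squeeze_cvgr _ _ _ _ (fun n => 1 - g^-1 * n.+1%:R^-1) (fun=> 1)).
  - apply: nearW => n; have /andP[_ ->] := f01 n; rewrite andbT.
    apply: le_trans (bernoulli_inequality _ (v01 n)).
    rewrite lerD2l lerN2.
    apply: (@le_trans _ _ (2 * expR (z n))).
      by rewrite -Mv mulrA ler_wpM2r//; have /andP[] := v01 n.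
    have zle : z n <= - (2 * g * n.+1%:R).
      have i0 : 0 < n.+1%:R^-1 :> R by rewrite invr_gt0.
      have h : n.+1%:R + n.+1%:R^-1 <= y - step_center b n.
        rewrite /step_center -subr_ge0 (_ : _ - _ = y - b); first by rewrite subr_ge0.
        by ring.
      have h2 : n.+1%:R ^+ 2 + 2 <= (y - step_center b n) ^+ 2.
        apply: (@le_trans _ _ ((n.+1%:R + n.+1%:R^-1) ^+ 2)).
          rewrite sqrrD (_ : n.+1%:R / n.+1%:R = 1) ?divff//.
          by rewrite -mulr_natl mulr1 lerDl sqr_ge0.
        have p0 : 0 <= n.+1%:R + n.+1%:R^-1 :> R by rewrite addr_ge0// ltW.
        by rewrite ler_pXn2r ?nnegrE// (le_trans p0).
      rewrite /z -mulrN; apply: (@le_trans _ _ (g * n.+1%:R * (- 2))).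
        by rewrite ler_wpM2l ?mulr_ge0 ?(ltW g0)//; lra.
      by rewrite le_eqVlt; apply/orP; left; apply/eqP; ring.
    apply: (@le_trans _ _ (2 * (2 * g * n.+1%:R)^-1)).
      rewrite ler_wpM2l//; apply: le_trans (expRN_le_inv _); last by rewrite !mulr_gt0.
      by rewrite ler_expR.
    rewrite le_eqVlt; apply/orP; left; apply/eqP; field.
    by rewrite (gt_eqF g0) nat1r pnatr_eq0.
  - rewrite -[X in _ --> X]subr0; apply: cvgB; first exact: cvg_cst.
    by rewrite -[X in _ --> X](mulr0 g^-1); apply: cvgMl_tmp; exact: cvg_harmonic.
  - exact: cvg_cst.
rewrite indicE memNset/=; last by rewrite in_itv/= andbT; apply/negP; rewrite -ltNge.
pose e := 2^-1 * (b - y); have e0 : 0 < e by rewrite mulr_gt0// subr_gt0.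
apply: (@squeeze_cvgr _ _ _ _ (fun=> 0) (fun n => (g * e)^-1 * n.+1%:R^-1)).
- have h1 : \forall n \near \oo, n.+1%:R^-1 <= e by apply: (cvgr_le (0 : R)) => //; exact: cvg_harmonic.
  have h2 : \forall n \near \oo, 2 * e <= n.+1%:R.
    exists (Num.truncn (2 * e)) => // n /= hn; rewrite ltW//.
    by apply: lt_le_trans (truncnS_gt _) _; rewrite ler_nat.
  apply: filterS2 h1 h2 => n h1 h2; have /andP[-> _] := f01 n => /=.
  have /andP[v0 v1] := v01 n.
  have i0 : 0 < n.+1%:R^-1 :> R by rewrite invr_gt0.
  have zge : g * e * n.+1%:R <= z n.
    have h : `|y - step_center b n| <= n.+1%:R - e.
      have h0 (i M : R) : 0 < i -> i <= e -> 2 * e <= M -> `|y - (b - i - M)| <= M - e.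
        by rewrite ler_norml /e => *; apply/andP; split; lra.
      exact: h0.
    have h3 : (y - step_center b n) ^+ 2 <= (n.+1%:R - e) ^+ 2.
      by rewrite -[leLHS]real_normK ?num_real// ler_pXn2r ?nnegrE//; lra.
    have h4 : e <= n.+1%:R ^+ 2 - (y - step_center b n) ^+ 2.
      apply: (@le_trans _ _ (n.+1%:R ^+ 2 - (n.+1%:R - e) ^+ 2)); last by rewrite lerD2l lerN2.
      rewrite (_ : _ - _ = e * (2 * n.+1%:R - e)); last by ring.
      rewrite ler_peMr ?(ltW e0)//.
      have : 1 <= n.+1%:R :> R by rewrite ler1n.
      by lra.
    rewrite /z (_ : g * e * n.+1%:R = g * n.+1%:R * e); last by ring.
    by rewrite ler_wpM2l ?mulr_ge0 ?(ltW g0).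
  have geN0 : 0 < g * e * n.+1%:R by exact: (mulr_gt0 (mulr_gt0 g0 e0) (N0 n)).
  have z0 : 0 < z n by exact: lt_le_trans zge.
  apply: (@le_trans _ _ (expR (- ((step_power g n)%:R * v n)))).
    rewrite -/(v n) -mulrN expRM_natl lerXn2r ?nnegrE ?subr_ge0 ?expR_ge0//.
    exact: expR_ge1Dx.
  apply: (@le_trans _ _ (expR (- expR (z n)))).
    by rewrite ler_expR lerN2 -Mv ler_wpM2r.
  apply: (le_trans (expRN_le_inv (expR_gt0 _))).
  rewrite -expRN; apply: (le_trans (expRN_le_inv z0)).
  by rewrite -invfM lef_pV2 ?posrE.
- exact: cvg_cst.
- by rewrite -[X in _ --> X](mulr0 (g * e)^-1); apply: cvgMl_tmp; exact: cvg_harmonic.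
Qed.

End half_lines.

Section exponential_determination.
Context d (T : measurableType d) (R : realType) (P : probability T R).

Local Notation mfun f := (measurable_fun [set: T] (f : T -> R)).
Local Notation intg f := (P.-integrable [set: T] (EFin \o (f : T -> R))).

(** Expanding the powers in smooth_step_cvg gives linear combinations of the
    functions to which V is orthogonal. *)
Lemma Rint_half_line_eq0 (V X : T -> R) (g : R) : 0 < g -> intg V -> mfun X ->
  (forall k lam, intg (fun x => V x * expR (lam * X x - k%:R * g * X x ^+ 2)) /\
    \int[P]_x (V x * expR (lam * X x - k%:R * g * X x ^+ 2)) = 0) ->
  forall b, \int[P]_x (V x * \1_(`[b, +oo[%classic) (X x)) = 0.
Proof.
move=> g0 IV mX H b.
pose u a x := expR (- (g * (X x - a) ^+ 2)).
have u01 a x : 0 <= u a x <= 1.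
  by rewrite expR_ge0/= -expR0 ler_expR oppr_le0 mulr_ge0 ?sqr_ge0// ltW.
have mu a : mfun (u a).
  apply: measurableT_comp => //; apply: measurableT_comp => //; apply: measurable_funM => //.
  by apply: measurable_funX; apply: measurable_funB.
have uX a k x : V x * u a x ^+ k = expR (- (k%:R * g * a ^+ 2)) *
    (V x * expR ((2 * k%:R * g * a) * X x - k%:R * g * X x ^+ 2)).
  by rewrite /u -expRM_natl [RHS]mulrCA -expRD; congr (_ * expR _); ring.
have bnd a j k m x : `|u a x ^+ j * (1 - u a x ^+ k) ^+ m| <= 1.
  have /andP[u0 u1] := u01 a x.
  have k0 : 0 <= u a x ^+ k by exact: exprn_ge0.
  have k1 : u a x ^+ k <= 1 by exact: exprn_ile1.
  have m0 : 0 <= (1 - u a x ^+ k) ^+ m by rewrite exprn_ge0 ?subr_ge0.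
  rewrite ger0_norm; last by rewrite mulr_ge0// exprn_ge0.
  have j1 : u a x ^+ j <= 1 by exact: exprn_ile1.
  have m1 : (1 - u a x ^+ k) ^+ m <= 1 by rewrite exprn_ile1 ?subr_ge0// lerBlDr lerDl.
  exact: (mulr_ile1 (exprn_ge0 _ u0) m0 j1 m1).
have mw a j k m : mfun (fun x => u a x ^+ j * (1 - u a x ^+ k) ^+ m).
  apply: measurable_funM; first exact: measurable_funX.
  by apply: measurable_funX; apply: measurable_funB => //; exact: measurable_funX.
have I a j k m : intg (fun x => V x * (u a x ^+ j * (1 - u a x ^+ k) ^+ m)).
  by apply: (intg_bounded (C := 1)).
have W a k m : forall j, \int[P]_x (V x * (u a x ^+ j * (1 - u a x ^+ k) ^+ m)) = 0.
  elim: m => [|m IH] j.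
    under eq_Rintegral do rewrite expr0 mulr1 uX.
    by rewrite RintZ ?(H _ _).2 ?mulr0//; exact: (H _ _).1.
  have e x : V x * (u a x ^+ j * (1 - u a x ^+ k) ^+ m.+1) =
    V x * (u a x ^+ j * (1 - u a x ^+ k) ^+ m) -
    V x * (u a x ^+ (j + k) * (1 - u a x ^+ k) ^+ m).
    by rewrite exprD [_ ^+ m.+1]exprS; ring.
  under eq_Rintegral do rewrite e.
  by rewrite RintB// !IH subrr.
have [||||_ c] := @Rint_dominated_cvg _ _ _ P
  (fun n x => V x * (1 - u (step_center b n) x ^+ n.+1) ^+ step_power g n)
  (fun x => V x * \1_(`[b, +oo[%classic) (X x)) (fun x => `|V x|).
- move=> n; apply: measurable_funM; first exact: (integrable_meas IV).
  by apply: measurable_funX; apply: measurable_funB => //; exact: measurable_funX.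
- exact: intg_norm.
- move=> n x; rewrite normrM ler_piMr//.
  by have := bnd (step_center b n) 0%N n.+1 (step_power g n) x; rewrite expr0 mul1r.
- by move=> x; apply: cvgMl_tmp; exact: smooth_step_cvg.
apply: (cvg_unique _ c); first exact: norm_hausdorff.
rewrite (_ : (fun n => _) = fun=> 0); first exact: cvg_cst.
apply/funext => n; rewrite -(W (step_center b n) n.+1 (step_power g n) 0%N).
by apply: eq_Rintegral => x _; rewrite expr0 mul1r.
Qed.

Lemma Rint_borel_eq0 (V X : T -> R) : intg V -> mfun X -> \int[P]_x V x = 0 ->
  (forall b, \int[P]_x (V x * \1_(`[b, +oo[%classic) (X x)) = 0) ->
  forall A : set R, measurable A -> \int[P]_x (V x * \1_A (X x)) = 0.
Proof.
move=> IV mX V0 Vb; have [HT1 HT2 HT3 HT4] := Rint_lambda_system IV V0.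
set HT := [set G | _] in HT1 HT2 HT3 HT4.
pose HR := [set A : set R | measurable A /\ HT (X @^-1` A)].
have LR : lambda_system setT HR.
  split => //.
  - move=> A B BA [mA hA] [mB hB]; split; first exact: measurableD.
    by apply: (HT3 (X @^-1` A) (X @^-1` B)) => // x; exact: BA.
  - move=> F ndF hF; split; first by apply: bigcupT_measurable => n; exact: (hF n).1.
    rewrite preimage_bigcup; apply: HT4 => [m n mn|n]; last exact: (hF n).2.
    by apply/subsetPset => x; have /subsetPset := ndF _ _ mn; exact.
have sub : <<s @RGenCInfty.G R >> `<=` HR.
  apply: (lambda_system_subset _ LR) => //.
  - move=> _ _ [a ->] [b ->]; exists (Num.max a b).
    apply/seteqP; split => x /=; rewrite !in_itv/= !andbT ge_max.
      by move=> [-> ->].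
    by move=> /andP[].
  - move=> _ [a ->]; split; first exact: measurable_itv.
    split; first by rewrite -[X in measurable X]setTI; apply: mX => //; exact: measurable_itv.
    rewrite -[RHS](Vb a); apply: eq_Rintegral => x _.
    by rewrite !indicE.
move=> A mA; have [_ [_ h]] : HR A by apply: sub; rewrite -[X in X A]RGenCInfty.measurableE.
by rewrite -[RHS]h; apply: eq_Rintegral => x _; rewrite !indicE.
Qed.

(** Linearize the square: with y = sqrt c * |x| and k the integer part of y,
    (y - k)^2 <= 1 gives c x^2 <= 1 + 2 k y - k^2. Summing the exponentials of
    the right-hand sides over k bounds exp(c X^2) by exponential moments of X
    that form a convergent series. *)
Lemma exp_square_integrable (X : T -> R) (v c : R) : mfun X -> 0 < c -> 4 * c * v <= 1 ->
  (forall lam, intg (fun x => expR (lam * X x)) /\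
     \int[P]_x expR (lam * X x) = expR (lam ^+ 2 * v / 2)) ->
  intg (fun x => expR (c * X x ^+ 2)).
Proof.
move=> mX c0 cv H; pose r := Num.sqrt c.
have r0 : 0 < r by rewrite sqrtr_gt0.
have r2 : r ^+ 2 = c by rewrite sqr_sqrtr// ltW.
pose w (k : nat) x := expR 1 * (expR (- k%:R ^+ 2) *
  (expR (2 * k%:R * r * X x) + expR (- (2 * k%:R * r) * X x))).
have w0 k x : 0 <= w k x by rewrite !mulr_ge0 ?expR_ge0// addr_ge0 ?expR_ge0.
have mw k : mfun (w k).
  apply: measurable_funM => //; apply: measurable_funM => //; apply: measurable_funD.
    by apply: measurableT_comp => //; exact: measurable_funM.
  by apply: measurableT_comp => //; exact: measurable_funM.
have wint k : (\int[P]_x (w k x)%:E <= (2 * expR 1 * expR (- 2^-1) ^+ k)%:E)%E.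
  have [I1 E1] := H (2 * k%:R * r); have [I2 E2] := H (- (2 * k%:R * r)).
  have Iw : intg (w k) by do 2 apply: intgZ; exact: intgD.
  rewrite -EFin_Rint// lee_fin /w RintZ; last by apply: intgZ; exact: intgD.
  rewrite RintZ; last exact: intgD.
  rewrite RintD// E1 E2 sqrrN.
  have key : expR (- k%:R ^+ 2) * expR ((2 * k%:R * r) ^+ 2 * v / 2) <= expR (- 2^-1) ^+ k.
    rewrite -expRD -expRM_natl ler_expR.
    have -> : (2 * k%:R * r) ^+ 2 * v / 2 = 2^-1 * (k%:R ^+ 2 * (4 * c * v)).
      by rewrite !exprMn r2; field.
    have kk : k%:R <= k%:R ^+ 2 :> R.
      by rewrite -natrX ler_nat; case: (k) => // j; rewrite expnS expn1 leq_pmulr.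
    have := sqr_ge0 (k%:R : R); move: kk; move: (k%:R ^+ 2) => K kK K0.
    have : K * (4 * c * v) <= K by rewrite ler_piMr.
    lra.
  move: key; set a := expR _; set l := expR _; set q := _ ^+ k => key.
  rewrite (_ : _ * (_ * _) = 2 * expR 1 * (a * l)); last by ring.
  by rewrite ler_wpM2l// mulr_ge0 ?expR_ge0.
have mf : mfun (fun x => expR (c * X x ^+ 2)).
  by apply: measurableT_comp => //; apply: measurable_funM => //; exact: measurable_funX.
apply: ge0_intg => //.
have pw x : ((expR (c * X x ^+ 2))%:E <= \sum_(k <oo) (w k x)%:E)%E.
  pose y := r * `|X x|; pose k := Num.truncn y.
  have y0 : 0 <= y by rewrite mulr_ge0// ltW.
  have /andP[k1 k2] : k%:R <= y < k.+1%:R by exact: truncn_itv.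
  have : ((w k x)%:E <= \sum_(0 <= i < k.+1) (w i x)%:E)%E.
    rewrite big_nat_recr//= leeDr// sume_ge0// => i _.
    by rewrite lee_fin.
  move=> h; apply: le_trans (le_trans h (nneseries_lim_ge _ _)); last first.
    by move=> n _ _; rewrite lee_fin.
  rewrite lee_fin.
  apply: (@le_trans _ _ (expR 1 * (expR (- k%:R ^+ 2) * expR (2 * k%:R * y)))).
    rewrite -!expRD ler_expR.
    have -> : c * X x ^+ 2 = y ^+ 2 by rewrite exprMn real_normK ?num_real// r2.
    rewrite -subr_ge0 (_ : _ - _ = 1 - (y - k%:R) ^+ 2); last by ring.
    have yk : `|y - k%:R| <= 1.
      by rewrite ger0_norm ?subr_ge0// lerBlDl; move: k2; rewrite -natr1 => /ltW.
    by rewrite subr_ge0 -[leLHS]real_normK ?num_real// exprn_ile1.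
  rewrite ler_wpM2l ?expR_ge0// ler_wpM2l ?expR_ge0// /y mulrA.
  have [x0|x0] := leP 0 (X x).
    by rewrite ger0_norm// lerDl expR_ge0.
  by rewrite ltr0_norm// mulrN mulNr lerDr expR_ge0.
apply: (@le_lt_trans _ _ (\int[P]_x \sum_(k <oo) (w k x)%:E)%E).
  apply: ge0_le_integral => //.
  - exact/measurable_EFinP.
  - by apply: ge0_emeasurable_sum => [k x _|k _]; [rewrite lee_fin|exact/measurable_EFinP].
rewrite integral_nneseries//; last 2 first.
- by move=> k; exact/measurable_EFinP.
- by move=> k x _; rewrite lee_fin.
pose q : R := expR (- 2^-1).
have q0 : 0 <= q by exact: expR_ge0.
have q1 : q < 1 by rewrite -expR0 ltr_expR oppr_lt0 invr_gt0.
apply: (@le_lt_trans _ _ (2 * expR 1 * (1 - q)^-1)%:E); last exact: ltry.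
apply: lime_le.
  by apply: is_cvg_nneseries => k _ _; apply: integral_ge0 => x _; rewrite lee_fin.
apply: nearW => n; apply: (@le_trans _ _ (\sum_(0 <= k < n) (2 * expR 1 * q ^+ k)%:E)%E).
  by apply: lee_sum => k _; exact: wint.
rewrite sumEFin lee_fin -mulr_sumr ler_wpM2l ?mulr_ge0 ?expR_ge0//.
rewrite -[leRHS]mul1r ler_pdivlMr ?subr_gt0//.
have -> : (\sum_(0 <= k < n) q ^+ k) * (1 - q) = 1 - q ^+ n.
  by elim: n => [|n IH]; rewrite ?big_nil ?big_nat_recr//= ?mul0r ?expr0 ?subrr// mulrDl IH exprS; ring.
by rewrite lerBlDr lerDl exprn_ge0.
Qed.

End exponential_determination.

(** * Totality of the Wick exponentials *)

Section totality.
Context d (T : measurableType d) (R : realType) (P : probability T R).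
Variable B : R -> {RV P >-> R}.
Implicit Types s : seq (R * R * R).

Local Notation mfun f := (measurable_fun [set: T] (f : T -> R)).
Local Notation intg f := (P.-integrable [set: T] (EFin \o (f : T -> R))).
Local Notation L2 f := ((f : T -> R) \in Lfun P 2%:E).

Hypothesis L2_wick : forall s, L2 (step_wick B s).
Hypothesis Rint_wick : forall s, \int[P]_x step_wick B s x = 1.

Let E s w := expR (step_integral B s w).

Let E_wick s w : E s w = expR (2^-1 * sq_norm s) * step_wick B s w.
Proof. by rewrite /E /step_wick -expRD addrC subrK. Qed.

Let L2_E s : L2 (E s).
Proof.
rewrite (_ : E s = fun w => expR (2^-1 * sq_norm s) * step_wick B s w); last exact/funext.
exact: L2Z.
Qed.

Let E_cat s s' w : E (s ++ s') w = E s w * E s' w.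
Proof. by rewrite /E step_integral_cat expRD. Qed.

Let E_scale c s w : E (scale_steps c s) w = expR (c * step_integral B s w).
Proof. by rewrite /E step_integral_scale. Qed.

Lemma exp_square_step_integral s c : 0 < c -> 4 * c * sq_norm s <= 1 ->
  intg (fun w => expR (c * step_integral B s w ^+ 2)).
Proof.
move=> c0 cs; apply: (exp_square_integrable (measurable_step_integral B s) c0 cs) => lam.
have LE := L2_E (scale_steps lam s); split.
  by apply: eq_intg (L2_intg LE) => w; rewrite E_scale.
transitivity (\int[P]_w E (scale_steps lam s) w).
  by apply: eq_Rintegral => w _; rewrite E_scale.
under eq_Rintegral do rewrite E_wick.
rewrite RintZ; last exact: L2_intg.
by rewrite Rint_wick mulr1 sq_norm_scale; congr expR; field.
Qed.

Definition wick_orthogonal (Y : T -> R) :=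
  L2 Y /\ forall s, \int[P]_w (Y w * expR (step_integral B s w)) = 0.

(** The exponentials of step integrals are stable under products. Hence V = Y
    exp(I(s')) is orthogonal to the exponentials of X = I(s), and then to all
    Borel functions of X. The constant delta is small enough for exp(4 delta
    X^2) to be integrable. *)
Lemma wick_orthogonal_indic (Y : T -> R) s (A : set R) : wick_orthogonal Y ->
  measurable A -> wick_orthogonal (fun w => Y w * \1_A (step_integral B s w)).
Proof.
move=> [LY Y0] mA; pose X := step_integral B s.
have mX : mfun X := measurable_step_integral B s.
split.
  apply: L2_le (LY).
    apply: measurable_funM; first exact: L2_meas LY.
    exact: (mfun_comp (f := fun y => \1_A y) mX (measurable_indic mA)).
  by move=> w; rewrite normrM ler_piMr ?indic_le1.
move=> s'; pose V w := Y w * E s' w.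
have IV : intg V by exact: L2M LY (L2_E s').
have mV : mfun V := integrable_meas IV.
pose delta : R := (16 * (sq_norm s + 1))^-1.
have s0 := sq_norm_ge0 s.
have d0 : 0 < delta by rewrite invr_gt0 mulr_gt0// ltr_wpDl.
have L2d : L2 (fun w => expR (2 * delta * X w ^+ 2)).
  apply/L2P; split.
    by apply: measurableT_comp => //; apply: measurable_funM => //; exact: measurable_funX.
  apply: eq_intg (@exp_square_step_integral s (4 * delta) _ _).
  - by move=> w; rewrite /= -expRM_natl; congr expR; rewrite /X; ring.
  - by rewrite mulr_gt0.
  - rewrite /delta (_ : 4 * _ * _ = sq_norm s / (sq_norm s + 1)); last first.
      by field; rewrite gt_eqF// ltr_wpDl.
    by rewrite ler_pdivrMr ?mul1r ?lerDl// ltr_wpDl.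
have zero lam : \int[P]_w (V w * expR (lam * X w)) = 0.
  rewrite -[RHS](Y0 (s' ++ scale_steps lam s)); apply: eq_Rintegral => w _.
  by rewrite -/(E _ w) E_cat E_scale mulrA.
have key := gaussian_damping d0 mV mX _ zero.
have V0 : \int[P]_w V w = 0.
  by rewrite -[RHS](zero 0); apply: eq_Rintegral => w _; rewrite mul0r expR0 mulr1.
have g0 : 0 < delta / 4 by rewrite divr_gt0.
have -> : \int[P]_w (Y w * \1_A (step_integral B s w) * expR (step_integral B s' w)) =
    \int[P]_w (V w * \1_A (X w)).
  by apply: eq_Rintegral => w _; rewrite mulrAC.
apply: Rint_borel_eq0 => //; apply: (Rint_half_line_eq0 g0 IV mX); apply: key => lam.
have L : L2 (fun w => E (s' ++ scale_steps lam s) w * expR (delta * X w ^+ 2)).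
  apply/L2P; split.
    apply: measurable_funM; first exact: L2_meas (L2_E _).
    by apply: measurableT_comp => //; apply: measurable_funM => //; exact: measurable_funX.
  apply: eq_intg (L2M (L2_E (scale_steps 2 (s' ++ scale_steps lam s))) L2d) => w.
  rewrite exprMn E_scale /E -!expRM_natl; congr (_ * expR _); ring.
by apply: eq_intg (L2M LY L) => w; rewrite E_cat E_scale /V; ring.
Qed.

Let value t w := step_integral B [:: (1, 0, t)] w.

Lemma wick_orthogonal_cylinder (Y : T -> R) (J : seq R) (A : R -> set R) :
  wick_orthogonal Y -> (forall t, measurable (A t)) ->
  wick_orthogonal (fun w => Y w * \prod_(t <- J) \1_(A t) (value t w)).
Proof.
move=> HY mA; elim: J => [|t J IH].
  by rewrite (_ : (fun w => _) = Y)//; apply/funext => w; rewrite big_nil mulr1.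
rewrite (_ : (fun w => _) =
  fun w => Y w * \prod_(t <- J) \1_(A t) (value t w) * \1_(A t) (value t w)).
  exact: wick_orthogonal_indic.
by apply/funext => w; rewrite big_cons mulrA mulrAC.
Qed.

Lemma indic_bigcap (J : {fset R}) (A : R -> set R) (X : R -> T -> R) w :
  \1_(\bigcap_(t in [set` J]) X t @^-1` A t) w = \prod_(t <- J) \1_(A t) (X t w) :> R.
Proof.
have [h|h] := pselect ((\bigcap_(t in [set` J]) X t @^-1` A t) w).
  rewrite indicE mem_set// big_seq big1// => t tJ.
  by rewrite indicE mem_set//; exact: h.
rewrite indicE memNset//; have [t [tJ nA]] : exists t, t \in J /\ ~ A t (X t w).
  apply: contrapT => H; apply: h => t /= tJ; apply: contrapT => nA; apply: H.
  by exists t.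
by rewrite (big_rem t tJ)/= indicE memNset// mul0r.
Qed.

Hypothesis B_start : {ae P, forall w, B 0 w = 0}.
Hypothesis F_generated : @measurable d T
  = null_completion P (sigma_gen [set t : R | 0 <= t] (fun t => B t)).

Lemma value_path t w : 0 <= t -> B 0 w = 0 -> value t w = B t w.
Proof.
move=> t0 w0; rewrite /value /step_integral big_seq1/= mul1r t0 maxxx w0 subr0.
by rewrite max_r.
Qed.

(** By wick_orthogonal_indic, Y is orthogonal to the cylinders of B, hence to
    the sigma-field that they generate and to its completion. This is the
    sigma-field of all events; those generated by Y show that Y is orthogonal
    to itself. *)
Lemma step_wick_total (Y : T -> R) : L2 Y ->
  (forall s, \int[P]_w (Y w * step_wick B s w) = 0) -> \int[P]_w Y w ^+ 2 = 0.
Proof.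
move=> LY Yw; have IY := L2_intg LY; have mY : mfun Y := L2_meas LY.
have HY : wick_orthogonal Y.
  split => // s; have e w : Y w * expR (step_integral B s w) =
      expR (2^-1 * sq_norm s) * (Y w * step_wick B s w).
    by rewrite -/(E s w) E_wick mulrCA.
  under eq_Rintegral do rewrite e.
  by rewrite RintZ ?Yw ?mulr0//; exact: L2M.
have gen G : sigma_gen [set t : R | 0 <= t] (fun t => B t) G ->
    measurable G /\ \int[P]_w (Y w * \1_G w) = 0.
  apply: Rint_sigma_gen_eq0 => // J A J0 mA.
  have [LYJ /(_ [::])] := wick_orthogonal_cylinder J HY mA.
  rewrite /step_integral; under eq_Rintegral do rewrite big_nil expR0 mulr1.
  move=> <-; apply: ae_eq_Rint.
  - apply: measurable_funM => //; apply: measurable_indic.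
    apply: fin_bigcap_measurable => //= t tJ.
    by rewrite -[X in measurable X]setTI; apply: measurable_funPT.
  - exact: L2_meas LYJ.
  - apply: ae_imply B_start => w w0; rewrite indic_bigcap; congr (_ * _).
    by rewrite !big_seq; apply: eq_bigr => t tJ; rewrite value_path//; exact: J0.
have all (G : set T) : measurable G -> \int[P]_w (Y w * \1_G w) = 0.
  move=> mG; have := mG; rewrite F_generated => -[A GA [N nN ANG]].
  have [mA <-] := gen A GA; apply: ae_eq_Rint.
  - by apply: measurable_funM => //; exact: measurable_indic.
  - by apply: measurable_funM => //; exact: measurable_indic.
  - apply: negligibleS nN => w /=; apply: contra_notP => nNw; congr (_ * _).
    rewrite !indicE; congr ((_ : bool)%:R); rewrite -ANG; apply/idP/idP.
      by rewrite !inE => -[].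
    by rewrite !inE => ?; left.
have := @Rint_comp_eq0 _ _ _ P Y Y id IY mY.
under eq_Rintegral do rewrite -expr2; apply.
- move=> A mA; rewrite -[RHS](all (Y @^-1` A)); last first.
    by rewrite -[X in measurable X]setTI; exact: mY.
  by apply: eq_Rintegral => w _; rewrite !indicE.
- exact: measurable_id.
- exact: L2M.
Qed.

End totality.

(** * Processes as functions on the product space *)

Section product_space.
Context d (T : measurableType d) (R : realType) (P : probability T R).

Notation leb := (@lebesgue_measure R).
Notation mu := (time_product P).
Local Notation mfun f := (measurable_fun [set: T] (f : T -> R)).
Local Notation intg f := (P.-integrable [set: T] (EFin \o (f : T -> R))).
Local Notation L2 f := ((f : T -> R) \in Lfun P 2%:E).
Local Notation intgL f := (leb.-integrable [set: R] (EFin \o (f : R -> R))).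
Local Notation L2L f := ((f : R -> R) \in Lfun leb 2%:E).
Local Notation mfunP f := (measurable_fun [set: T * measurableTypeR R] (f : T * measurableTypeR R -> R)).
Local Notation intgP f := (mu.-integrable [set: T * measurableTypeR R] (EFin \o (f : T * measurableTypeR R -> R))).
Local Notation L2P' f := ((f : T * measurableTypeR R -> R) \in Lfun mu 2%:E).

Definition tensor (V : T -> R) (f : R -> R) (z : T * measurableTypeR R) := V z.1 * f z.2.

Lemma measurable_tensor (V : T -> R) (f : R -> R) : mfun V ->
  measurable_fun [set: R] f -> mfunP (tensor V f).
Proof.
by move=> mV mf; apply: measurable_funM; apply: measurableT_comp.
Qed.

Lemma Rint_tensor (V : T -> R) (f : R -> R) : intg V -> intgL f ->
  intgP (tensor V f) /\ \int[mu]_z tensor V f z = (\int[P]_w V w) * (\int[leb]_t f t).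
Proof.
move=> IV If; have mV := integrable_meas IV; have mf := integrable_meas If.
have mt := measurable_tensor mV mf.
have I : intgP (tensor V f).
  apply/integrable12ltyP; first exact/measurable_EFinP.
  rewrite (eq_integral (fun w => ((\int[leb]_t `|f t|) * `|V w|)%:E)) => [|w _].
    rewrite -EFin_Rint ?ltry//; exact/intgZ/intg_norm.
  rewrite EFinM EFin_Rint; last exact: intg_norm.
  rewrite muleC -ge0_integralZl//.
  - by apply: eq_integral => t _; rewrite /tensor/= normrM EFinM.
  - by apply/measurable_EFinP; exact: measurableT_comp.
split => //; rewrite {1}/Rintegral -integral12_prod_meas1//.
rewrite mulrC -RintZ//; congr fine; apply: eq_integral => w _; rewrite /fubini_F.
transitivity ((\int[leb]_t (V w * f t))%:E); last by rewrite RintZ// mulrC.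
by rewrite EFin_Rint//; exact: intgZ.
Qed.

Lemma L2_tensor (V : T -> R) (f : R -> R) : L2 V -> L2L f ->
  L2P' (tensor V f) /\ \int[mu]_z tensor V f z ^+ 2 = (\int[P]_w V w ^+ 2) * (\int[leb]_t f t ^+ 2).
Proof.
move=> LV Lf; have [I e] := Rint_tensor (L2_sqr LV) (L2_sqr Lf); split.
  apply/L2P; split; first exact: measurable_tensor (L2_meas LV) (L2_meas Lf).
  by apply: eq_intg I => z; rewrite /tensor exprMn.
by rewrite -e; apply: eq_Rintegral => z _; rewrite /tensor exprMn.
Qed.

Variables (n : nat) (n0 : (0 < n)%N).

Definition partial_process (y : nat -> T -> R) N (z : T * measurableTypeR R) :=
  \sum_(1 <= i < N.+1) tensor (y i) \1_(cell n i) z.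

Definition sampled_process (y : nat -> T -> R) : T * measurableTypeR R -> R :=
  half_line_process (embed_process n y).

Lemma sampled_processE y w t : sampled_process y (w, t) =
  if 0 < t then y `|Num.ceil (n%:R * t)%R|%N w else 0.
Proof.
rewrite /sampled_process /half_line_process patchE/= /embed_process.
have n0' : 0 < n%:R :> R by rewrite ltr0n.
have [t0|t0] := ltP 0 t.
  rewrite mem_set/=; last by split => //=; rewrite in_itv/= (ltW t0).
  rewrite ifF//; apply/negbTE; rewrite absz_eq0 gt_eqF// ceil_gt0 mulr_gt0//.
case: ifPn => //; rewrite inE/= => -[_]; rewrite /= in_itv/= andbT => t1.
have -> : t = 0 by apply/eqP; rewrite eq_le t0.
by rewrite mulr0 ceil0.
Qed.

Lemma partial_processE y N w t : partial_process y N (w, t) =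
  if (0 < t) && (`|Num.ceil (n%:R * t)%R| <= N)%N then sampled_process y (w, t) else 0.
Proof.
rewrite /partial_process /tensor/= (sum_cell (fun i => y i w))// sampled_processE.
by case: (0 < t).
Qed.

Lemma partial_process_le y N z : `|partial_process y N z| <= `|sampled_process y z|.
Proof. by case: z => w t; rewrite partial_processE; case: ifP => // _; rewrite normr0. Qed.

Lemma partial_process_near y z :
  \forall N \near \oo, partial_process y N z = sampled_process y z.
Proof.
case: z => w t; exists `|Num.ceil (n%:R * t)%R|%N => // N /= hN.
rewrite partial_processE hN andbT; case: ltP => // t0.
by rewrite sampled_processE ltNge t0.
Qed.

Let truncated (y : nat -> T -> R) i := if (0 < i)%N then y i else fun=> 0.

Lemma L2_partial_process y N : (forall i, (0 < i)%N -> L2 (y i)) ->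
  L2P' (partial_process y N) /\
  \int[mu]_z partial_process y N z ^+ 2 = n%:R^-1 * \sum_(1 <= i < N.+1) \int[P]_w y i w ^+ 2.
Proof.
move=> Ly; have Lt i : L2 (truncated y i).
  by rewrite /truncated; case: ltnP => [/Ly//|_]; exact: Lfun_cst.
have L1 i : L2L (if (0 < i)%N then \1_(cell n i) else fun=> 0 : R).
  case: ltnP => [i0|_]; last exact: L20.
  apply/L2P; split; first by apply: measurable_indic; exact: measurable_cell.
  apply: eq_intg (intg_cell R n0 i0) => t.
  by rewrite indicE; case: (_ \in _); rewrite ?expr1n ?expr0n.
have pE z : partial_process y N z = \sum_(1 <= i < N.+1)
    tensor (truncated y i) (if (0 < i)%N then \1_(cell n i) else fun=> 0) z.
  by apply: eq_big_nat => i /andP[i0 _]; rewrite /truncated i0.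
split.
  rewrite (_ : partial_process y N = fun z => \sum_(1 <= i < N.+1)
    tensor (truncated y i) (if (0 < i)%N then \1_(cell n i) else fun=> 0) z); last exact/funext.
  by apply: L2_sum => i; exact: (L2_tensor (Lt i) (L1 i)).1.
have sE z : partial_process y N z ^+ 2 = \sum_(1 <= i < N.+1)
    tensor (truncated y i) (if (0 < i)%N then \1_(cell n i) else fun=> 0) z ^+ 2.
  case: z => w t; rewrite [RHS](_ : _ = partial_process (fun i w => y i w ^+ 2) N (w, t)).
    rewrite !partial_processE; case: ifP => [/andP[t0 _]|_]; last by rewrite expr0n.
    by rewrite !sampled_processE t0.
  apply: eq_big_nat => i /andP[i0 _]; rewrite /truncated i0 /tensor/= exprMn.
  by rewrite indicE; case: (_ \in _); rewrite ?expr1n ?expr0n.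
under eq_Rintegral do rewrite sE.
rewrite Rint_sum; last by move=> i; apply: L2_sqr; exact: (L2_tensor (Lt i) (L1 i)).1.
rewrite mulr_sumr; apply: eq_big_nat => i /andP[i0 _].
rewrite (L2_tensor (Lt i) (L1 i)).2 /truncated i0 mulrC; congr (_ * _).
rewrite -(Rint_cell R n0 i0); apply: eq_Rintegral => t _.
by rewrite indicE; case: (_ \in _); rewrite ?expr1n ?expr0n.
Qed.

Lemma measurable_sampled_process y : (forall i, (0 < i)%N -> L2 (y i)) -> mfunP (sampled_process y).
Proof.
move=> Ly; apply: (measurable_fun_cvg (h := partial_process y)) => //.
- by move=> N; exact: L2_meas (L2_partial_process N Ly).1.
- by move=> z _; apply: cvg_near_cst; exact: partial_process_near.
Qed.

Lemma L2_sampled_process y C : (forall i, (0 < i)%N -> L2 (y i)) ->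
  (forall N, \sum_(1 <= i < N.+1) \int[P]_w y i w ^+ 2 <= C) -> L2P' (sampled_process y).
Proof.
move=> Ly yC; have mG := measurable_sampled_process Ly.
have LN N := (L2_partial_process N Ly).1.
apply/L2P; split => //; apply: ge0_intg => [|z|]; [exact: measurable_funX|exact: sqr_ge0|].
pose g N z := (partial_process y N z ^+ 2)%:E.
have gl z : limn (g ^~ z) = (sampled_process y z ^+ 2)%:E.
  apply: cvg_lim => //; apply: cvg_near_cst.
  by apply: filterS (partial_process_near y z) => N; rewrite /g => ->.
have gmono N M z : (N <= M)%N -> (g N z <= g M z)%E.
  case: z => w t NM; rewrite lee_fin !partial_processE.
  case: ifP => [/andP[-> h]|_]; last by rewrite expr0n sqr_ge0.
  by rewrite (leq_trans h NM).
have g0 N z : (0 <= g N z)%E by rewrite lee_fin sqr_ge0.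
have mg N : measurable_fun setT (g N).
  exact/measurable_EFinP/measurable_funX/L2_meas/LN.
under eq_integral do rewrite -gl.
rewrite monotone_convergence//; last by move=> z _ N M; exact: gmono.
apply: (@le_lt_trans _ _ (n%:R^-1 * C)%:E); last exact: ltry.
apply: lime_le.
  apply: ereal_nondecreasing_is_cvgn => N M NM; apply: ge0_le_integral => //.
  by move=> z _; exact: gmono.
apply: nearW => N; rewrite /g -EFin_Rint; last exact: L2_sqr.
by rewrite lee_fin (L2_partial_process N Ly).2 ler_wpM2l// invr_ge0.
Qed.

Lemma sum_le_sampled_process y C N : (forall i, (0 < i)%N -> L2 (y i)) ->
  L2P' (sampled_process y) -> \int[mu]_z sampled_process y z ^+ 2 <= C ->
  n%:R^-1 * \sum_(1 <= i < N.+1) \int[P]_w y i w ^+ 2 <= C.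
Proof.
move=> Ly LG GC; have [LS <-] := L2_partial_process N Ly.
apply: le_trans GC; apply: le_Rint; [exact: L2_sqr|exact: L2_sqr|] => z.
rewrite -[leLHS]real_normK ?num_real// -[leRHS]real_normK ?num_real//.
by rewrite lerXn2r ?nnegrE// partial_process_le.
Qed.

Lemma sampled_process_pairing y (W : T -> R) s : (forall i, (0 < i)%N -> L2 (y i)) -> L2 W ->
  \int[mu]_z (sampled_process y z * tensor W (sampled s n) z) =
  \sum_(1 <= i < (horizon s * n).+1) step_fun s (i%:R / n%:R) / n%:R * \int[P]_w (y i w * W w).
Proof.
move=> Ly LW; set N := (horizon s * n)%N.
pose u i : T -> R := if (0 < i)%N then fun w => step_fun s (i%:R / n%:R) * (y i w * W w) else fun=> 0.
have Iu i : intg (u i).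
  rewrite /u; case: ltnP => [i0|_]; last exact: intg_cst.
  by apply: intgZ; exact: L2M (Ly i i0) LW.
have I1 i : intgL (if (0 < i)%N then \1_(cell n i) else fun=> 0 : R).
  case: ltnP => [i0|_]; first exact: intg_cell.
  by apply: eq_intg (L2_sqr (L20 leb)) => t; rewrite expr0n.
have e z : sampled_process y z * tensor W (sampled s n) z = \sum_(1 <= i < N.+1)
    tensor (u i) (if (0 < i)%N then \1_(cell n i) else fun=> 0) z.
  case: z => w t; rewrite [RHS](_ : _ = \sum_(1 <= i < N.+1)
    step_fun s (i%:R / n%:R) * (y i w * W w) * \1_(cell n i) t).
    rewrite (sum_cell (fun i => step_fun s (i%:R / n%:R) * (y i w * W w)))//.
    rewrite /tensor/= /sampled (sum_cell (fun i => step_fun s (i%:R / n%:R)))// sampled_processE.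
    by case: (0 < t) => /=; [case: ifP => _|]; rewrite ?mulr0//; ring.
  by apply: eq_big_nat => i /andP[i0 _]; rewrite /u i0.
under eq_Rintegral do rewrite e.
rewrite Rint_sum; last by move=> i; exact: (Rint_tensor (Iu i) (I1 i)).1.
apply: eq_big_nat => i /andP[i0 _].
rewrite (Rint_tensor (Iu i) (I1 i)).2 /u i0 Rint_cell// RintZ; last exact: L2M (Ly i i0) LW.
by rewrite mulrAC.
Qed.

End product_space.

Section fubini.
Context d (T : measurableType d) (R : realType) (P : probability T R).

Notation leb := (@lebesgue_measure R).
Notation mu := (time_product P).

Lemma Rint_not_integrable d' (S : measurableType d') (nu : {measure set S -> \bar R}) (f : S -> R) :
  measurable_fun setT f -> ~ nu.-integrable setT (EFin \o f) -> \int[nu]_x f x = 0.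
Proof.
move=> mf nI; rewrite /Rintegral integralE.
have mEf : measurable_fun setT (EFin \o f) by exact/measurable_EFinP.
set a := (\int[nu]_x _)%E; set b := (\int[nu]_x _)%E.
have a0 : (0 <= a)%E by exact: integral_ge0.
have b0 : (0 <= b)%E by exact: integral_ge0.
case: (ltP a +oo%E) => [aoo|]; last first.
  by rewrite leye_eq => /eqP ->; case: b b0.
case: (ltP b +oo%E) => [boo|]; last first.
  by rewrite leye_eq => /eqP ->; case: a a0 aoo.
exfalso; apply: nI; apply/integrableP; split => //.
rewrite (eq_integral (fun x => ((EFin \o f)^\+ x + (EFin \o f)^\- x)%E)); last first.
  by move=> x _; rewrite -/((abse \o (EFin \o f)) x) fune_abse.
rewrite ge0_integralD//; [exact: lte_add_pinfty|exact: measurable_funepos|exact: measurable_funeneg].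
Qed.

(** Integrals that are not finite have the value 0, so homogeneity needs no
    integrability. This serves the exceptional times at which the integrand of
    an iterated integral is not integrable. *)
Lemma RintZ_total d' (S : measurableType d') (nu : {measure set S -> \bar R}) (f : S -> R) (c : R) :
  measurable_fun setT f -> \int[nu]_x (c * f x) = c * \int[nu]_x f x.
Proof.
move=> mf; have [->|c0] := eqVneq c 0.
  rewrite mul0r; under eq_Rintegral do rewrite mul0r.
  by rewrite /Rintegral integral0.
have [I|nI] := pselect (nu.-integrable setT (EFin \o f)); first exact: RintZ.
rewrite [in RHS]Rint_not_integrable// mulr0 Rint_not_integrable//.
  exact: measurable_funM.
move=> I; apply: nI; apply: eq_intg (intgZ c^-1 I) => x.
by rewrite mulrA mulVf// mul1r.
Qed.

Lemma Rint_fubini (F : T * measurableTypeR R -> R) : mu.-integrable setT (EFin \o F) ->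
  \int[mu]_z F z = \int[leb]_t \int[P]_w F (w, t).
Proof.
move=> IF; have mF : measurable_fun setT (EFin \o F) := measurable_int _ IF.
rewrite /Rintegral -integral12_prod_meas1// /fubini_F.
rewrite (Fubini IF); congr fine; apply: ae_eq_integral => //.
- exact: measurable_fubini_G IF.
- apply/measurable_EFinP; apply: (measurableT_comp (f := fine)) => //.
  exact: measurable_fubini_G IF.
- apply: ae_imply (ae_integrable2 IF) => t It _.
  by rewrite fineK//; exact: integrable_fin_num.
Qed.

(** By Fubini, the pairing of Z with the product of a Wick exponential and its
    step function is the right-hand side of the relation that defines the
    Skorokhod integral. *)
Lemma Rint_pairing_S_transform (B : R -> {RV P >-> R}) (Z : R -> T -> R) s :
  (forall V : T -> R, measurable_fun setT V ->
     S_transform B V (step_fun s) = \int[P]_w (V w * step_wick B s w)) ->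
  step_wick B s \in Lfun P 2%:E ->
  (half_line_process Z : T * measurableTypeR R -> R) \in Lfun mu 2%:E ->
  \int[mu]_z (half_line_process Z z * tensor (step_wick B s) (half_line (step_fun s)) z) =
  \int[leb]_(t in `[0, +oo[) (S_transform B (Z t) (step_fun s) * step_fun s t).
Proof.
move=> SB LW LZ; have [LT _] := L2_tensor LW (L2_half_line_step s).
rewrite (Rint_fubini (L2M LZ LT)) [RHS]Rintegral_mkcond; apply: eq_Rintegral => t _.
rewrite patchE mem_setE in_itv/= andbT.
have zE w : half_line_process Z (w, t) = if 0 <= t then Z t w else 0.
  rewrite /half_line_process patchE/=; case: ifPn => h; case: ifPn => t0 //.
    by move: h; rewrite inE/= => -[_]; rewrite /= in_itv/= andbT (negbTE t0).
  by exfalso; move/negP: h; apply; rewrite inE/=; split => //=; rewrite in_itv/= t0.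
case: ifPn => t0; last first.
  under eq_Rintegral do rewrite zE (negbTE t0) mul0r.
  by rewrite /Rintegral integral0.
have mZ : measurable_fun setT (Z t).
  rewrite (_ : Z t = fun w => half_line_process Z (w, t)); last first.
    by apply/funext => w; rewrite zE t0.
  exact: (measurableT_comp (L2_meas LZ) (pair2_measurable t)).
rewrite SB// mulrC -RintZ_total; last first.
  by apply: measurable_funM => //; exact: L2_meas LW.
by apply: eq_Rintegral => w _; rewrite zE t0 /tensor/= half_line_stepE t0; ring.
Qed.

End fubini.

(** * Passage to the limit in the duality relation *)

Section square_root_bounds.
Context (R : realType).

Lemma abs_le_sqrt_mul (x a e : R) : 0 <= a -> 0 <= e -> x ^+ 2 <= a * e ->
  `|x| <= Num.sqrt e * (2^-1 * (1 + a)).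
Proof.
move=> a0 e0 xa; have b0 : 0 <= 2^-1 * (1 + a) by rewrite mulr_ge0// addr_ge0.
rewrite -(ler_pXn2r (ltn0Sn 1)) ?nnegrE ?(mulr_ge0 (sqrtr_ge0 _) b0)//.
rewrite real_normK ?num_real// exprMn sqr_sqrtr//; apply: (le_trans xa).
rewrite mulrC ler_wpM2l//; have := sqr_ge0 (a - 1); rewrite exprMn !expr2; lra.
Qed.

Lemma cvg0_sqr_le (u v : nat -> R) : (forall n, u n ^+ 2 <= v n) ->
  v n @[n --> \oo] --> (0 : R) -> u n @[n --> \oo] --> (0 : R).
Proof.
move=> uv vc; apply: (@cvgr_dist_squeeze _ _ (fun n => Num.sqrt (v n))).
  move=> n; rewrite subr0 -(ler_pXn2r (ltn0Sn 1)) ?nnegrE ?sqrtr_ge0//.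
  by rewrite real_normK ?num_real// sqr_sqrtr// (le_trans (sqr_ge0 _) (uv n)).
by rewrite -[X in _ --> X]sqrtr0; apply: continuous_cvg => //; exact: sqrt_continuous.
Qed.

End square_root_bounds.

Section weak_limit.
Context d (T : measurableType d) (R : realType) (P : probability T R).
Variables (B : R -> {RV P >-> R}) (xi : {RV P >-> R}) (X : nat -> nat -> {RV P >-> R}).
Variables (y : nat -> nat -> T -> R) (delta : nat -> T -> R) (Z : R -> T -> R).
Implicit Types s : seq (R * R * R).

Notation leb := (@lebesgue_measure R).
Notation mu := (time_product P).
Local Notation mfun f := (measurable_fun [set: T] (f : T -> R)).
Local Notation intg f := (P.-integrable [set: T] (EFin \o (f : T -> R))).
Local Notation L2 f := ((f : T -> R) \in Lfun P 2%:E).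

Hypothesis Lxi : L2 xi.
Hypothesis noise : forall n, white_noise P (fun i => X n i : T -> R).
Hypothesis lawX : forall n i, (0 < i)%N -> identically_distributed (X n i) xi.
Hypothesis walk_cvg : forall t : R, 0 <= t ->
  cvg_in_probability P (fun n => random_walk n.+1 (fun i => X n i) t) (B t).
Hypothesis domain : forall n,
  discrete_skorokhod_integral P n.+1 (fun i => X n i) (y n) (delta n).

Let Ly n i : (0 < i)%N -> L2 (y n i).
Proof. by move=> i0; have [[h _] _ _] := domain n; exact: (h i i0).2. Qed.

Let Ldelta n : L2 (delta n). Proof. by have [] := domain n. Qed.

Let G n := sampled_process n.+1 (y n).

Lemma L2_embedded n : (G n : T * measurableTypeR R -> R) \in Lfun mu 2%:E.
Proof.
have [[_ +] _ _] := domain n; set S := (\sum_(1 <= i <oo) _)%E => Soo.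
have E0 i : (0 <= 'E_P[(fun w => y n i w ^+ 2)%R])%E.
  by rewrite unlock; apply: integral_ge0 => w _; rewrite lee_fin sqr_ge0.
have S0 : (0 <= S)%E by apply: nneseries_ge0.
have fS : S \is a fin_num.
  rewrite ge0_fin_numE// ltey; apply/eqP => e; move: Soo.
  by rewrite e gt0_muley ?ltxx// lte_fin invr_gt0.
apply: (@L2_sampled_process _ _ _ _ _ (ltn0Sn n) _ (fine S)); first exact: Ly.
move=> N; rewrite -lee_fin fineK// -sumEFin.
apply: le_trans (nneseries_lim_ge (m := 1%N) (P := xpredT) N.+1 (fun i _ _ => E0 i)).
rewrite big_nat [leRHS]big_nat; apply: lee_sum => i /andP[i0 _].
by rewrite unlock EFin_Rint//; exact/L2_sqr/Ly.
Qed.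

Let N s n := (horizon s * n.+1)%N.
Let D s n := discrete_wick X s n.
Let sum_sqr s n := \sum_(1 <= i < (N s n).+1) grid s n.+1 i ^+ 2.
Let error s n := 2 * (step_bound s ^+ 2 / n.+1%:R * expR (sum_sqr s n)) +
  2 * \int[P]_w (D s n w - step_wick B s w) ^+ 2.

Let LD s n : L2 (D s n). Proof. exact: L2_discrete_wick noise _ _. Qed.
Let LW s : L2 (step_wick B s). Proof. exact: L2_step_wick Lxi noise lawX walk_cvg _. Qed.

Let error_ge0 s n : 0 <= error s n.
Proof.
rewrite addr_ge0// mulr_ge0//.
  by rewrite mulr_ge0 ?expR_ge0// divr_ge0 ?sqr_ge0.
by apply: Rint_ge0 => w; exact: sqr_ge0.
Qed.

Let error_cvg s : error s n @[n --> \oo] --> (0 : R).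
Proof.
rewrite -[X in _ --> X](_ : 2 * (step_bound s ^+ 2 * 0 * expR (sq_norm s)) + 2 * 0 = 0 :> R); last first.
  by rewrite !(mulr0, mul0r, addr0).
apply: cvgD; apply: cvgMl_tmp; last exact: (discrete_wick_cvg_L2 Lxi noise lawX walk_cvg).
apply: cvgM; last exact: cvg_expR_sum_grid.
by apply: cvgMl_tmp; exact: cvg_harmonic.
Qed.

Lemma omit_error s n i : (0 < i <= N s n)%N ->
  \int[P]_w (wick_prod (fun i => X n i : T -> R) (omit (grid s n.+1) i) (N s n) w - step_wick B s w) ^+ 2
    <= error s n.
Proof.
move=> iN; set V := wick_prod _ _ _.
have [LV _ _] := wick_prod_moments (noise n) (omit (grid s n.+1) i) (N s n).
rewrite -/V in LV.
have I1 := L2_sqr (L2B LV (LD s n)); have I2 := L2_sqr (L2B (LD s n) (LW s)).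
apply: (@le_trans _ _ (2 * \int[P]_w (V w - D s n w) ^+ 2 + 2 * \int[P]_w (D s n w - step_wick B s w) ^+ 2)).
  rewrite -!RintZ// -RintD; [|exact: intgZ|exact: intgZ].
  apply: le_Rint; [exact/L2_sqr/L2B|by apply: intgD; exact: intgZ|] => w.
  rewrite -[V w - step_wick B s w](subrKA (D s n w)).
  move: (V w - _) (_ - step_wick B s w) => p q.
  by have := sqr_ge0 (p - q); rewrite !expr2; lra.
rewrite lerD2r ler_wpM2l//.
apply: (le_trans (wick_prod_omit_dist (noise n) (grid s n.+1) iN)).
rewrite ler_wpM2r ?expR_ge0// ler_pdivlMr//.
exact: grid_bound.
Qed.

(** Compare discrete_duality term by term with the pairing of the sampled
    process: the coefficients agree, and replacing the product without a
    factor by the Wick exponential costs sqrt(error) per term, by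
    Cauchy-Schwarz. The bound sqrt a <= (1 + a) / 2 makes the terms summable. *)
Lemma duality_error s n C : \int[mu]_z G n z ^+ 2 <= C ->
  `|\int[P]_w (delta n w * D s n w) -
    \int[mu]_z (G n z * tensor (step_wick B s) (sampled s n.+1) z)| <=
  step_bound s * Num.sqrt (error s n) * (2^-1 * ((horizon s)%:R + C)).
Proof.
move=> GC; have aN i : (N s n < i)%N -> grid s n.+1 i = 0 by exact: grid_out.
rewrite (discrete_duality (noise n) aN (domain n)).
rewrite (sampled_process_pairing (ltn0Sn n) s (@Ly n) (LW s)) -/(N s n).
have gE i : grid s n.+1 i / Num.sqrt n.+1%:R = step_fun s (i%:R / n.+1%:R) / n.+1%:R.
  by rewrite /grid -mulrA -invfM -expr2 sqr_sqrtr.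
pose A i := \int[P]_w y n i w ^+ 2.
have A0 i : 0 <= A i by apply: Rint_ge0 => w; exact: sqr_ge0.
have K0 := step_bound_ge0 s.
rewrite -sumrB; apply: (le_trans (ler_norm_sum _ _ _)).
apply: (@le_trans _ _ (\sum_(1 <= i < (N s n).+1)
    step_bound s * Num.sqrt (error s n) * 2^-1 * (n.+1%:R^-1 * (1 + A i)))).
  rewrite big_nat [leRHS]big_nat; apply: ler_sum => i /andP[i0]; rewrite ltnS => iN.
  have LV : L2 (wick_prod (fun i => X n i : T -> R) (omit (grid s n.+1) i) (N s n)).
    by have [] := wick_prod_moments (noise n) (omit (grid s n.+1) i) (N s n).
  have LVW := L2B LV (LW s).
  rewrite gE -mulrBr -RintB; [|exact: L2M (Ly _ i0) LV|exact: L2M (Ly _ i0) (LW s)].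
  under eq_Rintegral do rewrite -mulrBr.
  rewrite !normrM -!mulrA ler_pM// ?mulr_ge0//; first exact: step_fun_le.
  rewrite ger0_norm// [leRHS]mulrCA [leRHS]mulrA [leRHS](_ : _ =
    n.+1%:R^-1 * (Num.sqrt (error s n) * (2^-1 * (1 + A i)))); last by ring.
  rewrite ler_wpM2l//; apply: abs_le_sqrt_mul => //.
  apply: (le_trans (L2_cauchy_schwarz (Ly _ i0) LVW)).
  have iN' : (0 < i <= N s n)%N by rewrite i0.
  exact: (ler_wpM2l (A0 i) (omit_error iN')).
rewrite -mulr_sumr -!mulrA !ler_wpM2l ?sqrtr_ge0//.
rewrite -mulr_sumr big_split/= mulrDr lerD//.
  rewrite sumr_const_nat subn1/= -mulr_natl mulr1 /N natrM mulrC mulfK//.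
exact: (sum_le_sampled_process (ltn0Sn n) _ (@Ly n) (L2_embedded n) GC).
Qed.

Hypothesis G_cvg : forall V : T * measurableTypeR R -> R, V \in Lfun mu 2%:E ->
  \int[mu]_z (G n z * V z) @[n --> \oo] --> \int[mu]_z (half_line_process Z z * V z).

(** Three errors vanish: the one in duality_error, the discrete Wick
    exponential against bounded delta n, and the sampled step function against
    bounded G n. What remains is the weak limit of G n. *)
Lemma Rint_delta_wick_cvg s C : (forall n, \int[P]_w delta n w ^+ 2 <= C) ->
  \int[P]_w (delta n w * step_wick B s w) @[n --> \oo] -->
  \int[mu]_z (half_line_process Z z * tensor (step_wick B s) (half_line (step_fun s)) z).
Proof.
move=> dC; have [C' GC] : exists C', forall n, \int[mu]_z G n z ^+ 2 <= C'.
  apply: L2_bounded_of_weak; first exact: L2_embedded.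
  by move=> V LV; apply/cvg_ex; eexists; exact: G_cvg.
have LWs := LW s; have LDs := LD s.
have [LT _] := L2_tensor LWs (L2_half_line_step s).
have LTn n := (L2_tensor LWs (L2_sampled s (ltn0Sn n))).1.
have C0 : 0 <= C by apply: le_trans (dC 0%N); apply: Rint_ge0 => w; exact: sqr_ge0.
have C'0 : 0 <= C' by apply: le_trans (GC 0%N); apply: Rint_ge0 => w; exact: sqr_ge0.
have t1 : \int[P]_w (delta n w * (D s n w - step_wick B s w)) @[n --> \oo] --> (0 : R).
  apply: (@cvg0_sqr_le _ _ (fun n => C * \int[P]_w (D s n w - step_wick B s w) ^+ 2)).
    move=> n; apply: (le_trans (L2_cauchy_schwarz (Ldelta n) (L2B (LDs n) LWs))).
    by rewrite ler_wpM2r//; apply: Rint_ge0 => w; exact: sqr_ge0.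
  rewrite -[X in _ --> X](mulr0 C); apply: cvgMl_tmp.
  exact: (discrete_wick_cvg_L2 Lxi noise lawX walk_cvg).
have t2 : \int[P]_w (delta n w * D s n w) -
    \int[mu]_z (G n z * tensor (step_wick B s) (sampled s n.+1) z) @[n --> \oo] --> (0 : R).
  apply: (@cvgr_dist_squeeze _ _ (fun n =>
    step_bound s * Num.sqrt (error s n) * (2^-1 * ((horizon s)%:R + C')))).
    by move=> n; rewrite subr0; exact: duality_error.
  rewrite -[X in _ --> X](_ : step_bound s * Num.sqrt 0 * (2^-1 * ((horizon s)%:R + C')) = 0); last first.
    by rewrite sqrtr0 mulr0 mul0r.
  apply: cvgM; last exact: cvg_cst.
  apply: cvgMl_tmp; apply: continuous_cvg; first exact: sqrt_continuous.
  exact: error_cvg.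
have t3 : \int[mu]_z (G n z * (tensor (step_wick B s) (sampled s n.+1) z -
    tensor (step_wick B s) (half_line (step_fun s)) z)) @[n --> \oo] --> (0 : R).
  apply: (@cvg0_sqr_le _ _ (fun n => C' * (\int[P]_w step_wick B s w ^+ 2 *
    \int[leb]_t (sampled s n.+1 t - half_line (step_fun s) t) ^+ 2))).
    move=> n; apply: (le_trans (L2_cauchy_schwarz (L2_embedded n) (L2B (LTn n) LT))).
    have [_ <-] := L2_tensor LWs (L2B (L2_sampled s (ltn0Sn n)) (L2_half_line_step s)).
    rewrite (_ : \int[mu]_z (tensor _ _ z - _) ^+ 2 = \int[mu]_z
      tensor (step_wick B s) (fun t => sampled s n.+1 t - half_line (step_fun s) t) z ^+ 2).
      by rewrite ler_wpM2r//; apply: Rint_ge0 => z; exact: sqr_ge0.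
    by apply: eq_Rintegral => z _; rewrite /tensor mulrBr.
  rewrite -[X in _ --> X](_ : C' * (\int[P]_w step_wick B s w ^+ 2 * 0) = 0); last by rewrite !mulr0.
  by apply: cvgMl_tmp; apply: cvgMl_tmp; exact: sampled_cvg_L2.
have t4 := G_cvg LT.
rewrite (_ : (fun n => _) = fun n =>
  (\int[P]_w (delta n w * D s n w) -
    \int[mu]_z (G n z * tensor (step_wick B s) (sampled s n.+1) z)) -
  \int[P]_w (delta n w * (D s n w - step_wick B s w)) +
  \int[mu]_z (G n z * (tensor (step_wick B s) (sampled s n.+1) z -
    tensor (step_wick B s) (half_line (step_fun s)) z)) +
  \int[mu]_z (G n z * tensor (step_wick B s) (half_line (step_fun s)) z)); last first.
  apply/funext => n.
  under [X in _ = _ - X + _ + _]eq_Rintegral do rewrite mulrBr.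
  under [X in _ = _ + X + _]eq_Rintegral do rewrite mulrBr.
  rewrite (RintB (L2M (Ldelta n) (LDs n)) (L2M (Ldelta n) LWs)).
  rewrite (RintB (L2M (L2_embedded n) (LTn n)) (L2M (L2_embedded n) LT)).
  by ring.
have := cvgD (cvgD (cvgB t2 t1) t3) t4; rewrite subrr !add0r.
exact.
Qed.

End weak_limit.

(** * The equivalence *)

Unset Implicit Arguments.

Theorem theorem9 (d : measure_display) (T : measurableType d) (R : realType)
    (P : probability T R)
    (B : R -> {RV P >-> R})
    (xi : {RV P >-> R}) (xin : nat -> nat -> {RV P >-> R})
    (Zn : nat -> nat -> T -> R) (deltaZn : nat -> T -> R) (Z : R -> T -> R)
    (B_brownian : brownian_motion B)
    (F_generated : @measurable d T
       = null_completion P (sigma_gen [set t : R | 0 <= t] (fun t => B t)))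
    (xi_L2 : (xi : T -> R) \in Lfun P 2%:E)
    (xi_mean : ('E_P[xi])%E = 0%E)
    (xi_var : ('V_P[xi])%E = 1%E)
    (xin_indep : forall n, (0 < n)%N ->
       mutual_indep P [set i | (0 < i)%N] (fun i => xin n i))
    (xin_law : forall n i, (0 < n)%N -> (0 < i)%N ->
       identically_distributed (xin n i) xi)
    (Bn_cvg : forall t : R, 0 <= t ->
       cvg_in_probability P
         (fun n => random_walk n (fun i => xin n i) t) (B t))
    (Zn_dom : forall n, (0 < n)%N ->
       discrete_skorokhod_integral P n (fun i => xin n i) (Zn n) (deltaZn n))
    (Z_L2 : half_line_process Z \in Lfun (time_product P) 2%:E)
    (Zn_cvg : weak_cvg (time_product P)
       (fun n => half_line_process (embed_process n (Zn n)))
       (half_line_process Z)) :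
  (ereal_sup [set ('E_P[(fun w => `|deltaZn n w| ^+ 2)%R])%E
             | n in [set n | (0 < n)%N]] < +oo)%E
  <->
  exists2 deltaZ : T -> R,
    skorokhod_integral B Z deltaZ & weak_cvg P deltaZn deltaZ.
Proof.
(* The sequences are indexed from 1, so n.+1 replaces n throughout. *)
pose X n i := xin n.+1 i.
have noise n : white_noise P (fun i => X n i : T -> R).
  apply: (white_noise_of_law xi_L2 xi_mean xi_var); first exact: xin_indep.
  by move=> i i0; exact: xin_law.
have lawX n i : (0 < i)%N -> identically_distributed (X n i) xi by move=> i0; exact: xin_law.
have walk_cvg t : 0 <= t ->
    cvg_in_probability P (fun n => random_walk n.+1 (fun i => X n i) t) (B t).
  by move=> t0 e e0; have := Bn_cvg t t0 e e0; rewrite -cvg_shiftS.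
have dom n := Zn_dom n.+1 (ltn0Sn n).
have Ldelta n : (deltaZn n.+1 : T -> R) \in Lfun P 2%:E by have [] := dom n.
have E_sqr n : ('E_P[(fun w => `|deltaZn n.+1 w| ^+ 2)%R] =
    (\int[P]_w deltaZn n.+1 w ^+ 2)%:E)%E.
  rewrite EFin_Rint; last exact: (L2_sqr (Ldelta n)).
  rewrite unlock.
  by apply: eq_integral => w _; rewrite real_normK ?num_real.
split=> [bounded|[deltaZ _ weak]]; last first.
  have [C bC] : exists C, forall n, \int[P]_w deltaZn n.+1 w ^+ 2 <= C.
    apply: L2_bounded_of_weak => // Y LY; apply/cvg_ex.
    by exists (\int[P]_w (deltaZ w * Y w)); have := weak Y LY; rewrite -cvg_shiftS.
  apply: (@le_lt_trans _ _ C%:E); last exact: ltry.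
  by apply: ge_ereal_sup => _ [[//|n] _ <-]; rewrite E_sqr lee_fin.
set b := ereal_sup _ in bounded.
have leb n : (('E_P[(fun w => `|deltaZn n.+1 w| ^+ 2)%R])%E <= b)%E.
  by apply: ereal_sup_ubound; exists n.+1.
have dC n : \int[P]_w deltaZn n.+1 w ^+ 2 <= fine b.
  have := leb n; rewrite E_sqr => h; have fb : b \is a fin_num.
    by apply: fin_real; rewrite bounded andbT (lt_le_trans _ h)// ltNyr.
  by rewrite -lee_fin (fineK fb).
have G_cvg V : V \in Lfun (time_product P) 2%:E ->
    \int[time_product P]_z (sampled_process n.+1 (Zn n.+1) z * V z) @[n --> \oo] -->
    \int[time_product P]_z (half_line_process Z z * V z).
  by move=> LV; have := Zn_cvg V LV; rewrite -cvg_shiftS.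
have LW s := @L2_step_wick _ _ _ _ _ _ _ xi_L2 noise lawX walk_cvg s.
have EW s := @Rint_step_wick _ _ _ _ _ _ _ xi_L2 noise lawX walk_cvg s.
have SB s V := @S_transform_step _ _ _ _ _ _ noise walk_cvg V s.
have lim s := @Rint_delta_wick_cvg _ _ _ _ _ _ _ _ _ _ xi_L2 noise lawX walk_cvg
  dom G_cvg s _ dC.
have [B0 _ _ _] := B_brownian.
have [|||deltaZ LdZ weak] := @L2_weak_cvg_total _ _ _ P
  (fun f => exists s, f = step_wick B s) (fun n => deltaZn n.+1) (fine b) _ _ Ldelta dC.
- by move=> _ [s ->].
- move=> Y LY Y0; apply: (step_wick_total LW EW B0 F_generated LY) => s.
  by apply: Y0; exists s.
- by move=> _ [s ->]; apply/cvg_ex; eexists; exact: lim.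
exists deltaZ; last first.
  by move=> Y LY; rewrite -cvg_shiftS; exact: weak.
split => // _ [s ->].
rewrite SB; last exact: L2_meas LdZ.
rewrite -Rint_pairing_S_transform//; last exact: SB.
apply: (cvg_unique _ (weak _ (LW s)) (lim s)); exact: norm_hausdorff.
Qed.
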